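(* Let $n\ge3$, let $\mathbb B\subset\mathbb R^n$ be the open unit ball and let $\mathbf I=\{(t,x)\in\mathbb R\times\mathbb R^{n-1}: 0\le t<1,\ |x|=0\}$. Then $\mathbb B$ and $\mathbb B\setminus\mathbf I$ are not of the same bi-conformal energy type; that is, there is no homeomorphism $h$ of $\mathbb B$ onto $\mathbb B\setminus\mathbf I$ of finite bi-conformal energy.
   Context: A homeomorphism $h\colon\mathbb X\to\mathbb Y$ of a bounded domain $\mathbb X\subset\mathbb R^n$ onto a bounded domain $\mathbb Y\subset\mathbb R^n$ is of finite bi-conformal energy if $h\in W^{1,n}(\mathbb X,\mathbb R^n)$ and its inverse $f=h^{-1}\colon\mathbb Y\to\mathbb X$ belongs to $W^{1,n}(\mathbb Y,\mathbb R^n)$, equivalently $\int_{\mathbb X}|Dh|^n\,dx+\int_{\mathbb Y}|Df|^n\,dy<\infty$ for Sobolev $h$ and $f$. Here $\mathbb R^n$ is identified with $\mathbb R\times\mathbb R^{n-1}$. *)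

(* Defs.v *)
From HB Require Import structures.
From mathcomp Require Import all_boot all_order all_algebra.
From mathcomp Require Import all_classical all_reals all_analysis.

Set Implicit Arguments.
Unset Strict Implicit.
Unset Printing Implicit Defensive.
Import Order.TTheory GRing.Theory Num.Theory.
Import numFieldNormedType.Exports.

Local Open Scope classical_set_scope.
Local Open Scope ring_scope.

Definition measure_rV_display : measure_display -> measure_display.
Proof. exact. Qed.

(* The product sigma-algebra, set up as for [n.-tuple R]; on R^n it coincides
   with the Borel sigma-algebra. *)
Section measurable_rV.
Context {R : realType}.
Variable n : nat.

Let coors : 'I_n -> 'rV[R]_n -> R := fun i x => x ord0 i.

Let rV_set0 : g_sigma_preimage coors set0.
Proof. exact: sigma_algebra0. Qed.

Let rV_setC A : g_sigma_preimage coors A -> g_sigma_preimage coors (~` A).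
Proof. exact: sigma_algebraC. Qed.

Let rV_bigcup (F : _^nat) : (forall i, g_sigma_preimage coors (F i)) ->
  g_sigma_preimage coors (\bigcup_i (F i)).
Proof. exact: sigma_algebra_bigcup. Qed.

HB.instance Definition _ :=
  @isMeasurable.Build (measure_rV_display default_measure_display)
    'rV[R]_n (g_sigma_preimage coors) rV_set0 rV_setC rV_bigcup.

End measurable_rV.

Section lebesgue_rV.
Context {R : realType}.

Definition cons_rV n (p : measurableTypeR R * 'rV[R]_n) : 'rV[R]_n.+1 :=
  row_mx (p.1)%:M p.2.

Lemma measurable_coord n (i : 'I_n) :
  measurable_fun [set: 'rV[R]_n] (fun x : 'rV[R]_n => x ord0 i).
Proof.
move=> _ Y mY; rewrite setTI; apply: sub_sigma_algebra => /=.
rewrite -bigcup_seq/=; exists i => /=; first by rewrite mem_index_enum.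
by exists Y => //; rewrite setTI.
Qed.

Lemma measurable_rVP d (T : measurableType d) n (f : T -> 'rV[R]_n) :
  (forall i, measurable_fun [set: T] (fun x => f x ord0 i)) ->
  measurable_fun [set: T] f.
Proof.
move=> mf; suff H : measurable `<=` [set A | measurable (f @^-1` A)].
  by move=> _ A mA; rewrite setTI; exact: H.
apply: smallest_sub => [|A].
  split=> [|A /= mA|F /= mF].
  - by rewrite /= preimage_set0; exact: measurable0.
  - by rewrite setTD preimage_setC; exact: measurableC.
  - by rewrite preimage_bigcup; exact: bigcup_measurable.
rewrite -bigcup_seq/= => -[i _ [B mB <-]]; rewrite setTI.
by have := mf i measurableT B mB; rewrite setTI.
Qed.

Definition uncons_rV n (v : 'rV[R]_n.+1) : measurableTypeR R * 'rV[R]_n :=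
  (v ord0 ord0, \row_j v ord0 (lift ord0 j)).

Lemma cons_rV0 n p : @cons_rV n p ord0 ord0 = p.1.
Proof.
rewrite /cons_rV (_ : ord0 = lshift n (ord0 : 'I_1)); last exact/val_inj.
by rewrite (row_mxEl (p.1)%:M p.2) mxE eqxx mulr1n.
Qed.

Lemma cons_rVS n p j : @cons_rV n p ord0 (lift ord0 j) = p.2 ord0 j.
Proof.
rewrite /cons_rV (_ : lift ord0 j = rshift 1 j); last exact/val_inj.
by rewrite (row_mxEr (p.1)%:M p.2).
Qed.

Lemma cons_rVK n : cancel (@cons_rV n) (@uncons_rV n).
Proof.
move=> [t v]; rewrite /uncons_rV cons_rV0; congr pair.
by apply/rowP => j; rewrite mxE cons_rVS.
Qed.

Lemma measurable_cons_rV n : measurable_fun setT (@cons_rV n).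
Proof.
apply: measurable_rVP => i; have [j ->|->] := unliftP ord0 i.
  rewrite [X in measurable_fun _ X](_ : _ =
      (fun v : 'rV[R]_n => v ord0 j) \o snd).
    exact: (measurableT_comp (measurable_coord j) measurable_snd).
  by apply/funext => p; rewrite cons_rVS.
rewrite [X in measurable_fun _ X](_ : _ = (fst : measurableTypeR R * 'rV[R]_n -> R)).
  exact: measurable_fst.
by apply/funext => p; rewrite cons_rV0.
Qed.

Lemma measurable_uncons_rV n : measurable_fun setT (@uncons_rV n).
Proof.
apply/measurable_fun_pair; first exact: (measurable_coord ord0).
apply: measurable_rVP => j.
rewrite [X in measurable_fun _ X](_ : _ = (fun v : 'rV[R]_n.+1 => v ord0 (lift ord0 j))).
  exact: measurable_coord.
by apply/funext => v; rewrite mxE.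
Qed.

Section step.
Variables (n : nat) (mu : {sigma_finite_measure set 'rV[R]_n -> \bar R}).
Local Open Scope ereal_scope.

Definition lebesgue_step : set 'rV[R]_n.+1 -> \bar R :=
  pushforward (lebesgue_measure \x mu) (@cons_rV n).

Let step0 : lebesgue_step set0 = 0.
Proof. by rewrite /lebesgue_step /pushforward preimage_set0 measure0. Qed.

Let step_ge0 A : 0 <= lebesgue_step A.
Proof. by rewrite /lebesgue_step /pushforward measure_ge0. Qed.

Let step_sigma_additive : semi_sigma_additive lebesgue_step.
Proof.
move=> F mF tF mUF; rewrite /lebesgue_step /pushforward preimage_bigcup.
apply: measure_semi_sigma_additive.
- by move=> k; rewrite -[X in measurable X]setTI; exact: measurable_cons_rV.
- apply/trivIsetP => /= i j _ _ ij; rewrite -preimage_setI.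
  by move/trivIsetP : tF => /(_ _ _ _ _ ij) ->//; rewrite preimage_set0.
- by rewrite -preimage_bigcup -[X in measurable X]setTI; exact: measurable_cons_rV.
Qed.

HB.instance Definition _ := isMeasure.Build _ _ _
  lebesgue_step step0 step_ge0 step_sigma_additive.

Let step_sigma_finite : sigma_finite setT lebesgue_step.
Proof.
have /sigma_finiteP[F [TF ndF Foo]] := sigma_finiteT (@lebesgue_measure R).
have /sigma_finiteP[G [TG ndG Goo]] := sigma_finiteT mu.
exists (fun k => @uncons_rV n @^-1` (F k `*` G k)).
  rewrite -preimage_bigcup (_ : \bigcup_k _ = setT) ?preimage_setT//.
  rewrite -setXTT TF TG predeqE => -[x y]; split; last first.
    move=> [/= [i _ Fix] [j _ Gjy]]; exists (maxn i j) => //; split.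
    - by move: x Fix; exact/subsetPset/ndF/leq_maxl.
    - by move: y Gjy; exact/subsetPset/ndG/leq_maxr.
  by move=> [i _ []/= ? ?]; split; exists i.
move=> k; have [mF Fk] := Foo k; have [mG Gk] := Goo k; split.
  rewrite -[X in measurable X]setTI; apply: measurable_uncons_rV => //.
  exact: measurableX.
rewrite /lebesgue_step /pushforward -comp_preimage.
rewrite (_ : _ \o _ = id) ?preimage_id; last exact/funext/cons_rVK.
by rewrite product_measure1E// lte_mul_pinfty// ge0_fin_numE.
Qed.

HB.instance Definition _ := Measure_isSigmaFinite.Build _ _ _
  lebesgue_step step_sigma_finite.

End step.

Fixpoint lebesgue_rV n : {sigma_finite_measure set 'rV[R]_n -> \bar R} :=
  match n with
  | 0 => dirac (0 : 'rV[R]_0)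
  | n'.+1 => lebesgue_step (lebesgue_rV n')
  end.

End lebesgue_rV.

Section finite_biconformal_energy.
Context {R : realType}.

Section sobolev.
Variable n : nat.
Implicit Types (Omega : set 'rV[R]_n) (u g phi : 'rV[R]_n -> R).

Definition smooth phi := forall (s : seq 'rV[R]_n) (x : 'rV[R]_n),
  differentiable (foldr (fun v psi => 'D_v psi) phi s) x.

Definition test_function Omega phi :=
  [/\ smooth phi, compact (closure [set x | phi x != 0]) &
      closure [set x | phi x != 0] `<=` Omega].

(* Meaningful for u and g locally integrable on the open set Omega. *)
Definition weak_partial Omega (i : 'I_n) u g :=
  forall phi, test_function Omega phi ->
    (\int[lebesgue_rV n]_(x in Omega) (u x * 'D_(delta_mx ord0 i) phi x)%:E =
     - \int[lebesgue_rV n]_(x in Omega) (g x * phi x)%:E)%E.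

Definition Lp_on (p : \bar R) Omega u := u \_ Omega \in Lfun (lebesgue_rV n) p.

(* W^{1,p}(Omega), for 1 <= p *)
Definition W1p (p : \bar R) Omega u :=
  Lp_on p Omega u /\
  forall i, exists2 g, Lp_on p Omega g & weak_partial Omega i u g.

(* W^{1,p}(Omega, R^m) *)
Definition W1p_vec (p : \bar R) Omega m (h : 'rV[R]_n -> 'rV[R]_m) :=
  forall j : 'I_m, W1p p Omega (fun x => h x ord0 j).

End sobolev.

Section domains.
Variable n : nat.
Implicit Types (X Y : set 'rV[R]_n) (h f : 'rV[R]_n -> 'rV[R]_n).

(* h restricts to a homeomorphism of X onto Y whose inverse is the restriction
   of f to Y; the values of h off X and of f off Y are irrelevant. *)
Definition homeomorphism_onto X Y h f :=
  [/\ h @` X = Y, {in X, cancel h f},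
      {within X, continuous h} & {within Y, continuous f}].

Definition finite_biconformal_energy X Y h := exists f,
  [/\ homeomorphism_onto X Y h f,
      W1p_vec n%:R%:E X h & W1p_vec n%:R%:E Y f].

Definition same_biconformal_type X Y :=
  exists h, finite_biconformal_energy X Y h.

(* The norm `|x| of the library is the sup norm. *)
Definition euclidean_norm (x : 'rV[R]_n) : R :=
  Num.sqrt (\sum_i x ord0 i ^+ 2).

Definition unit_ball : set 'rV[R]_n := [set x | euclidean_norm x < 1].

(* The points (t, 0) of R x R^(n-1) with 0 <= t < 1. *)
Definition slit : set 'rV[R]_n :=
  [set \row_(i < n) (if i == 0%N :> nat then t else 0) | t in `[0, 1[].

End domains.

End finite_biconformal_energy.

Arguments unit_ball R n : clear implicits.
Arguments slit R n : clear implicits.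

(* Main.v *)
From HB Require Import structures.
Require Import Defs.
From mathcomp Require Import all_boot all_order all_algebra.
From mathcomp Require Import all_classical all_reals all_analysis.
From mathcomp Require Import measurable_realfun.
From mathcomp Require Import ring lra.

(** Why the theorem holds.

Let B be the ball, I the slit, h a homeomorphism of B onto B \ I and f its
inverse, and suppose that both have finite energy.  Preimages of compact sets
are compact, so f (y) tends to the sphere as y tends to the slit
([inverse_proper]).

First, look at f on the hyperplane slices {t} x R^(n-1).  Such a slice meets
the slit in one point, and for many t the n-energy of f on it is controlled by
the energy of f ([pick_slice]).  The exponent n exceeds the dimension n - 1 of
the slice, so the oscillation of f over a convex part of diameter l is at most
a constant times theta + C theta^(1-n) l, for every theta > 0: this is Morrey's
estimate, with Young's inequality in the role of Hoelder's
([slice_oscillation]).  Since n - 1 >= 2, a small punctured cube around the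
puncture (t, 0) is covered by convex half cubes that overlap in a chain, and f
has a limit q at (t, 0) along the slice ([puncture_limit]); q is on the sphere.

Next, take a thin box around the part of the slit with first coordinate below
t, whose top face lies in the slice of t.  The boundary of the box without the
puncture lies in B \ I, and its image T under f accumulates on the sphere at q
only.  The sphere without q is connected, hence near it, away from q, all points
of B off T belong to the image of the same side of the box, the inside or the
outside ([one_sided]).  So points of the other side that tend to the slit
are mapped by f to points that tend to q.  On that side, move toward two
points of the slit with different first coordinates a and a' while keeping the
first coordinate fixed: the image curves both end at q, and the first
coordinate of h is a on one and a' on the other.

Finally, this is impossible, because a continuous W^(1,n) function on B cannot
have two values along two curves that end at the same boundary point
([asymptotic_values_coincide]).  Close to q the energy is small, and so is the
oscillation on well chosen hyperplane pieces of size rho, at every scale rho;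
the faces of a suitable box around q cross both curves and the parts of them
inside B hang together.

The Morrey estimate is obtained without absolute continuity on lines or
restriction of Sobolev functions to hyperplanes.  On a compact set, a mollified
copy of u at a scale small enough for uniform closeness has increments that are
bounded through the definition of weak derivatives by the mollification of
|Du|^n, whose integral is at most the energy ([mollify]).  All estimates are
then estimates on a nonnegative measurable function, and slices are chosen for
that function. *)

Set Implicit Arguments.
Unset Strict Implicit.
Unset Printing Implicit Defensive.
Import Order.TTheory GRing.Theory Num.Theory.
Import numFieldNormedType.Exports.

Local Open Scope classical_set_scope.
Local Open Scope ring_scope.

(** * Lebesgue measure: Fubini along a coordinate, affine changes of variable *)

Section insert.
Context {R : realType}.

(** Insertion of the coordinate [p.1] at position [i]: the inverse of
the splitting of R^(n+1) as the i-th axis times the hyperplane orthogonal to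
it. *)
Definition ins_rV n (i : 'I_n.+1) (p : measurableTypeR R * 'rV[R]_n) : 'rV[R]_n.+1 :=
  \row_j (if unlift i j is Some k then p.2 ord0 k else p.1).

Lemma ins_rV_i n (i : 'I_n.+1) p : ins_rV i p ord0 i = p.1.
Proof. by rewrite mxE unlift_none. Qed.

Lemma ins_rV_lift n (i : 'I_n.+1) p k : ins_rV i p ord0 (lift i k) = p.2 ord0 k.
Proof. by rewrite mxE liftK. Qed.

Lemma ins_rV0 n : @ins_rV n ord0 = @cons_rV R n.
Proof.
apply/funext => p; apply/rowP => j; have [k ->|->] := unliftP ord0 j.
  by rewrite ins_rV_lift cons_rVS.
by rewrite ins_rV_i cons_rV0.
Qed.

Lemma measurable_ins_rV n (i : 'I_n.+1) : measurable_fun setT (ins_rV i).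
Proof.
apply: measurable_rVP => j; have [k ->|->] := unliftP i j.
  rewrite (_ : (fun p => _) = (fun v : 'rV[R]_n => v ord0 k) \o snd).
    exact: (measurableT_comp (measurable_coord k) measurable_snd).
  by apply/funext => p; rewrite ins_rV_lift.
rewrite (_ : (fun p => _) = (fst : measurableTypeR R * 'rV[R]_n -> R)).
  exact: measurable_fst.
by apply/funext => p; rewrite ins_rV_i.
Qed.

Lemma ins_rV_comm n (i : 'I_n.+1) (s t : R) (z : 'rV[R]_n) :
  ins_rV (lift ord0 i) (s, cons_rV (t, z)) = cons_rV (t, ins_rV i (s, z)).
Proof.
apply/rowP => j; have [k ->|->] := unliftP (lift ord0 i) j.
  rewrite ins_rV_lift/=; have [l ->|->] := unliftP ord0 k.
    rewrite cons_rVS/=.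
    rewrite (_ : lift (lift ord0 i) (lift ord0 l) = lift ord0 (lift i l)); last first.
      by apply/val_inj; rewrite /= /bump/= !add1n ltnS addnS.
    by rewrite cons_rVS/= ins_rV_lift.
  by rewrite cons_rV0/= (_ : lift (lift ord0 i) ord0 = ord0) ?cons_rV0//; exact/val_inj.
by rewrite ins_rV_i/= cons_rVS/= ins_rV_i.
Qed.

Local Open Scope ereal_scope.

Lemma lebesgue_rVS n (A : set 'rV[R]_n.+1) : measurable A ->
  lebesgue_rV n.+1 A = \int[lebesgue_measure]_t lebesgue_rV n [set w | A (cons_rV (t, w))].
Proof.
move=> mA; rewrite /= /lebesgue_step /pushforward /product_measure1.
apply: eq_integral => t _ /=; congr (lebesgue_rV n _).
by apply/seteqP; split => w; rewrite /xsection /= inE.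
Qed.

Lemma measurable_preimageT d d' (T : measurableType d) (T' : measurableType d')
  (f : T -> T') (A : set T') : measurable_fun setT f -> measurable A ->
  measurable (f @^-1` A).
Proof. by move=> mf mA; rewrite -[X in measurable X]setTI; exact: mf. Qed.

Lemma measurable_pair_cst d d' (T : measurableType d) (T' : measurableType d') (t : T) :
  measurable_fun setT (fun w : T' => (t, w)).
Proof. by apply/measurable_fun_pair; [exact: measurable_cst|exact: measurable_id]. Qed.

(** The measure is built by adding coordinates in front, so
that only the splitting off of the first one is immediate.  Induction on the
dimension: exchange the first two coordinates by Tonelli, and apply the
hypothesis to the slice. *)
Lemma lebesgue_rV_ins n (i : 'I_n.+1) (A : set 'rV[R]_n.+1) : measurable A ->
  lebesgue_rV n.+1 A = (lebesgue_measure \x lebesgue_rV n) (ins_rV i @^-1` A).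
Proof.
elim: n i A => [|n IH] i A mA.
  by rewrite (_ : i = ord0) ?ins_rV0//; apply/val_inj; case: i => -[].
have [i' ->|->] := unliftP ord0 i; last by rewrite ins_rV0.
transitivity (\int[lebesgue_measure]_t lebesgue_rV n.+1 [set w | A (cons_rV (t, w))]).
  exact: lebesgue_rVS.
transitivity (\int[lebesgue_measure]_t \int[lebesgue_measure]_s
  lebesgue_rV n [set z | A (cons_rV (t, ins_rV i' (s, z)))]).
  apply: eq_integral => t _.
  have mB : measurable [set w | A (cons_rV (t, w))].
    apply: measurable_preimageT mA.
    exact: (measurableT_comp (measurable_cons_rV (n:=n.+1)) (measurable_pair_cst t)).
  rewrite (IH i')// /product_measure1; apply: eq_integral => s _ /=.
  by congr (lebesgue_rV n _); apply/seteqP; split => w; rewrite /xsection /= inE.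
pose g (p : measurableTypeR R * measurableTypeR R) := lebesgue_rV n [set z | A (cons_rV (p.1, ins_rV i' (p.2, z)))].
have mg : measurable_fun [set: measurableTypeR R * measurableTypeR R] g.
  pose B := [set q : (measurableTypeR R * measurableTypeR R) * 'rV[R]_n | A (cons_rV (q.1.1, ins_rV i' (q.1.2, q.2)))].
  have mB : measurable B.
    apply: (measurable_preimageT (f := fun q : (measurableTypeR R * measurableTypeR R) * 'rV[R]_n =>  cons_rV (q.1.1, ins_rV i' (q.1.2, q.2)))) mA.
    apply: (measurableT_comp (measurable_cons_rV (n:=n.+1))).
    apply/measurable_fun_pair => /=.
      exact: (measurableT_comp measurable_fst measurable_fst).
    apply: (measurableT_comp (measurable_ins_rV i')).
    apply/measurable_fun_pair => /=; last exact: measurable_snd.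
    exact: (measurableT_comp measurable_snd measurable_fst).
  have := measurable_fun_xsection (lebesgue_rV n) mB.
  apply: eq_measurable_fun => -[t s] _ /=; rewrite /g/=.
  by congr (lebesgue_rV n _); apply/seteqP; split => w; rewrite /xsection /= inE.
transitivity (\int[lebesgue_measure]_s \int[lebesgue_measure]_t g (t, s)).
  by apply: (fubini_tonelli g) => // p; exact: measure_ge0.
rewrite [RHS]/product_measure1; apply: eq_integral => s _ /=.
etransitivity; last first.
  apply/esym/lebesgue_rVS.
  apply: measurable_xsection.
  exact: measurable_preimageT (measurable_ins_rV _) mA.
apply: eq_integral => t _; rewrite /g/=.
by congr (lebesgue_rV n _); apply/seteqP; split => w; rewrite /xsection /= inE /= ins_rV_comm.
Qed.

Lemma integral_rV_ins n (i : 'I_n.+1) (f : 'rV[R]_n.+1 -> \bar R) :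
  measurable_fun setT f -> (forall x, 0 <= f x) ->
  \int[lebesgue_rV n.+1]_x f x =
  \int[lebesgue_measure]_t \int[lebesgue_rV n]_w f (ins_rV i (t, w)).
Proof.
move=> mf f0.
rewrite -(fubini_tonelli1 (f \o ins_rV i)); last 2 first.
- by apply: measurableT_comp => //; exact: measurable_ins_rV.
- by move=> p; exact: f0.
transitivity (\int[pushforward (lebesgue_measure \x lebesgue_rV n) (ins_rV i)]_x f x).
  apply: eq_measure_integral => [|mi A mA _]; first exact: measurable_ins_rV.
  exact: lebesgue_rV_ins.
exact: (ge0_integral_pushforward (measurable_ins_rV i)).
Qed.

(** Both affine changes of variable, on the line and in
R^n, are instances: it is enough to know how the measure of sets scales. *)
Lemma ge0_integral_rescale d (T : measurableType d) (mu : {measure set T -> \bar R})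
    (phi : T -> T) (k : R) (f : T -> \bar R) : (0 <= k)%R ->
  measurable_fun setT phi ->
  (forall A, measurable A -> mu (phi @^-1` A) = k%:E * mu A) ->
  measurable_fun setT f -> (forall x, 0 <= f x) ->
  \int[mu]_x f (phi x) = k%:E * \int[mu]_x f x.
Proof.
move=> k0 mphi muphi mf f0.
pose k' := NngNum k0.
rewrite -(ge0_integral_mscale mu measurableT k' mf)//.
transitivity (\int[pushforward mu phi]_x f x).
  by rewrite (ge0_integral_pushforward mphi).
apply: eq_measure_integral => A mA _.
exact: muphi.
Qed.

Lemma measurable_affine (s b : R) :
  measurable_fun setT (fun x : measurableTypeR R => (s * x + b)%R : measurableTypeR R).
Proof. by apply: measurable_funD => //; exact: measurable_funM. Qed.

Lemma lebesgue_measure_affine (s b : R) (A : set (measurableTypeR R)) : (0 < s)%R -> measurable A ->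
  lebesgue_measure ((fun x => s * x + b)%R @^-1` A) = s^-1%:E * lebesgue_measure A.
Proof.
move=> s0 mA; have s0' := ltW s0; pose k := NngNum s0'.
have mp := measurable_affine s b.
pose F : {mfun _ >-> _} := HB.pack (fun x : measurableTypeR R => (s * x + b)%R : measurableTypeR R) (isMeasurableFun.Build _ _ _ _ _ mp).
have e : lebesgue_measure A = s%:E * lebesgue_measure (F @^-1` A).
  apply: (@lebesgue_measure_unique R (mscale k (pushforward lebesgue_measure F))) => //.
  move=> _ [[a c] ] _ <-.
  have pre : F @^-1` (`]a, c]%classic : set R) = `]((a - b) / s)%R, ((c - b) / s)%R]%classic.
    apply/seteqP; split => x /=; rewrite !in_itv/= ltr_pdivrMr// ler_pdivlMr// mulrC;
    by rewrite ltrBlDr lerBrDr.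
  transitivity (s%:E * lebesgue_measure (`]((a - b) / s)%R, ((c - b) / s)%R]%classic : set R)); last by rewrite -pre.
  rewrite !lebesgue_measure_itv/= !lte_fin ltr_pM2r ?invr_gt0// ltrD2r.
  case: ifPn => _; last by rewrite mule0.
  rewrite -!EFinD -EFinM; congr EFin; field; exact: lt0r_neq0.
by rewrite e muleA -EFinM mulVf ?mul1e// lt0r_neq0.
Qed.

Lemma measurable_affine_rV n (s : R) (b : 'rV[R]_n) :
  measurable_fun setT (fun x : 'rV[R]_n => s *: x + b)%R.
Proof.
apply: measurable_rVP => i.
rewrite (_ : (fun x => _) = (fun t : measurableTypeR R => s * t + b ord0 i)%R \o (fun x : 'rV[R]_n => x ord0 i)).
  exact: (measurableT_comp (measurable_affine _ _) (measurable_coord i)).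
by apply/funext => x; rewrite !mxE.
Qed.

Lemma lebesgue_rV_affine n (s : R) (b : 'rV[R]_n) (A : set 'rV[R]_n) : (0 < s)%R -> measurable A ->
  lebesgue_rV n ((fun x => s *: x + b)%R @^-1` A) = (s^-1 ^+ n)%:E * lebesgue_rV n A.
Proof.
move=> s0; elim: n b A => [|n IH] b A mA.
  rewrite expr0 mul1e; congr (lebesgue_rV 0 _).
  by apply/seteqP; split => x /=; rewrite [(_ *: _ + _)%R]thinmx0 [x]thinmx0.
have mB : measurable ((fun x => s *: x + b)%R @^-1` A) by exact: measurable_preimageT (measurable_affine_rV _ _) mA.
have mS t : measurable [set w | A (cons_rV (t, w))].
  apply: measurable_preimageT mA.
  exact: (measurableT_comp (measurable_cons_rV (n:=n)) (measurable_pair_cst t)).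
pose F (t : measurableTypeR R) := lebesgue_rV n [set w | A (cons_rV (t, w))].
have mF : measurable_fun setT F.
  pose B := [set q : measurableTypeR R * 'rV[R]_n | A (cons_rV q)].
  have mBB : measurable B by exact: measurable_preimageT (measurable_cons_rV (n:=n)) mA.
  have := measurable_fun_xsection (lebesgue_rV n) mBB.
  apply: eq_measurable_fun => t _ /=; rewrite /F/=.
  by congr (lebesgue_rV n _); apply/seteqP; split => w; rewrite /xsection /= inE.
transitivity (\int[lebesgue_measure]_t lebesgue_rV n [set w | ((fun x => s *: x + b)%R @^-1` A) (cons_rV (t, w))]).
  exact: lebesgue_rVS.
pose b' := (\row_j b ord0 (lift ord0 j))%R.
transitivity (\int[lebesgue_measure]_t ((s^-1 ^+ n)%:E * F (s * t + b ord0 ord0)%R)).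
  apply: eq_integral => t _; rewrite /F -(IH b')//; congr (lebesgue_rV n _).
  have e w : (s *: cons_rV (t, w) + b = cons_rV (s * t + b ord0 ord0, s *: w + b'))%R.
    apply/rowP => j; rewrite [LHS]mxE [X in (X + _)%R]mxE.
    have [k ->|->] := unliftP ord0 j; last by rewrite !cons_rV0.
    by rewrite !cons_rVS/= !mxE.
  by apply/seteqP; split => w /=; rewrite e.
rewrite ge0_integralZl//; last 2 first.
- exact: (measurableT_comp mF (measurable_affine _ _)).
- by rewrite lee_fin exprn_ge0// invr_ge0 ltW.
rewrite (ge0_integral_rescale (phi := fun t : measurableTypeR R => (s * t + b ord0 ord0)%R : measurableTypeR R) (k := s^-1)); last 5 first.
- by rewrite invr_ge0 ltW.
- exact: measurable_affine.
- by move=> B mB2; exact: lebesgue_measure_affine.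
- exact: mF.
- by move=> t; exact: measure_ge0.
by rewrite muleA -EFinM -exprSr; congr (_ * _); exact/esym/lebesgue_rVS.
Qed.

Lemma integral_rV_affine n (s : R) (b : 'rV[R]_n) (f : 'rV[R]_n -> \bar R) : (0 < s)%R ->
  measurable_fun setT f -> (forall x, 0 <= f x) ->
  \int[lebesgue_rV n]_x f (s *: x + b)%R = (s^-1 ^+ n)%:E * \int[lebesgue_rV n]_x f x.
Proof.
move=> s0 mf f0.
apply: (ge0_integral_rescale (phi := (fun x : 'rV[R]_n => s *: x + b : 'rV[R]_n)%R)) => //.
- by rewrite exprn_ge0// invr_ge0 ltW.
- exact: measurable_affine_rV.
- by move=> A mA; exact: lebesgue_rV_affine.
Qed.

End insert.

(** * The sup norm, Borel sets and boxes *)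

Section borel.
Context {R : realType}.

Lemma rV_norm_le n (x : 'rV[R]_n) (e : R) : 0 <= e ->
  (forall i, `|x ord0 i| <= e) -> `|x| <= e.
Proof.
move=> e0 H; rewrite /Num.norm/= mx_normrE; apply/bigmax_leP; split => // -[i j] _ /=.
by rewrite (ord1 i).
Qed.

Lemma rV_norm_lt n (x : 'rV[R]_n) (e : R) : 0 < e ->
  (forall i, `|x ord0 i| < e) -> `|x| < e.
Proof.
move=> e0 H; rewrite /Num.norm/= mx_normrE; apply/bigmax_ltP; split => // -[i j] _ /=.
by rewrite (ord1 i).
Qed.

Lemma coord_norm_le n (x : 'rV[R]_n) i : `|x ord0 i| <= `|x|.
Proof.
by rewrite [leRHS]/Num.norm /= mx_normrE; apply/bigmax_geP; right => /=; exists (ord0, i).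
Qed.

Lemma norm_const_row n (s : R) : (0 < n)%N -> 0 <= s -> `|const_mx s : 'rV[R]_n| = s.
Proof.
move=> n0 s0; apply/le_anti/andP; split; last first.
  by apply: le_trans (coord_norm_le _ (Ordinal n0)); rewrite mxE ger0_norm.
by apply: rV_norm_le => // j; rewrite mxE ger0_norm.
Qed.

Lemma ball_rV n (x y : 'rV[R]_n) (e : R) : ball x e y = (`|x - y| < e) :> Prop.
Proof. by rewrite -ball_normE. Qed.

Lemma measurable_coord_lt n (i : 'I_n) (a b : R) :
  measurable [set x : 'rV[R]_n | a < x ord0 i < b].
Proof.
rewrite (_ : mkset _ = (fun x : 'rV[R]_n => x ord0 i) @^-1` `]a, b[%classic).
  by apply: measurable_preimageT; [exact: measurable_coord|exact: measurable_itv].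
by apply/seteqP; split => x /=; rewrite in_itv.
Qed.

Lemma measurable_coord_le n (i : 'I_n) (a b : R) :
  measurable [set x : 'rV[R]_n | a <= x ord0 i <= b].
Proof.
rewrite (_ : mkset _ = (fun x : 'rV[R]_n => x ord0 i) @^-1` `[a, b]%classic).
  by apply: measurable_preimageT; [exact: measurable_coord|exact: measurable_itv].
by apply/seteqP; split => x /=; rewrite in_itv.
Qed.

Lemma measurable_forall_ord n m (P : 'I_m -> 'rV[R]_n -> Prop) :
  (forall i, measurable [set x | P i x]) -> measurable [set x | forall i, P i x].
Proof.
move=> mP; rewrite (_ : mkset _ = \bigcap_(i in [set: 'I_m]) [set x | P i x]).
  by apply: fin_bigcap_measurable => // i _; exact: mP.
by apply/seteqP; split => x /= H i //=; exact: H.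
Qed.

(** The sigma-algebra is generated by the coordinates, the
topology by the sup norm: an open set is a countable union of rational cubes. *)
Lemma open_measurable_rV n (U : set 'rV[R]_n) : open U -> measurable U.
Proof.
move=> oU.
pose B (p : 'rV[rat]_n * nat) := [set x : 'rV[R]_n | forall i,
  ratr (p.1 ord0 i) - p.2.+1%:R^-1 < x ord0 i < ratr (p.1 ord0 i) + p.2.+1%:R^-1].
have mB p : measurable (B p).
  by apply: measurable_forall_ord => i; exact: measurable_coord_lt.
pose F (k : nat) : set 'rV[R]_n := if unpickle k is Some p then
  (if `[< B p `<=` U >] then B p else set0) else set0.
rewrite (_ : U = \bigcup_k F k).
  apply: bigcup_measurable => k _; rewrite /F; case: unpickle => [p|]; last exact: measurable0.
  by case: ifP => _; [exact: mB|exact: measurable0].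
apply/seteqP; split => [x Ux|x [k _]]; last first.
  by rewrite /F; case: unpickle => // p; case: asboolP => // BU; exact: BU.
have [e /= e0 eU] : nbhs_ball x U by apply/nbhs_ballP; exact: oU.
have [k ke] : exists k, k.+1%:R^-1 < e / 2.
  have e2 : 0 < e / 2 by rewrite divr_gt0.
  by have [k _ H] := near_infty_natSinv_lt (PosNum e2); exists k; exact: H (leqnn _).
have k0 : 0 < k.+1%:R^-1 :> R by rewrite invr_gt0.
have H i : exists q : rat, x ord0 i - k.+1%:R^-1 < ratr q < x ord0 i + k.+1%:R^-1.
  move: k0 => /[dup] _; set d := _^-1 => k0.
  have /rat_in_itvoo[q] : x ord0 i - d < x ord0 i + d by lra.
  by rewrite in_itv; exists q.
have [q Hq] := choice H.
clear H; have {k0 ke} [d [Ed d0 de]] : exists d : R, [/\ d = k.+1%:R^-1, 0 < d & d < e / 2] by eexists; split; first reflexivity.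
rewrite -Ed in Hq.
pose p : 'rV[rat]_n * nat := (\row_i q i, k).
exists (pickle p) => //; rewrite /F pickleK.
have Bx : B p x by move=> i /=; rewrite !mxE -Ed; have /andP[] := Hq i; lra.
case: asboolP => // -[] y By; apply: eU; rewrite ball_rV.
apply: rV_norm_lt => // i; rewrite !mxE.
have := Bx i; have := By i; rewrite /= !mxE -Ed => /andP[? ?] /andP[? ?].
rewrite ltr_norml; lra.
Qed.

Lemma closed_measurable_rV n (U : set 'rV[R]_n) : closed U -> measurable U.
Proof.
move=> cU; rewrite -[U]setCK; apply: measurableC; apply: open_measurable_rV.
exact: closed_openC.
Qed.

Lemma compact_measurable_rV n (U : set 'rV[R]_n) : compact U -> measurable U.
Proof.
by move=> cU; apply: closed_measurable_rV; apply: compact_closed cU; exact: norm_hausdorff.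
Qed.

Lemma continuous_measurable_rV n (f : 'rV[R]_n -> R) : continuous f ->
  measurable_fun setT f.
Proof.
move=> cf; apply: (measurability _ (RGenOpens.measurableE R)) => //.
move=> _ [_ [a [b ->] <-]]; rewrite setTI; apply: open_measurable_rV.
by apply: open_comp => // x _; exact: cf.
Qed.

Definition box n (a b : 'rV[R]_n) : set 'rV[R]_n :=
  [set x | forall i, a ord0 i <= x ord0 i <= b ord0 i].

Lemma measurable_box n (a b : 'rV[R]_n) : measurable (box a b).
Proof. by apply: measurable_forall_ord => i; exact: measurable_coord_le. Qed.

Lemma lebesgue_rV_box n (a b : 'rV[R]_n) : (forall i, a ord0 i <= b ord0 i) ->
  lebesgue_rV n (box a b) = (\prod_i (b ord0 i - a ord0 i))%:E.
Proof.
elim: n a b => [|n IH] a b ab.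
  rewrite big_ord0 /= diracE mem_set//= => i; by case: i.
pose tl (v : 'rV[R]_n.+1) := \row_j v ord0 (lift ord0 j).
rewrite big_ord_recl [LHS](_ : _ = (lebesgue_measure \x lebesgue_rV n)%E
    (`[a ord0 ord0, b ord0 ord0]%classic `*` box (tl a) (tl b))).
  rewrite product_measure1E//=; [|exact: measurable_box].
  rewrite lebesgue_measure_itv/= IH; last by move=> i; rewrite !mxE.
  rewrite EFinM; congr (_ * _)%E; last first.
    by congr EFin; apply: eq_bigr => i _; rewrite !mxE.
  rewrite lte_fin; case: ifPn => // h; congr EFin; have := ab ord0; lra.
rewrite /= /lebesgue_step /pushforward; congr (_ \x _)%E.
apply/seteqP; split => -[t w] /=; rewrite in_itv/=.
  move=> H; split; first by have := H ord0; rewrite cons_rV0.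
  by move=> i; have := H (lift ord0 i); rewrite cons_rVS !mxE.
move=> -[H1 H2] i; have [k ->|->] := unliftP ord0 i; last by rewrite cons_rV0.
by rewrite cons_rVS; have := H2 k; rewrite !mxE.
Qed.

Lemma lebesgue_rV_bounded n (A : set 'rV[R]_n) (M : R) : measurable A ->
  (forall x, A x -> `|x| <= M) -> (lebesgue_rV n A < +oo)%E.
Proof.
move=> mA AM.
have MM : 0 <= `|M| by [].
apply: (@le_lt_trans _ _ (lebesgue_rV n (box (const_mx (- `|M|)) (const_mx `|M|)))).
  apply: le_measure; rewrite ?inE//; first exact: measurable_box.
  move=> x Ax i; rewrite !mxE -ler_norml (le_trans (coord_norm_le _ _))//.
  by rewrite (le_trans (AM _ Ax))// ler_norm.
by rewrite lebesgue_rV_box ?ltry// => i; rewrite !mxE; lra.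
Qed.


End borel.

(** * Smooth bump functions *)

Section flat.
Context {R : realType}.

(** The functions t^-k exp(-1/t), extended by 0 to t <= 0.  Derivatives
of one member of the family are combinations of other members, so
smoothness of everything built from them can be read off the construction. *)
Definition flat k (t : R) : R := if 0 < t then t^-1 ^+ k * expR (- t^-1) else 0.

(** From the Taylor bound of exp(1/t) at order k + 1.  It gives the
derivative 0 at the origin. *)
Lemma flat_le k t : 0 < t -> 0 <= flat k t <= k.+1`!%:R * t.
Proof.
move=> t0; rewrite /flat t0; have ti : 0 < t^-1 by rewrite invr_gt0.
apply/andP; split; first by rewrite mulr_ge0 ?expR_ge0// exprn_ge0 ?ltW.
rewrite expRN ler_pdivrMr ?expR_gt0//.
have f0 : 0 < k.+1`!%:R :> R by rewrite ltr0n fact_gt0.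
apply: (@le_trans _ _ (k.+1`!%:R * t * (t^-1 ^+ k.+1 / k.+1`!%:R))).
  by rewrite exprS le_eqVlt; apply/orP; left; apply/eqP; field; rewrite !lt0r_neq0.
rewrite ler_pM2l ?mulr_gt0//.
by apply: le_trans (expR_ge1Dxn k (ltW ti)); rewrite lerDr.
Qed.

Lemma is_derive_flat (k : nat) (t : R) : is_derive t (1 : R) (flat k) (flat k.+2 t - k%:R * flat k.+1 t).
Proof.
have [t0|t0|t0] := ltgtP t 0.
- rewrite /flat !ltNge !(ltW t0)/= mulr0 subr0.
  have e : \near t, cst 0 t = (if 0 < t then t^-1 ^+ k * expR (- t^-1) else 0) :> R.
    near=> x; rewrite ifF//; apply/negbTE; rewrite -leNgt ltW//.
    by near: x; exact: lt_nbhsl.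
  exact: near_eq_is_derive e (is_derive_cst _ _ _).
- rewrite /flat t0.
  pose g := (id ^+ k * (expR \o -%R)) : R -> R.
  have e : \near t, (g \o GRing.inv) t = (if 0 < t then t^-1 ^+ k * expR (- t^-1) else 0) :> R.
    near=> x; rewrite ifT; first by rewrite /g/= exprfctE.
    by near: x; exact: lt_nbhsr.
  apply: near_eq_is_derive e _.
  have tn : t != 0 by rewrite gt_eqF.
  have di : is_derive t 1 (GRing.inv : R -> R) (- t ^- 2 *: 1).
    have d1 : derivable (@id R) t 1 by exact: derivable_id.
    apply: DeriveDef; first by apply: (@derivableV _ _ (@id R)).
    by rewrite (@deriveV _ _ (@id R))// derive_id.
  apply: is_derive_eq.
  rewrite /= /GRing.scale/=; case: k {g} => [|k]; rewrite /=.
    by rewrite exprfctE !mul0r !expr0; field.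
  by rewrite exprfctE !exprS; field.
rewrite {}t0 {2 3}/flat ltxx mulr0 subr0.
have H : h^-1 *: (flat k (h *: (1 : R) + 0) - flat k 0) @[h --> (0:R)^'] --> (0 : R).
  apply/cvgr0Pnorm_le => e e0.
  have K0 : 0 < k.+2`!%:R :> R by rewrite ltr0n fact_gt0.
  near=> h; rewrite {2}/flat ltxx subr0 addr0 /GRing.scale/= mulr1.
  have hn : h != 0 by near: h; exact: nbhs_dnbhs_neq.
  rewrite (_ : _ * _ = flat k.+1 h); last first.
    by rewrite /flat; case: ifP => _; rewrite ?mulr0// exprS mulrA.
  have [h0|h0] := ltP 0 h; last by rewrite /flat ltNge h0/= normr0 ltW.
  have /andP[h1 h2] := flat_le k.+1 h0.
  rewrite ger0_norm// (le_trans h2)// -ler_pdivlMl// mulrC.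
  rewrite -[h]gtr0_norm//; near: h.
  by apply: dnbhs0_le; rewrite divr_gt0.
by apply: DeriveDef; [apply/cvg_ex; exists 0|exact/cvg_lim].
Unshelve. all: by end_near. Qed.
End flat.

Section elem.
Context {R : realType}.
Variable n : nat.
Implicit Types (f g : 'rV[R]_n -> R) (x v : 'rV[R]_n).

(** Since [smooth] asks for differentiability of all iterated derivatives,
it is proved once and for all on a class closed under directional derivatives. *)
Inductive elem : ('rV[R]_n -> R) -> Prop :=
| elem_flat k a b i : elem (fun x => flat k (a * x ord0 i + b))
| elem_cst c : elem (fun=> c)
| elemD f g : elem f -> elem g -> elem (fun x => f x + g x)
| elemM f g : elem f -> elem g -> elem (fun x => f x * g x).

Lemma is_derive_coord (i : 'I_n) x v :
  is_derive x v (fun y : 'rV[R]_n => y ord0 i) (v ord0 i).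
Proof.
have d : differentiable (fun y : 'rV[R]_n => y ord0 i) x by exact: differentiable_coord.
apply: DeriveDef; first exact: diff_derivable.
have /derivableP := diff_derivable (v := v) d.
move=> _; apply/cvg_lim => //.
apply: cvg_near_cst; near=> h.
rewrite /= !mxE addrK /GRing.scale/= mulrA mulVf ?mul1r//.
by near: h; exact: nbhs_dnbhs_neq.
Unshelve. all: by end_near. Qed.

Lemma affine_coord (i : 'I_n) a b x :
  differentiable (fun y : 'rV[R]_n => a * y ord0 i + b) x /\
  forall v, is_derive x v (fun y : 'rV[R]_n => a * y ord0 i + b) (a * v ord0 i).
Proof.
have d : differentiable (fun y : 'rV[R]_n => y ord0 i) x by exact: differentiable_coord.
split.
  apply: (@differentiableD _ _ _ (fun y : 'rV[R]_n => a * y ord0 i) (cst b)); last exact: differentiable_cst.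
  exact: (@differentiableZ _ _ _ (fun y : 'rV[R]_n => y ord0 i)).
move=> v.
have H := is_derive_coord i x v.
have H1 : is_derive x v (a \*: (fun y : 'rV[R]_n => y ord0 i)) (a *: v ord0 i) by apply: is_deriveZ.
have H2 : is_derive x v (cst b) 0 by exact: is_derive_cst.
have := is_deriveD H1 H2; rewrite addr0; exact.
Qed.

Lemma elem_deriv f : elem f -> (forall x, differentiable f x) /\
  forall v, elem (fun x => 'D_v f x).
Proof.
elim=> {f} [k a b i|c|f g ef [df Df] eg [dg Dg]|f g ef [df Df] eg [dg Dg]].
- have dl x := (affine_coord i a b x).1.
  have df (t : R) : differentiable (flat k) t.
    by apply/derivable1_diffP; have [] := is_derive_flat k t.
  have dc x : differentiable (fun x => flat k (a * x ord0 i + b)) x.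
    by apply: (@differentiable_comp _ _ _ _ (fun x => a * x ord0 i + b) (flat k)).
  split => // v.
  rewrite [X in elem X](_ : _ = fun x => (a * v ord0 i) * (flat k.+2 (a * x ord0 i + b) + - k%:R * flat k.+1 (a * x ord0 i + b))).
    apply: elemM; first exact: elem_cst.
    apply: elemD; first exact: elem_flat.
    by apply: elemM; [exact: elem_cst|exact: elem_flat].
  apply/funext => x; rewrite deriveE//.
  rewrite (@diff_comp _ _ _ _ (fun x => a * x ord0 i + b) (flat k))//=.
  rewrite diff1E// derive1E.
  have [_ ->] := is_derive_flat k (a * x ord0 i + b).
  rewrite -(deriveE _ (dl x)).
  have [_ ->] := (affine_coord i a b x).2 v.
  by rewrite /GRing.scale/= mulNr.
- split=> [x|v]; first exact: differentiable_cst.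
  rewrite [X in elem X](_ : _ = fun=> 0); first exact: elem_cst.
  by apply/funext => x; rewrite derive_cst.
- split=> [x|v]; first exact: differentiableD.
  rewrite [X in elem X](_ : _ = fun x => 'D_v f x + 'D_v g x); first exact: elemD.
  by apply/funext => x; rewrite -deriveD//; exact: diff_derivable.
- split=> [x|v]; first exact: differentiableM.
  rewrite [X in elem X](_ : _ = fun x => f x * 'D_v g x + g x * 'D_v f x).
    by apply: elemD; exact: elemM.
  by apply/funext => x; rewrite -deriveM//; exact: diff_derivable.
Qed.

Lemma elem_smooth f : elem f -> smooth f.
Proof.
move=> ef s; suff H : elem (foldr (fun v psi => 'D_v psi) f s).
  by move=> x; have [+ _] := elem_deriv H; exact.
by elim: s => [|v s IH] //=; have [_] := elem_deriv IH; exact.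
Qed.

Lemma elem_continuous f : elem f -> continuous f.
Proof. by move=> /elem_deriv[df _] x; exact: differentiable_continuous. Qed.

Lemma elem_translate f x : elem f -> elem (fun y => f (y - x)).
Proof.
elim=> {f} [k a b i|c|f g _ ef _ eg|f g _ ef _ eg].
- rewrite [X in elem X](_ : _ = fun y : 'rV[R]_n => flat k (a * y ord0 i + (b - a * x ord0 i))).
    exact: elem_flat.
  by apply/funext => y; rewrite !mxE; congr flat; ring.
- exact: elem_cst.
- exact: elemD.
- exact: elemM.
Qed.

Lemma derive_translate f x v y : 'D_v (fun y => f (y - x)) y = 'D_v f (y - x).
Proof.
have e : (fun h : R => h^-1 *: (((fun y => f (y - x)) \o shift y) (h *: v) - f (y - x))) =
    (fun h : R => h^-1 *: ((f \o shift (y - x)) (h *: v) - f (y - x))).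
  by apply/funext => h /=; rewrite addrA.
by rewrite /derive e.
Qed.

Lemma elem_prod (I : Type) (s : seq I) (F : I -> 'rV[R]_n -> R) :
  (forall i, elem (F i)) -> elem (fun x => \prod_(i <- s) F i x).
Proof.
move=> eF; elim: s => [|i s IH].
  by rewrite [X in elem X](_ : _ = fun=> 1); [exact: elem_cst|apply/funext => x; rewrite big_nil].
rewrite [X in elem X](_ : _ = fun x => F i x * \prod_(i <- s) F i x); first exact: elemM.
by apply/funext => x; rewrite big_cons.
Qed.

Lemma flat_ge0 k (t : R) : 0 <= flat k t.
Proof. by rewrite /flat; case: ifPn => // t0; rewrite mulr_ge0 ?expR_ge0// exprn_ge0// invr_ge0 ltW. Qed.

Lemma flat_gt0 k (t : R) : 0 < t -> 0 < flat k t.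
Proof. by move=> t0; rewrite /flat t0 mulr_gt0 ?expR_gt0// exprn_gt0// invr_gt0. Qed.

Local Open Scope ereal_scope.

(** Normalised product over the coordinates of flat functions of
1 + x_i / e and 1 - x_i / e: even, and supported in the sup norm ball of radius
[e]. *)
Lemma bump_exists (e : R) : (0 < e)%R -> exists phi : 'rV[R]_n -> R,
  [/\ elem phi, forall x, (0 <= phi x)%R, forall x, phi (- x)%R = phi x,
     forall x, (e <= `|x|)%R -> phi x = 0%R &
     \int[lebesgue_rV n]_x (phi x)%:E = 1].
Proof.
move=> e0.
pose beta (i : 'I_n) (x : 'rV[R]_n) : R :=
  (flat 0 (e^-1 * x ord0 i + 1) * flat 0 (- e^-1 * x ord0 i + 1))%R.
pose f (x : 'rV[R]_n) : R := (\prod_i beta i x)%R.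
have ebeta i : elem (beta i) by apply: elemM; exact: elem_flat.
have ef : elem f by exact: elem_prod.
have f0 x : (0 <= f x)%R by apply: prodr_ge0 => i _; rewrite mulr_ge0 ?flat_ge0.
have fN x : f (- x)%R = f x.
  by apply: eq_bigr => i _; rewrite /beta !mxE [LHS]mulrC !mulrN !mulNr opprK.
have mf : measurable_fun setT f by apply: continuous_measurable_rV; exact: elem_continuous.
have fsupp x : (e <= `|x|)%R -> f x = 0%R.
  move=> ex; apply: contrapT => fx.
  suff : (`|x| < e)%R by rewrite ltNge ex.
  apply: rV_norm_lt => // i.
  have : beta i x != 0%R by apply: contra_notN fx => /eqP b0; rewrite /f (bigD1 i)//= b0 mul0r.
  rewrite /beta mulf_eq0 negb_or /flat => /andP[].
  case: ifPn => [+ _|]; last by rewrite eqxx.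
  case: ifPn => [+ + _|]; last by rewrite eqxx.
  move=> h1 h2; rewrite ltr_norml.
  have : (0 < e * (e^-1 * x ord0 i + 1))%R by rewrite mulr_gt0.
  have : (0 < e * (- e^-1 * x ord0 i + 1))%R by rewrite mulr_gt0.
  rewrite !mulrDr !mulrA mulrN mulfV ?gt_eqF//; lra.
have e2 : (0 < e / 2)%R by rewrite divr_gt0.
pose Q := box (const_mx (- (e / 2))%R) (const_mx (e / 2)%R) : set 'rV[R]_n.
have [x0 Qx0 [c c0 cQ]] : exists2 x0 : 'rV[R]_n, Q x0 & exists2 c : R, (0 < c)%R & forall x, Q x -> (c <= f x)%R.
  exists 0%R; first by move=> i; rewrite !mxE; lra.
  exists (\prod_(i < n) (flat 0 (2^-1 : R) * flat 0 (2^-1 : R)))%R.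
    by rewrite prodr_gt0// => i _; rewrite mulr_gt0 ?flat_gt0.
  have flat_nd (t : R) : (2^-1 <= t)%R -> (flat 0 (2^-1 : R) <= flat 0 t)%R.
    move=> ht; have t0 : (0 < t)%R by lra.
    rewrite /flat t0 invr_gt0 ltr0n/= !expr0 !mul1r ler_expR lerN2 invrK.
    by rewrite invf_ple// posrE.
  move=> x Qx; apply: ler_prod => i _; rewrite mulr_ge0 ?flat_ge0//=.
  have := Qx i; rewrite !mxE => /andP[h1 h2].
  have : (- 2^-1 <= e^-1 * x ord0 i <= 2^-1)%R.
    by rewrite mulrC ler_pdivlMr// ler_pdivrMr//; lra.
  by move=> /andP[h3 h4]; apply: ler_pM; rewrite ?flat_ge0//; apply: flat_nd; lra.
pose I := \int[lebesgue_rV n]_x (f x)%:E.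
have I0 : 0 < I.
  apply: (@lt_le_trans _ _ (\int[lebesgue_rV n]_(x in Q) (cst c%:E x))).
    rewrite integral_cst; last exact: measurable_box.
    rewrite [X in _ * X]lebesgue_rV_box; last by move=> i; rewrite !mxE; lra.
    by rewrite -EFinM lte_fin mulr_gt0// prodr_gt0// => i _; rewrite !mxE; lra.
  apply: (@le_trans _ _ (\int[lebesgue_rV n]_(x in Q) (f x)%:E)).
    apply: ge0_le_integral.
    - exact: measurable_box.
    - by move=> x _; rewrite lee_fin ltW.
    - exact: measurable_cst.
    - by apply/measurable_EFinP; exact: measurable_funTS.
    - by move=> x Qx; rewrite lee_fin; exact: cQ.
  apply: ge0_subset_integral => //; first exact: measurable_box.
    exact/measurable_EFinP.
  by move=> x _; rewrite lee_fin.
have Ioo : I < +oo.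
  have [M HM] : exists M : R, forall x, (f x <= M)%R.
    exists (\prod_(i < n) (1 * 1))%R => x; apply: ler_prod => i _.
    have flat1 (t : R) : (flat 0 t <= 1)%R.
      by rewrite /flat; case: ifPn => // t0; rewrite expr0 mul1r -expR0 ler_expR oppr_le0 invr_ge0 ltW.
    by rewrite mulr_ge0 ?flat_ge0//= ler_pM ?flat_ge0.
  pose Q' := box (const_mx (- e)%R) (const_mx e) : set 'rV[R]_n.
  rewrite /I (_ : \int[_]_x _ = \int[lebesgue_rV n]_(x in Q') (f x)%:E).
    apply: (@le_lt_trans _ _ (\int[lebesgue_rV n]_(x in Q') (cst M%:E x))).
      apply: ge0_le_integral.
      - exact: measurable_box.
      - by move=> x _; rewrite lee_fin.
      - by apply/measurable_EFinP; exact: measurable_funTS.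
      - exact: measurable_cst.
      - by move=> x _; rewrite lee_fin; exact: HM.
    rewrite integral_cst; last exact: measurable_box.
    rewrite [X in _ * X]lebesgue_rV_box; last by move=> i; rewrite !mxE; lra.
    by rewrite -EFinM ltry.
  rewrite [RHS]integral_mkcond; apply: eq_integral => x _; rewrite patchE; case: ifPn => //.
  rewrite notin_setE => Qx; rewrite fsupp// leNgt; apply: contra_notN Qx => xe i.
  by rewrite !mxE -ler_norml (le_trans (coord_norm_le _ _))// ltW.
have If : I = (fine I)%:E by rewrite fineK// ge0_fin_numE// ltW.
have fI0 : (0 < fine I)%R by rewrite -lte_fin -If.
exists (fun x => (fine I)^-1 * f x)%R; split.
- by apply: elemM => //; exact: elem_cst.
- by move=> x; rewrite mulr_ge0// invr_ge0 ltW.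
- by move=> x; rewrite fN.
- by move=> x /fsupp ->; rewrite mulr0.
- under eq_integral do rewrite EFinM.
  rewrite ge0_integralZl//; last 3 first.
  + exact/measurable_EFinP.
  + by move=> x _; rewrite lee_fin.
  + by rewrite lee_fin invr_ge0 ltW.
  by rewrite -/I If -EFinM mulVf ?gt_eqF.
Qed.

End elem.

(** * Differences of smooth functions along curves, uniform radii *)

Section tools.
Context {R : realType}.

Lemma integrable_bounded_supp d (T : measurableType d) (mu : {measure set T -> \bar R})
    (A : set T) (f : T -> R) (C : R) : measurable A -> (mu A < +oo)%E ->
  measurable_fun setT f -> (forall x, A x -> `|f x| <= C) -> (forall x, ~ A x -> f x = 0) ->
  mu.-integrable setT (EFin \o f).
Proof.
move=> mA muA mf fC f0; apply/integrableP; split; first exact/measurable_EFinP.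
rewrite (_ : integral _ _ _ = \int[mu]_(x in A) (`|f x|)%:E)%E.
  apply: (@le_lt_trans _ _ (\int[mu]_(x in A) (cst C%:E x))%E).
    apply: ge0_le_integral => //.
    apply/measurable_EFinP; apply: measurableT_comp => //.
      exact: measurable_funTS.
  rewrite integral_cst//; have /fineK <- : mu A \is a fin_num by rewrite ge0_fin_numE.
  by rewrite -EFinM ltry.
rewrite [RHS]integral_mkcond; apply: eq_integral => x _; rewrite patchE; case: ifPn => //.
by rewrite notin_setE => /f0 /= ->; rewrite normr0.
Qed.

(** Neighbourhoods in R^n are defined entrywise; this turns
continuity at a point into an epsilon-delta statement for the sup norm. *)
Lemma rV_cont_at n (f : 'rV[R]_n -> R) x :
  (forall e, 0 < e -> exists2 d, 0 < d & forall y, `|y - x| < d -> `|f y - f x| < e) <->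
  {for x, continuous f}.
Proof.
split=> [H A /= /nbhs_ballP[e /= e0 eA]|H e e0].
  have [d d0 dH] := H e e0.
  apply/nbhs_ballP; exists d => //= y; rewrite ball_rV distrC => /dH fy.
  by apply: eA; rewrite -ball_normE /= distrC.
have /H/nbhs_ballP[d /= d0 dH] : nbhs (f x) (ball (f x) e) by exact: nbhsx_ballx.
exists d => // y yx; have /dH : ball x d y by rewrite ball_rV distrC.
by rewrite /= -ball_normE /= distrC.
Qed.

Variable n : nat.
Implicit Types (phi : 'rV[R]_n -> R) (p d x : 'rV[R]_n).

Lemma derive_coord_sum phi x d : differentiable phi x ->
  'D_d phi x = \sum_i d ord0 i * 'D_(delta_mx ord0 i) phi x.
Proof.
move=> df; rewrite deriveE// {1}(row_sum_delta d) linear_sum/=.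
by apply: eq_bigr => i _; rewrite linearZ/= deriveE.
Qed.

(** The curve p - s^k d is the segment from p to p - d, run
with speed k s^(k-1).  For k = n this slow start absorbs the singularity of
the Morrey kernel. *)
Lemma is_derive_curve phi p d k (s : R) : elem phi ->
  is_derive s (1 : R) (fun s => phi (p - s ^+ k *: d))
    (- (k%:R * s ^+ k.-1) * 'D_d phi (p - s ^+ k *: d)).
Proof.
move=> ephi; have [dphi _] := elem_deriv ephi.
pose line (t : R) := phi (p - t *: d).
have dline (t : R) : is_derive t (1 : R) line (- 'D_d phi (p - t *: d)).
  have e : (fun h : R => h^-1 *: ((line \o shift t) (h *: (1 : R)) - line t)) =
      (fun h : R => h^-1 *: ((phi \o shift (p - t *: d)) (h *: - d) - phi (p - t *: d))).
    apply/funext => h /=; rewrite /line [h *: _]mulr1; congr (_ *: (phi _ - _)).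
    by rewrite scalerDl scalerN opprD addrCA.
  have -> : - 'D_d phi (p - t *: d) = 'D_(- d) phi (p - t *: d) by rewrite !deriveE// linearN.
  have dd : derivable phi (p - t *: d) (- d) by exact: diff_derivable.
  by apply: DeriveDef; [rewrite /derivable e|rewrite /derive e].
have dX : is_derive s (1 : R) (fun s : R => s ^+ k) (k%:R * s ^+ k.-1).
  apply: DeriveDef; first exact: exprn_derivable.
  by rewrite exp_derive /GRing.scale/= mulr1.
have := @is_derive1_comp _ line (fun s : R => s ^+ k) s _ _ (dline (s ^+ k)) dX.
by rewrite mulrC mulrN -mulNr; apply.
Qed.

Lemma continuous_curve p d k : continuous (fun s : R => p - s ^+ k *: d).
Proof.
move=> s; apply: (@cvgB _ _ _ _ _ (cst p) (fun s : R => s ^+ k *: d)); first exact: cvg_cst.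
apply: cvgZr_tmp; exact: exprn_continuous.
Qed.

(** The increment from [p] to [p - d] as an integral over the
reparametrised segment. *)
Lemma elem_FTC phi p d k : elem phi -> (0 < k)%N ->
  (\int[lebesgue_measure]_(s in `[0%R, 1%R])
    (- (k%:R * s ^+ k.-1) * 'D_d phi (p - s ^+ k *: d))%:E
  = (phi (p - d))%:E - (phi p)%:E)%E.
Proof.
move=> ephi k0.
pose F (s : R) := phi (p - s ^+ k *: d).
have dF (s : R) := is_derive_curve p d k s ephi.
have [_ /(_ d) eD] := elem_deriv ephi.
have cF : continuous F.
  move=> s; apply: differentiable_continuous; apply/derivable1_diffP; by case: (dF s).
rewrite (@continuous_FTC2 _ (fun s => (- (k%:R * s ^+ k.-1) * 'D_d phi (p - s ^+ k *: d))) F 0 1)//.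
- by rewrite /F expr1n scale1r expr0n gtn_eqF//= scale0r subr0.
- apply: continuous_subspaceT => s.
  apply: (@continuousM _ _ (fun s : R => - (k%:R * s ^+ k.-1)) (fun s : R => 'D_d phi (p - s ^+ k *: d))).
    apply: (@continuousN _ _ _ (fun s : R => k%:R * s ^+ k.-1)).
    apply: (@continuousM _ _ (cst k%:R)); [exact: cvg_cst|exact: exprn_continuous].
  apply: (@continuous_comp _ _ _ (fun s : R => p - s ^+ k *: d) (fun x => 'D_d phi x)).
    exact: continuous_curve.
  exact: elem_continuous.
- split.
  + by move=> s _; case: (dF s).
  + exact/cvg_at_right_filter/cF.
  + exact/cvg_at_left_filter/cF.
- by move=> s _; rewrite derive1E; case: (dF s).
Qed.

Lemma test_function_translate Omega phi p (e : R) : elem phi ->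
  (forall x, e <= `|x| -> phi x = 0) -> (forall y, `|y - p| <= e -> Omega y) ->
  test_function Omega (fun y => phi (y - p)).
Proof.
move=> ephi supp sub.
have cB : closed [set y : 'rV[R]_n | `|y - p| <= e].
  have c : continuous (fun y : 'rV[R]_n => `|y - p|).
    move=> y; apply/rV_cont_at => r r0; exists r => // z zr.
    by rewrite (le_lt_trans (ler_dist_dist _ _))// opprB addrA subrK.
  apply: (@closed_comp _ _ (fun y : 'rV[R]_n => `|y - p|) [set t : R | t <= e]); last exact: closed_le.
  by move=> y _; exact: c.
have sB : closure [set y | phi (y - p) != 0] `<=` [set y : 'rV[R]_n | `|y - p| <= e].
  rewrite [X in _ `<=` X]((closure_id _).1 cB); apply: closureS => y /=.
  by apply: contra_neqT; rewrite -ltNge => /ltW; exact: supp.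
split.
- exact/elem_smooth/elem_translate.
- apply: bounded_closed_compact; last exact: closed_closure.
  exists (e + `|p|); split; first exact: num_real.
  move=> M eM y /sB /= ye; rewrite -[y](subrK p) (le_trans (ler_normD _ _))//.
  by rewrite ltW// (le_lt_trans _ eM)// lerD2r.
- by move=> y /sB /= /sub.
Qed.

(** Gives a scale at which mollification is defined on
[K] and moves [u] by at most [eta] there. *)
Lemma compact_uniform_radius (Omega K : set 'rV[R]_n) (u : 'rV[R]_n -> R) (eta : R) :
  open Omega -> (forall x, Omega x -> {for x, continuous u}) ->
  compact K -> K `<=` Omega -> 0 < eta ->
  exists2 e : R, 0 < e & forall x y, K x -> `|y - x| <= e -> Omega y /\ `|u y - u x| <= eta.
Proof.
move=> oO cu cK KO eta0.
have /compact_near_coveringP cK' := cK.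
pose P (e : R) (x : 'rV[R]_n) := forall y, `|y - x| <= e -> Omega y /\ `|u y - u x| <= eta.
have : \forall e \near (0 : R)^'+, K `<=` P e.
  apply: cK' => x Kx.
  have [r /= r0 rO] : nbhs_ball x (Omega `&` [set y | `|u x - u y| <= eta / 2]).
    apply/nbhs_ballP; apply: filterI; first exact: (oO _ (KO _ Kx)).
    by have /cvgrPdist_le := cu _ (KO _ Kx); apply; rewrite divr_gt0.
  have r2 : 0 < r / 2 by rewrite divr_gt0.
  exists (ball x (r / 2), [set e : R | e < r / 2]).
    by split; [exact: nbhsx_ballx|exact: nbhs_right_lt].
  move=> [x' e] /= [xx' er] y yx'; rewrite ball_rV in xx'.
  have [Oy uy] : (Omega `&` [set y | `|u x - u y| <= eta / 2]) y.
    apply: rO; rewrite ball_rV (_ : x - y = (x - x') - (y - x')); last by rewrite opprB addrA subrK.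
    rewrite (le_lt_trans (ler_normB _ _))//; lra.
  have [_ /= ux'] : (Omega `&` [set y | `|u x - u y| <= eta / 2]) x'.
    by apply: rO; rewrite ball_rV; lra.
  split => //; rewrite (_ : u y - u x' = (u x - u x') - (u x - u y)); last by ring.
  by rewrite (le_trans (ler_normB _ _))//; rewrite /= in uy; lra.
move=> H; have H2 : \forall e \near (0 : R)^'+, 0 < e /\ K `<=` P e.
  by apply: filterI => //; exact: nbhs_right_gt.
have [e [e0 eK]] := filter_ex H2.
by exists e => // x y Kx; exact: eK.
Qed.

End tools.

(** * Mollified increments and the mollified energy density *)

Section mollification.
Context {R : realType}.
Variable m : nat.
Local Notation rV := 'rV[R]_m.+1.
Local Notation mu := (lebesgue_rV m.+1 : {sigma_finite_measure set rV -> \bar R}).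
Variables (Omega : set rV) (u : rV -> R) (g : 'I_m.+1 -> rV -> R).
Hypothesis oO : open Omega.
Hypothesis mu_ : measurable_fun setT (u \_ Omega).
Hypothesis mg : forall i, measurable_fun setT (g i \_ Omega).
Hypothesis wp : forall i, weak_partial Omega i u (g i).
Variables (phi : rV -> R) (e : R).
Implicit Types (p x y z : rV) (t : R) (i : 'I_m.+1) (K : set rV).
Hypothesis e0 : 0 < e.
Hypothesis ephi : elem phi.
Hypothesis phi0 : forall x, 0 <= phi x.
Hypothesis phiN : forall x, phi (- x) = phi x.
Hypothesis psupp : forall x, e <= `|x| -> phi x = 0.
Hypothesis pint : (\int[mu]_x (phi x)%:E = 1)%E.
Local Open Scope ereal_scope.

Let mphi : measurable_fun setT phi.
Proof. by apply: continuous_measurable_rV; exact: elem_continuous. Qed.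

Lemma measurable_translate (psi : rV -> R) p : measurable_fun setT psi ->
  measurable_fun setT (fun y => psi (y - p)%R).
Proof.
move=> mpsi; apply: (measurableT_comp mpsi).
rewrite (_ : (fun y => _) = (fun y : rV => (1%R *: y + - p)%R)).
  exact: measurable_affine_rV.
by apply/funext => y; rewrite scale1r.
Qed.

Lemma integral_translate (f : rV -> \bar R) p : measurable_fun setT f -> (forall x, 0 <= f x) ->
  \int[mu]_y f (y - p)%R = \int[mu]_y f y.
Proof.
move=> mf f0; rewrite -[RHS]mul1e -[in RHS](expr1n R m.+1) -[in RHS]invr1.
rewrite -(integral_rV_affine (- p)%R ltr01 mf f0).
by apply: eq_integral => y _; rewrite scale1r.
Qed.

Lemma phi_translate p : \int[mu]_y (phi (y - p)%R)%:E = 1.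
Proof.
rewrite (integral_translate (f := fun y => (phi y)%:E))//.
  exact/measurable_EFinP.
Qed.

(** Mollification of |g_i|^n at x, where n = m + 1. *)
Definition mol_power i (x : rV) : \bar R :=
  \int[mu]_y (`|(g i \_ Omega) y| ^+ m.+1 * phi (y - x))%:E.

Let mG i : measurable_fun [set: rV * rV]
  (fun p : rV * rV => (`|(g i \_ Omega) p.2| ^+ m.+1 * phi (p.2 - p.1))%:E).
Proof.
apply/measurable_EFinP; apply: measurable_funM.
  apply: measurable_funX; apply: measurableT_comp => //.
  exact: (measurableT_comp (mg i) measurable_snd).
apply: (measurableT_comp mphi).
apply: measurable_rVP => j.
rewrite (_ : (fun _ => _) = (fun p : rV * rV => (p.2 ord0 j - p.1 ord0 j)%R)).
  apply: measurable_funB.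
    exact: (measurableT_comp (measurable_coord j) measurable_snd).
  exact: (measurableT_comp (measurable_coord j) measurable_fst).
by apply/funext => p; rewrite !mxE.
Qed.

Let G_ge0 i (p : rV * rV) : 0 <= (`|(g i \_ Omega) p.2| ^+ m.+1 * phi (p.2 - p.1)%R)%:E.
Proof. by rewrite lee_fin mulr_ge0// exprn_ge0. Qed.

Lemma mol_power_ge0 i x : 0 <= mol_power i x.
Proof. by apply: integral_ge0 => y _; exact: (G_ge0 i (x, y)). Qed.

Lemma measurable_mol_power i : measurable_fun setT (mol_power i).
Proof. exact: (measurable_fun_fubini_tonelli_F (m2 := mu) _ (mG i) (G_ge0 i)). Qed.

Definition mol_energy x := \sum_i mol_power i x.

Lemma mol_energy_ge0 x : 0 <= mol_energy x.
Proof. by apply: sume_ge0 => i _; exact: mol_power_ge0. Qed.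

Lemma measurable_mol_energy : measurable_fun setT mol_energy.
Proof. by apply: emeasurable_sum => i; exact: measurable_mol_power. Qed.

(** Tonelli: the kernel has integral 1 in either variable. *)
Lemma integral_mol_power i : \int[mu]_x mol_power i x = \int[mu]_(y in Omega) (`|g i y| ^+ m.+1)%:E.
Proof.
rewrite (fubini_tonelli (m1 := mu) (m2 := mu) _ (mG i) (G_ge0 i))/=.
rewrite [RHS]integral_mkcond; apply: eq_integral => y _.
under eq_integral do rewrite EFinM.
rewrite ge0_integralZl; last 4 first.
- exact: measurableT.
- apply/measurable_EFinP.
  rewrite (_ : (fun x => _) = (fun x : rV => phi (x - y)%R)); first exact: measurable_translate.
  by apply/funext => x; rewrite -phiN opprB.
- by move=> x _; rewrite lee_fin.
- by rewrite lee_fin exprn_ge0.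
rewrite (_ : integral _ _ _ = 1) ?mule1.
  rewrite !patchE; case: ifPn => // _.
  by rewrite normr0 expr0n.
by rewrite -(phi_translate y); apply: eq_integral => x _; rewrite -phiN opprB.
Qed.

(** Independence of the mollification scale is what makes the
energy a usable bound. *)
Lemma integral_mol_energy K : measurable K ->
  \int[mu]_(x in K) mol_energy x <= \sum_i \int[mu]_(y in Omega) (`|g i y| ^+ m.+1)%:E.
Proof.
move=> mK; apply: (@le_trans _ _ (\int[mu]_x mol_energy x)).
  apply: ge0_subset_integral => //; first exact: measurable_mol_energy.
  by move=> x _; exact: mol_energy_ge0.
rewrite ge0_integral_sum//; last 2 first.
- exact: measurable_mol_power.
- by move=> i x _; exact: mol_power_ge0.
by under eq_bigr do rewrite integral_mol_power.
Qed.

(** Replaces Hoelder's inequality: the exponent 1 / (m + 1) never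
appears, and [t] is free. *)
Lemma young_power (a t : R) : (0 <= a)%R -> (0 < t)%R -> (a <= t + t^-1 ^+ m * a ^+ m.+1)%R.
Proof.
move=> a0 t0; have ti0 : (0 <= t^-1)%R by rewrite invr_ge0 ltW.
have [at_|ta] := leP a t.
  by rewrite (le_trans at_)// lerDl mulr_ge0// exprn_ge0.
apply: (@le_trans _ _ (t^-1 ^+ m * a ^+ m.+1)%R); last by rewrite lerDr ltW.
rewrite exprS mulrCA -exprMn ler_peMr// exprn_ege1//.
by rewrite mulrC ler_pdivlMr// mul1r ltW.
Qed.

(** The kernel centred at [p] is a test function.  Young's inequality under the integral, together with the
unit mass of the kernel, bounds the i-th derivative of the mollified function. *)
Lemma weak_bound i p t : (forall y, (`|y - p| <= e)%R -> Omega y) -> (0 < t)%R ->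
  `|\int[mu]_(y in Omega) (u y * 'D_(delta_mx ord0 i) (fun y => phi (y - p)) y)%:E|
    <= t%:E + (t^-1 ^+ m)%:E * mol_energy p.
Proof.
move=> pO t0; have tf := test_function_translate ephi psupp pO.
have mO : measurable Omega by exact: open_measurable_rV.
have ti0 : (0 <= t^-1 ^+ m)%R by rewrite exprn_ge0// invr_ge0 ltW.
have mtr : measurable_fun setT (fun y => phi (y - p)%R) by exact: measurable_translate.
have mpow : measurable_fun setT (fun y => (`|(g i \_ Omega) y| ^+ m.+1 * phi (y - p))%:E).
  apply/measurable_EFinP; apply: measurable_funM => //.
  by apply: measurable_funX; apply: measurableT_comp => //; exact: mg.
rewrite (wp i tf) abseN.
have -> : \int[mu]_(y in Omega) (g i y * phi (y - p))%:E =
    \int[mu]_y ((g i \_ Omega) y * phi (y - p))%:E.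
  rewrite integral_mkcond; apply: eq_integral => y _; rewrite !patchE.
  by case: ifPn => //; rewrite mul0r.
have mgp : measurable_fun setT (fun y => ((g i \_ Omega) y * phi (y - p))%:E).
  by apply/measurable_EFinP; apply: measurable_funM.
apply: (le_trans (le_abse_integral _ _ _)) => //.
apply: (@le_trans _ _ (\int[mu]_y ((t * phi (y - p))%:E +
   (t^-1 ^+ m)%:E * (`|(g i \_ Omega) y| ^+ m.+1 * phi (y - p))%:E))).
  apply: ge0_le_integral => //.
  - exact: measurableT_comp.
  - apply: emeasurable_funD; first by apply/measurable_EFinP; exact: measurable_funM.
    exact: measurable_funeM.
  move=> y _; rewrite -EFinM -EFinD lee_fin normrM (ger0_norm (phi0 _)) mulrA -mulrDl.
  by rewrite ler_wpM2r// young_power.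
rewrite ge0_integralD; last 5 first.
- exact: measurableT.
- by move=> y _; rewrite lee_fin mulr_ge0// ltW.
- by apply/measurable_EFinP; exact: measurable_funM.
- by move=> y _; apply: mule_ge0; rewrite lee_fin// mulr_ge0// exprn_ge0.
- exact: measurable_funeM.
apply: leeD.
  under eq_integral do rewrite EFinM.
  rewrite ge0_integralZl; last 4 first.
  - exact: measurableT.
  - exact/measurable_EFinP.
  - by move=> y _; rewrite lee_fin.
  - by rewrite lee_fin ltW.
  by rewrite phi_translate mule1.
rewrite ge0_integralZl; last 4 first.
- exact: measurableT.
- exact: mpow.
- by move=> y _; rewrite lee_fin mulr_ge0 ?exprn_ge0.
- by rewrite lee_fin.
apply: lee_pmul => //; first by apply: integral_ge0 => y _; rewrite lee_fin mulr_ge0 ?exprn_ge0.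
rewrite /mol_energy (bigD1 i)//= leeDl//; apply: sume_ge0 => j _; exact: mol_power_ge0.
Qed.

Variables (K : set rV) (eta M : R).
Hypothesis eta0 : (0 < eta)%R.
Hypothesis cK : compact K.
Hypothesis HK : forall x y, K x -> (`|y - x| <= e)%R -> Omega y /\ (`|u y - u x| <= eta)%R.
Hypothesis HM : forall x, K x -> (`|u x| <= M)%R.

Let M' : R := (`|M| + eta)%R.
(** Away from [K], the function [u] may be unbounded.  The
truncation keeps the values used for mollification at points of [K] and
makes all integrands bounded. *)
Let ut (y : rV) : R := Num.max (- M')%R (Num.min M' ((u \_ Omega) y)).

Let M'0 : (0 <= M')%R. Proof. by rewrite addr_ge0// ltW. Qed.

Let ut_bound y : (`|ut y| <= M')%R.
Proof.
rewrite ler_norml /ut le_max lexx/= ge_max ge_min lexx/= andbT.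
by rewrite (le_trans _ M'0)// oppr_le0.
Qed.

Let ut_eq x y : K x -> (`|y - x| <= e)%R -> ut y = u y.
Proof.
move=> Kx yx; have [Oy uyx] := HK Kx yx.
rewrite /ut patchE ifT ?inE//.
have : (`|u y| <= M')%R.
  rewrite -[u y](subrK (u x)) (le_trans (ler_normD _ _))// addrC lerD//.
  by rewrite (le_trans (HM Kx))// ler_norm.
by rewrite ler_norml => /andP[h1 h2]; rewrite (min_idPr h2) (max_idPr h1).
Qed.

Let mut : measurable_fun setT ut.
Proof. by apply: measurable_maxr => //; exact: measurable_minr. Qed.

Lemma supp_bounded (psi : rV -> R) : elem psi -> (forall x, (e < `|x|)%R -> psi x = 0%R) ->
  exists2 C : R, (0 <= C)%R & forall x, (`|psi x| <= C)%R.
Proof.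
move=> epsi psi0.
pose B := box (const_mx (- e)%R) (const_mx e) : set rV.
have BE (x : rV) : B x <-> (`|x| <= e)%R.
  split=> [Bx|xe i]; last by rewrite !mxE -ler_norml (le_trans (coord_norm_le _ _)).
  by apply: rV_norm_le => [|i]; [exact: ltW|have := Bx i; rewrite !mxE -ler_norml].
have cB : compact B.
  rewrite (_ : B = [set v : rV | forall i, v ord0 i \in `[(- e)%R, e]]).
    by apply: (@rV_compact _  _ (fun=> `[(- e)%R, e]%classic)) => _; exact: segment_compact.
  by apply/seteqP; split => x /= H i; have := H i; rewrite !mxE in_itv.
have [C [_ HC]] : bounded_set (psi @` B).
  apply: compact_bounded; apply: continuous_compact => //.
  by apply: continuous_subspaceT; exact: elem_continuous.
exists `|C + 1|%R => // x; have [/BE Bx|/psi0 ->] := leP (`|x|%R : R) e; last by rewrite normr0.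
apply: (@le_trans _ _ (C + 1)%R); last exact: ler_norm.
have C1 : (C < C + 1)%R by rewrite ltrDl.
by apply: (HC _ C1); exists x.
Qed.

Let phi_supp x : (e < `|x|)%R -> phi x = 0%R. Proof. by move=> /ltW; exact: psupp. Qed.

Lemma derive_supp d x : (e < `|x|)%R -> 'D_d phi x = 0%R.
Proof.
move=> ex; rewrite (near_eq_derive (g := cst 0%R)) ?derive_cst//.
apply/nbhs_ballP; exists (`|x| - e)%R => /=; first by rewrite subr_gt0.
move=> y; rewrite ball_rV => xy; apply: psupp.
have : (`|x| <= `|x - y| + `|y|)%R by rewrite -{1}(subrK y x) ler_normD.
lra.
Qed.

(** A bounded factor and a continuous kernel supported in a ball:
integrals over the whole space converge, and can be added and subtracted. *)
Lemma supp_integrable (w psi : rV -> R) p C : measurable_fun setT w ->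
  (forall x, (`|w x| <= C)%R) -> (0 <= C)%R ->
  elem psi -> (forall x, (e < `|x|)%R -> psi x = 0%R) ->
  mu.-integrable setT (fun y => (w y * psi (y - p))%:E).
Proof.
move=> mw wC C0 epsi psi0; have [C' C'0 HC'] := supp_bounded epsi psi0.
have mpsi : measurable_fun setT psi by apply: continuous_measurable_rV; exact: elem_continuous.
pose B := [set y : rV | (`|y - p| <= e)%R].
have mB : measurable B.
  rewrite (_ : B = box (p - const_mx e)%R (p + const_mx e)%R); first exact: measurable_box.
  apply/seteqP; split => y.
    move=> yp i; rewrite !mxE; have := le_trans (coord_norm_le (y - p)%R i) yp.
    rewrite !mxE ler_norml; lra.
  move=> H; apply: rV_norm_le => [|i]; first exact: ltW.
  have := H i; rewrite !mxE ler_norml; lra.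
apply: (integrable_bounded_supp (A := B) (C := C * C')) => //.
- apply: (lebesgue_rV_bounded (M := e + `|p|)) => // y yp.
  rewrite -[y](subrK p) (le_trans (ler_normD _ _))// lerD2r; exact: yp.
- by apply: measurable_funM => //; exact: measurable_translate.
- by move=> y _; rewrite normrM ler_pM.
- by move=> y /negP; rewrite -ltNge => /psi0 ->; rewrite mulr0.
Qed.

(** Mollification of [u] at x, for x in [K]. *)
Definition mol_value x : \bar R := \int[mu]_y (ut y * phi (y - x))%:E.

Let mol_value_integrable x : mu.-integrable setT (fun y => (ut y * phi (y - x))%:E).
Proof. exact: (supp_integrable x mut ut_bound M'0). Qed.

Lemma mol_value_fin x : mol_value x \is a fin_num.
Proof. by have := integrable_fin_num measurableT (mol_value_integrable x). Qed.

(** The kernel averages over points where [u] differs from [u x] by at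
most [eta]. *)
Lemma mol_value_approx x : K x -> `|mol_value x - (u x)%:E| <= eta%:E.
Proof.
move=> Kx.
have c1 y : (`|(fun=> 1%R : R) y| <= (1 : R))%R by rewrite normr1.
have i1 : mu.-integrable setT (fun y => (u x * phi (y - x))%:E).
  by apply: (@supp_integrable (fun=> u x) phi x `|u x|%R).
have -> : (u x)%:E = \int[mu]_y (u x * phi (y - x))%:E.
  under eq_integral do rewrite EFinM.
  rewrite integralZl//; first by rewrite phi_translate mule1.
  have := supp_integrable x (measurable_cst (1%R : R)) c1 ler01 ephi phi_supp.
  by under eq_fun do rewrite mul1r.
rewrite -integralB//.
have ib := integrableB measurableT (mol_value_integrable x) i1.
have /integrableP[mb _] := ib.
apply: (le_trans (le_abse_integral _ _ _)) => //.
apply: (@le_trans _ _ (\int[mu]_y (eta%:E * (phi (y - x))%:E))).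
  apply: ge0_le_integral => //.
  - exact: measurableT_comp.
  - by apply: measurable_funeM; apply/measurable_EFinP; exact: measurable_translate.
  move=> y _; rewrite -EFinB -mulrBl -EFinM lee_fin normrM (ger0_norm (phi0 _)).
  have [yx|/ltW /psupp ->] := leP (`|y - x|%R : R) e; last by rewrite !mulr0.
  by rewrite ler_wpM2r// (ut_eq Kx yx); exact: (HK Kx yx).2.
rewrite ge0_integralZl; last 4 first.
- exact: measurableT.
- by apply/measurable_EFinP; exact: measurable_translate.
- by move=> y _; rewrite lee_fin.
- by rewrite lee_fin ltW.
by rewrite phi_translate mule1.
Qed.

Let mD d : measurable_fun setT (fun y => 'D_d phi y).
Proof.
apply: continuous_measurable_rV; apply: elem_continuous.
by have [_] := elem_deriv ephi; exact.
Qed.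

Let eD d : elem (fun y => 'D_d phi y).
Proof. by have [_] := elem_deriv ephi; exact. Qed.

Lemma measurable_curve x d k :
  measurable_fun setT (fun s : measurableTypeR R => (x + s ^+ k *: d)%R).
Proof.
apply: measurable_rVP => i.
rewrite (_ : (fun s => _) = (fun s : measurableTypeR R => x ord0 i + s ^+ k * d ord0 i)%R).
  apply: measurable_funD => //; exact: measurable_funM.
by apply/funext => s; rewrite !mxE.
Qed.

(** The integrand of [mol_value (x + d) - mol_value x] after the
fundamental theorem along x + s^n d, as a function of the time s and the
integration point y. *)
Let F x d (p : measurableTypeR R * rV) : R :=
  (\1_(`[0, 1]%classic : set (measurableTypeR R)) p.1 * (ut p.2 *
    (- (m.+1%:R * p.1 ^+ m) * 'D_d phi (p.2 - (x + p.1 ^+ m.+1 *: d)))))%R.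

Let measurable_F x d : measurable_fun [set: measurableTypeR R * rV] (F x d).
Proof.
apply: measurable_funM.
  apply: (measurableT_comp _ measurable_fst).
  by apply: measurable_indic; exact: measurable_itv.
apply: measurable_funM; first exact: (measurableT_comp mut measurable_snd).
apply: measurable_funM.
  have mh : measurable_fun setT (fun s : measurableTypeR R => (- (m.+1%:R * s ^+ m))%R : measurableTypeR R).
    by apply: measurableT_comp => //; exact: measurable_funM.
  exact: (measurableT_comp mh measurable_fst).
apply: (measurableT_comp (mD d)).
apply: measurable_rVP => j.
rewrite (_ : (fun _ => _) = (fun p : measurableTypeR R * rV => (p.2 ord0 j - (x + p.1 ^+ m.+1 *: d)%R ord0 j)%R)).
  apply: measurable_funB.
    exact: (measurableT_comp (measurable_coord j) measurable_snd).
  apply: (measurableT_comp (measurable_coord j)).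
  exact: (measurableT_comp (measurable_curve x d m.+1) measurable_fst).
by apply/funext => p; rewrite !mxE.
Qed.

Let F_int x d : (lebesgue_measure \x mu).-integrable setT (EFin \o F x d).
Proof.
have [C C0 HC] := supp_bounded (eD d) (@derive_supp d).
pose B := [set y : rV | (`|y| <= `|x| + `|d| + e)%R].
have mB : measurable B.
  rewrite (_ : B = box (const_mx (- (`|x| + `|d| + e))%R) (const_mx (`|x| + `|d| + e)%R)); first exact: measurable_box.
  apply/seteqP; split => y.
    by move=> yp i; rewrite !mxE -ler_norml; exact: le_trans (coord_norm_le _ _) yp.
  move=> H; apply: rV_norm_le => [|i]; first by rewrite !addr_ge0// ltW.
  by have := H i; rewrite !mxE -ler_norml.
apply: (integrable_bounded_supp (A := (`[0%R, 1%R]%classic : set (measurableTypeR R)) `*` B) (C := (M' * (m.+1%:R * C))%R)).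
- by apply: measurableX => //; exact: measurable_itv.
- rewrite [X in X < _](_ : _ = (lebesgue_measure (`[0%R, 1%R]%classic : set (measurableTypeR R)) * lebesgue_rV m.+1 B)%E).
    rewrite lebesgue_measure_itv/= lte01 oppr0 adde0 mul1e.
    by apply: (lebesgue_rV_bounded mB) => y; exact.
  by apply: product_measure1E => //; exact: measurable_itv.
- exact: measurable_F.
- move=> [s y] [/= sI _]; rewrite /F/= indicE mem_set// mul1r normrM.
  move: sI; rewrite /= in_itv/= => /andP[s0 s1].
  rewrite ler_pM// normrM normrN ler_pM// ger0_norm; last by rewrite mulr_ge0// exprn_ge0.
  by rewrite ler_piMr// exprn_ile1.
- move=> [s y] sy; rewrite /F/= indicE.
  have [|_] := boolP (s \in (`[0%R, 1%R]%classic : set (measurableTypeR R))); last by rewrite mul0r.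
  rewrite inE/= in_itv/= => /andP[s0 s1]; rewrite derive_supp ?mulr0//.
  rewrite ltNge; apply: contra_notN sy => sy; split; first by rewrite /= in_itv/= s0.
  rewrite /B/= -[y](subrK (x + s ^+ m.+1 *: d)%R).
  rewrite (le_trans (ler_normD _ _))// addrC lerD//.
  rewrite (le_trans (ler_normD _ _))// lerD2l normrZ ger0_norm ?exprn_ge0//.
  by rewrite ler_piMl// exprn_ile1.
Qed.

Let mol_value_diff x d : mol_value (x + d)%R - mol_value x = \int[mu]_y \int[lebesgue_measure]_s (F x d (s, y))%:E.
Proof.
rewrite -integralB//; apply: eq_integral => y _.
have ep : elem (fun w => ut y * phi w)%R by apply: elemM => //; exact: elem_cst.
have E : (y - x - d = y - (x + d))%R by rewrite opprD addrA.
have := elem_FTC (y - x)%R d ep (ltn0Sn m); rewrite E /= => <-.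
rewrite [LHS]integral_mkcond; apply: eq_integral => s _.
rewrite patchE /F/= indicE; case: ifPn => sI; last by rewrite mul0r.
rewrite mul1r (_ : 'D_d (fun w => (ut y * phi w)%R) _ = (ut y * 'D_d phi (y - (x + s ^+ m.+1 *: d)))%R).
  by congr EFin; ring.
rewrite opprD addrA; apply: (@deriveZ _ _ _ phi (ut y)).
by have [dphi _] := elem_deriv ephi; exact: diff_derivable.
Qed.

Lemma sum_const_ereal k (a : \bar R) : 0 <= a -> \sum_(i < k) a = k%:R%:E * a.
Proof.
move=> a0; elim: k => [|k IH]; first by rewrite big_ord0 mul0e.
by rewrite big_ord_recr/= IH -natr1 EFinD ge0_muleDl ?mul1e// lee_fin.
Qed.

(** The derivative at time s is n s^m times a directional
derivative.  Taking t = T s^-m in [weak_bound] turns s^m (t + t^-m G) into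
T + T^-m s^(m n) G, and s^(m n) is the Jacobian of a homothety of ratio s^n in
dimension m. *)
Let slice_bound x d L T s : (0 < m)%N -> (0 < T)%R ->
  (forall s, (0 <= s <= 1)%R -> K (x + s *: d)%R) -> (forall i, (`|d ord0 i| <= L)%R) ->
  (0 <= s <= 1)%R ->
  `|\int[mu]_y (F x d (s, y))%:E| <= (m.+1%:R ^+ 2 * L)%:E *
   (T%:E + (T^-1 ^+ m)%:E * ((s ^+ (m * m.+1))%:E * mol_energy (x + s ^+ m.+1 *: d)%R)).
Proof.
move=> m0 T0 HKd dL s01; have /andP[s0 s1] := s01.
have L0 : (0 <= L)%R by exact: le_trans (dL ord0).
have sI : s \in (`[0%R, 1%R]%classic : set (measurableTypeR R)) by rewrite inE /= in_itv/=.
set p := (x + s ^+ m.+1 *: d)%R.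
have [s00|sn0] := eqVneq s 0%R.
  rewrite integral0_eq ?normr0; last first.
    by move=> y _; rewrite /F/= s00 expr0n (gtn_eqF m0) mulr0 oppr0 mul0r !mulr0.
  rewrite abse0 mule_ge0//; first by rewrite lee_fin mulr_ge0// exprn_ge0.
  apply: adde_ge0; first by rewrite lee_fin ltW.
  apply: mule_ge0; first by rewrite lee_fin exprn_ge0// invr_ge0 ltW.
  by apply: mule_ge0; [rewrite lee_fin exprn_ge0|exact: mol_energy_ge0].
have sp : (0 < s)%R by rewrite lt_neqAle eq_sym sn0.
have Kp : K p by apply: HKd; rewrite exprn_ge0//= exprn_ile1.
have dphi : forall x, differentiable phi x by have [] := elem_deriv ephi.
pose J i := \int[mu]_(y in Omega) (u y * 'D_(delta_mx ord0 i) (fun y => phi (y - p)) y)%:E.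
have JE i : J i = \int[mu]_y (ut y * 'D_(delta_mx ord0 i) phi (y - p))%:E.
  rewrite /J integral_mkcond; apply: eq_integral => y _; rewrite patchE derive_translate.
  have [yp|yp] := leP (`|y - p|%R : R) e.
    by rewrite (ut_eq Kp yp) mem_set//; exact: (HK Kp yp).1.
  by rewrite derive_supp// !mulr0; case: ifP.
have Ji i : mu.-integrable setT (fun y => (ut y * 'D_(delta_mx ord0 i) phi (y - p))%:E).
  exact: (supp_integrable p mut ut_bound M'0 (eD _) (@derive_supp _)).
have FE : \int[mu]_y (F x d (s, y))%:E =
    \sum_i (- (m.+1%:R * s ^+ m) * d ord0 i)%:E * J i.
  transitivity (\int[mu]_y (\sum_i (- (m.+1%:R * s ^+ m) * d ord0 i)%:E *
      (ut y * 'D_(delta_mx ord0 i) phi (y - p))%:E)).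
    apply: eq_integral => y _; rewrite /F/= indicE sI mul1r -/p derive_coord_sum//.
    under [RHS]eq_bigr do rewrite -EFinM.
    rewrite sumEFin; congr EFin; rewrite mulrA mulr_sumr.
    apply: eq_bigr => i _; ring.
  rewrite integral_sum//; last by move=> i; exact: integrableZl.
  by apply: eq_bigr => i _; rewrite JE (integralZl measurableT (Ji i)).
rewrite FE; pose t := (T * s^-1 ^+ m)%R.
have t0 : (0 < t)%R by rewrite mulr_gt0// exprn_gt0// invr_gt0.
have Jb i : `|J i| <= t%:E + (t^-1 ^+ m)%:E * mol_energy p.
  by apply: weak_bound => // y yp; exact: (HK Kp yp).1.
apply: (le_trans (lee_abs_sum _ _ _)).
apply: (@le_trans _ _ (\sum_(i < m.+1) (m.+1%:R * s ^+ m * L)%:E * (t%:E + (t^-1 ^+ m)%:E * mol_energy p))).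
  apply: lee_sum => i _; rewrite abseM; apply: lee_pmul => //.
  have c0 : (0 <= m.+1%:R * s ^+ m)%R by rewrite mulr_ge0 ?exprn_ge0.
  by rewrite lee_fin mulNr normrN normrM (ger0_norm c0) ler_wpM2l.
have sn : (s ^+ m != 0)%R by rewrite expf_neq0.
have Tn : (T != 0)%R by rewrite gt_eqF.
have Gp0 := mol_energy_ge0 p.
have ti0 : (0 <= t^-1 ^+ m)%R by rewrite exprn_ge0// invr_ge0 ltW.
have Ti0 : (0 <= T^-1 ^+ m)%R by rewrite exprn_ge0// invr_ge0 ltW.
have tG0 : 0 <= t%:E + (t^-1 ^+ m)%:E * mol_energy p.
  by apply: adde_ge0; [rewrite lee_fin ltW|apply: mule_ge0; rewrite ?lee_fin].
rewrite sum_const_ereal; last by apply: mule_ge0 => //; rewrite lee_fin !mulr_ge0// exprn_ge0.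
rewrite muleA -EFinM.
rewrite ge0_muleDr; last 2 first.
- by rewrite lee_fin ltW.
- by rewrite mule_ge0// lee_fin.
rewrite [leRHS]ge0_muleDr; last 2 first.
- by rewrite lee_fin ltW.
- by rewrite mule_ge0 ?lee_fin// mule_ge0// lee_fin exprn_ge0.
rewrite !muleA -!EFinM.
rewrite (_ : (m.+1%:R * (m.+1%:R * s ^+ m * L) * t = m.+1%:R ^+ 2 * L * T)%R); last first.
  rewrite /t exprVn; field; exact: sn.
rewrite (_ : (m.+1%:R * (m.+1%:R * s ^+ m * L) * t^-1 ^+ m = m.+1%:R ^+ 2 * L * T^-1 ^+ m * s ^+ (m * m.+1))%R)//.
rewrite /t invfM exprMn exprVn invrK -exprM mulnS exprD; ring.
Qed.

(** Integral over s of the previous bound. *)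
Lemma mol_value_curve x d L T : (0 < m)%N -> (0 < T)%R ->
  (forall s, (0 <= s <= 1)%R -> K (x + s *: d)%R) -> (forall i, (`|d ord0 i| <= L)%R) ->
  `|mol_value (x + d)%R - mol_value x| <= (m.+1%:R ^+ 2 * L)%:E * (T%:E + (T^-1 ^+ m)%:E *
     \int[lebesgue_measure]_(s in `[0%R, 1%R]) ((s ^+ (m * m.+1))%:E * mol_energy (x + s ^+ m.+1 *: d)%R)).
Proof.
move=> m0 T0 HKd dL.
have L0 : (0 <= L)%R by exact: le_trans (dL ord0).
have Ti0 : (0 <= T^-1 ^+ m)%R by rewrite exprn_ge0// invr_ge0 ltW.
pose I01 : set (measurableTypeR R) := `[0%R, 1%R]%classic.
have mI : measurable I01 by exact: measurable_itv.
have l01 : lebesgue_measure I01 = 1 by rewrite /I01 lebesgue_measure_itv/= lte01 oppr0 adde0.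
pose g1 (s : measurableTypeR R) := (s ^+ (m * m.+1))%:E * mol_energy (x + s ^+ m.+1 *: d)%R.
have mg1 : measurable_fun setT g1.
  apply: emeasurable_funM; first exact/measurable_EFinP.
  exact: (measurableT_comp measurable_mol_energy (measurable_curve x d m.+1)).
have g10 s : I01 s -> 0 <= g1 s.
  rewrite /I01/= in_itv/= => /andP[s0 _].
  by apply: mule_ge0; [rewrite lee_fin exprn_ge0|exact: mol_energy_ge0].
have FI := F_int x d.
have mH := measurable_fubini_F FI.
rewrite mol_value_diff -(Fubini FI).
apply: (le_trans (le_abse_integral _ _ _)) => //.
apply: (@le_trans _ _ (\int[lebesgue_measure]_(s in I01)
   ((m.+1%:R ^+ 2 * L)%:E * (T%:E + (T^-1 ^+ m)%:E * g1 s)))).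
  rewrite [leRHS]integral_mkcond; apply: ge0_le_integral => //.
  - exact: measurableT_comp.
  - apply/(measurable_restrictT _ _).1 => //; apply: measurable_funTS.
    apply: measurable_funeM; apply: emeasurable_funD => //.
    exact: measurable_funeM.
  - move=> s _; rewrite patchE; case: ifPn => sI.
      apply: slice_bound => //; move: sI; rewrite inE /I01/= in_itv//.
    rewrite /fubini_F integral0_eq ?abse0// => y _; rewrite /F/= indicE.
    by rewrite (negbTE sI) mul0r.
rewrite ge0_integralZl//; last 3 first.
- apply: measurable_funTS; apply: emeasurable_funD => //; exact: measurable_funeM.
- move=> s sI; apply: adde_ge0; first by rewrite lee_fin ltW.
  by apply: mule_ge0; [rewrite lee_fin|exact: g10].
- by rewrite lee_fin mulr_ge0// exprn_ge0.
rewrite ge0_integralD//; last 3 first.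
- by move=> s _; rewrite lee_fin ltW.
- by move=> s sI; apply: mule_ge0; [rewrite lee_fin|exact: g10].
- by apply: measurable_funTS; exact: measurable_funeM.
rewrite integral_cst// [X in _ * X + _](_ : _ = 1); last first.
  exact: l01.
rewrite mule1.
rewrite ge0_integralZl//; exact: measurable_funTS.
Qed.

End mollification.

(** * Oscillation on hyperplane slices *)

Section energy.
Context {R : realType}.
Local Open Scope ereal_scope.

(** A continuous function with chosen weak partial derivatives,
together with the measurability that integrals in [weak_partial] need to be
meaningful. *)
Definition sobolev_data n (Omega : set 'rV[R]_n) (u : 'rV[R]_n -> R) (g : 'I_n -> 'rV[R]_n -> R) :=
  [/\ open Omega, forall x, Omega x -> {for x, continuous u},
      measurable_fun setT (u \_ Omega), forall i, measurable_fun setT (g i \_ Omega)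
    & forall i, weak_partial Omega i u (g i)].

Definition energy n (Omega : set 'rV[R]_n) (g : 'I_n -> 'rV[R]_n -> R) : \bar R :=
  \sum_i \int[lebesgue_rV n]_(y in Omega) (`|g i y| ^+ n)%:E.

(** Increments of [u] along segments of [K] controlled by [G], up to
the error [eta].  The weight s^(m n) is the Jacobian of the homothety of ratio
s^n in a hyperplane. *)
Definition osc_bound m (K : set 'rV[R]_m.+1) (u : 'rV[R]_m.+1 -> R) (eta : R) (G : 'rV[R]_m.+1 -> \bar R) :=
  forall x z L T, (0 < T)%R -> (forall s, (0 <= s <= 1)%R -> K (x + s *: (z - x))%R) ->
    (forall i, (`|z ord0 i - x ord0 i| <= L)%R) ->
    (`|u z - u x|)%:E <= eta%:E + (m.+1%:R ^+ 2 * L)%:E * (T%:E + (T^-1 ^+ m)%:E *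
     \int[lebesgue_measure]_(s in `[0%R, 1%R]) ((s ^+ (m * m.+1))%:E * G (x + s ^+ m.+1 *: (z - x))%R)).

(** Trades weak differentiability for a pointwise estimate by a
nonnegative measurable function, to which Tonelli applies. *)
Lemma mollify m (Omega K : set 'rV[R]_m.+1) u g (eta : R) : (0 < m)%N ->
  sobolev_data Omega u g -> compact K -> K `<=` Omega -> (0 < eta)%R ->
  exists G : 'rV[R]_m.+1 -> \bar R, [/\ measurable_fun setT G, forall x, 0 <= G x,
    \int[lebesgue_rV m.+1]_(x in K) G x <= energy Omega g & osc_bound K u eta G].
Proof.
move=> m0 [oO cu mu mg wp] cK KO eta0.
have eta2 : (0 < eta / 2)%R by rewrite divr_gt0.
have [e e0 He] := compact_uniform_radius oO cu cK KO eta2.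
have [phi [ephi phi0 phiN psupp pint]] := bump_exists m.+1 e0.
have [M HM] : exists M : R, forall x, K x -> (`|u x| <= M)%R.
  have [C [_ HC]] : bounded_set (u @` K).
    apply: compact_bounded; apply: continuous_compact => //.
    apply: continuous_in_subspaceT => x; rewrite inE => Kx.
    exact: cu (KO _ Kx).
  have C1 : (C < C + 1)%R by rewrite ltrDl.
  by exists (C + 1)%R => x Kx; apply: (HC _ C1); exists x.
exists (mol_energy Omega g phi); split.
- exact: measurable_mol_energy.
- exact: mol_energy_ge0.
- by apply: integral_mol_energy => //; exact: compact_measurable_rV.
move=> x z L T T0 sK dL.
have Kx : K x by have := sK 0%R; rewrite scale0r addr0; apply; rewrite lexx ler01.
have Kz : K z by have := sK 1%R; rewrite scale1r addrC subrK; apply; rewrite lexx ler01.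
have Vx := mol_value_approx mu e0 ephi phi0 psupp pint eta2 He HM Kx.
have Vz := mol_value_approx mu e0 ephi phi0 psupp pint eta2 He HM Kz.
have dL' i : (`|(z - x)%R ord0 i| <= L)%R by rewrite !mxE.
have := mol_value_curve oO mu mg wp e0 ephi phi0 psupp pint eta2 He HM m0 T0 sK dL'.
have xz : (x + (z - x) = z)%R by rewrite addrC subrK.
rewrite xz.
set Vz' := mol_value _ _ _ _ _ z in Vz *; set Vx' := mol_value _ _ _ _ _ x in Vx *.
have fz : Vz' \is a fin_num by exact: (mol_value_fin mu e0 ephi psupp M eta2).
have fx : Vx' \is a fin_num by exact: (mol_value_fin mu e0 ephi psupp M eta2).
move: Vx Vz; rewrite -(fineK fz) -(fineK fx) -!EFinB !lee_fin => Vx Vz.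
move=> H; apply: (@le_trans _ _ (eta%:E + `|(fine Vz' - fine Vx')%:E|)); last exact: leeD2l.
rewrite -EFinD lee_fin.
move: Vx Vz; set a := fine Vz'; set b := fine Vx' => Vx Vz.
rewrite (_ : u z - u x = (u z - a) + ((b - u x) + (a - b)))%R; last by ring.
have h1 := ler_normD (u z - a)%R ((b - u x) + (a - b))%R.
have h2 := ler_normD (b - u x)%R (a - b)%R.
rewrite distrC in Vz; lra.
Qed.

Lemma measurable_homothety m k (w1 : 'rV[R]_m) : measurable_fun setT
  (fun p : measurableTypeR R * 'rV[R]_m => (w1 + p.1 ^+ k *: (p.2 - w1))%R).
Proof.
apply: measurable_rVP => j.
rewrite (_ : (fun _ => _) = (fun p : measurableTypeR R * 'rV[R]_m =>
    (w1 ord0 j + p.1 ^+ k * (p.2 ord0 j - w1 ord0 j))%R)).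
  apply: measurable_funD => //; apply: measurable_funM.
    apply: measurable_funX; exact: measurable_fst.
  apply: measurable_funB => //.
  exact: (measurableT_comp (measurable_coord j) measurable_snd).
by apply/funext => p; rewrite !mxE.
Qed.

(** The weight cancels the Jacobian of the homothety of
centre [w1] and ratio s^k, which maps [D] into itself: for each s the inner
integral is at most the integral of [H] over [D]. *)
Lemma homothety_average m k (H : 'rV[R]_m -> \bar R) (D : set 'rV[R]_m) w1 :
  (0 < m)%N -> (0 < k)%N -> measurable D ->
  (forall w (s : R), D w -> (0 <= s <= 1)%R -> D (w1 + s *: (w - w1))%R) ->
  measurable_fun setT H -> (forall w, 0 <= H w) ->
  \int[lebesgue_rV m]_(w in D) \int[lebesgue_measure]_(s in `[0%R, 1%R])
     ((s ^+ (m * k))%:E * H (w1 + s ^+ k *: (w - w1))%R) <= \int[lebesgue_rV m]_(w in D) H w.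
Proof.
move=> m0 k0 mD sD mH H0.
pose I01 : set (measurableTypeR R) := `[0%R, 1%R]%classic.
have mI : measurable I01 by exact: measurable_itv.
pose F (p : measurableTypeR R * 'rV[R]_m) := (\1_I01 p.1)%:E * ((\1_D p.2)%:E *
   ((p.1 ^+ (m * k))%:E * H (w1 + p.1 ^+ k *: (p.2 - w1))%R)).
have mF : measurable_fun setT F.
  apply: emeasurable_funM.
    apply/measurable_EFinP; apply: (measurableT_comp (measurable_indic mI)).
    exact: measurable_fst.
  apply: emeasurable_funM.
    apply/measurable_EFinP; apply: (measurableT_comp (measurable_indic mD)).
    exact: measurable_snd.
  apply: emeasurable_funM.
    apply/measurable_EFinP; apply: measurable_funX; exact: measurable_fst.
  exact: (measurableT_comp mH (measurable_homothety k w1)).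
have F0 p : 0 <= F p.
  rewrite /F indicE; have [pI|_] := boolP (p.1 \in I01); last by rewrite mul0e.
  move: pI; rewrite inE/I01/= in_itv/= => /andP[s0 _].
  by rewrite mul1e !mule_ge0// lee_fin ?exprn_ge0// indicE.
rewrite [leLHS](_ : _ = \int[lebesgue_rV m]_w \int[lebesgue_measure]_s F (s, w)); last first.
  rewrite integral_mkcond; apply: eq_integral => w _; rewrite patchE.
  case: ifPn => wD; last first.
    by rewrite integral0_eq// => s _; rewrite /F/= !indicE (negbTE wD) mul0e mule0.
  rewrite integral_mkcond; apply: eq_integral => s _; rewrite patchE /F/= !indicE wD mul1e.
  case: ifPn => sI; last by rewrite mul0e.
  by rewrite mul1e.
rewrite -(fubini_tonelli _ mF F0).
apply: (@le_trans _ _ (\int[lebesgue_measure]_(s in I01) \int[lebesgue_rV m]_(w in D) H w)).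
  rewrite [leRHS]integral_mkcond; apply: ge0_le_integral => //.
  - by move=> s _; apply: integral_ge0.
  - exact: (measurable_fun_fubini_tonelli_F (m2 := lebesgue_rV m) _ mF F0).
  - apply/(measurable_restrictT _ _).1 => //; exact: measurable_cst.
  move=> s _; rewrite patchE; case: ifPn => sI; last first.
    by rewrite /fubini_F integral0_eq// => w _; rewrite /F/= indicE (negbTE sI) mul0e.
  have /andP[s0 s1] : (0 <= s <= 1)%R by move: sI; rewrite inE /I01 /= in_itv.
  rewrite /fubini_F.
  have [s00|sn0] := eqVneq s 0%R.
    rewrite integral0_eq; first by apply: integral_ge0.
    move=> w _; rewrite /F/= (_ : s ^+ (m * k) = 0)%R ?mul0e ?mule0//.
    by rewrite s00 expr0n muln_eq0 (gtn_eqF m0) (gtn_eqF k0).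
  have sp : (0 < s)%R by rewrite lt_neqAle eq_sym sn0.
  have skp : (0 < s ^+ k)%R by rewrite exprn_gt0.
  have mHD : measurable_fun setT (H \_ D) by apply/(measurable_restrictT _ _).1 => //; exact: measurable_funTS.
  have HD0 w : 0 <= (H \_ D) w by rewrite patchE; case: ifP.
  pose b := (w1 - s ^+ k *: w1)%R.
  apply: (@le_trans _ _ (\int[lebesgue_rV m]_(w in [set: 'rV[R]_m]) ((s ^+ (m * k))%:E * (H \_ D) (s ^+ k *: w + b)%R))).
    have mc : measurable_fun setT (fun w : 'rV[R]_m => (H \_ D) (s ^+ k *: w + b)%R).
      exact: (measurableT_comp mHD (measurable_affine_rV _ _)).
    apply: ge0_le_integral => //.
    - exact: (measurableT_comp mF (measurable_pair_cst s)).
    - exact: measurable_funeM.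
    move=> w _; rewrite /F/= !indicE sI mul1e patchE.
    have [wD|wD] := boolP (w \in D); last first.
      by rewrite mul0e mule_ge0// ?lee_fin ?exprn_ge0//; case: ifP.
    rewrite mul1e (_ : w1 + s ^+ k *: (w - w1) = s ^+ k *: w + b)%R; last first.
      by rewrite /b scalerBr; apply/rowP => j; rewrite !mxE; ring.
    rewrite ifT// inE (_ : s ^+ k *: w + b = w1 + s ^+ k *: (w - w1))%R; last first.
      by rewrite /b scalerBr; apply/rowP => j; rewrite !mxE; ring.
    apply: sD; first by move: wD; rewrite inE.
    by rewrite exprn_ge0//= exprn_ile1.
  rewrite ge0_integralZl; last 4 first.
  - exact: measurableT.
  - exact: (measurableT_comp mHD (measurable_affine_rV _ _)).
  - by move=> w _; exact: HD0.
  - by rewrite lee_fin exprn_ge0.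
  rewrite (integral_rV_affine _ skp mHD HD0) muleA -EFinM.
  rewrite (_ : _ * _ = 1)%R; last first.
    by rewrite exprVn -exprM mulnC mulfV// expf_neq0.
  by rewrite mul1e [leRHS]integral_mkcond.
have l01 : lebesgue_measure I01 = 1 by rewrite /I01 lebesgue_measure_itv/= lte01 oppr0 adde0.
suff cstI (X : \bar R) : \int[lebesgue_measure]_(s in I01) X <= X by exact: cstI.
by rewrite integral_cst// [Y in _ * Y](_ : _ = 1) ?mule1.
Qed.

(** The mean over [c1, c2] of the slice integrals is less than
E / (c2 - c1). *)
Lemma pick_slice m (i : 'I_m.+1) (K : set 'rV[R]_m.+1) (G : 'rV[R]_m.+1 -> \bar R) (E c1 c2 : R) :
  measurable K -> measurable_fun setT G -> (forall x, 0 <= G x) ->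
  \int[lebesgue_rV m.+1]_(x in K) G x < E%:E -> (c1 < c2)%R ->
  exists2 c : R, (c1 <= c <= c2)%R &
    \int[lebesgue_rV m]_(w in [set w | K (ins_rV i (c, w))]) G (ins_rV i (c, w)) <=
    (E / (c2 - c1))%:E.
Proof.
move=> mK mG G0 GE c12; apply: contrapT => H.
have c21 : (0 < c2 - c1)%R by rewrite subr_gt0.
pose I : set (measurableTypeR R) := `[c1, c2]%classic.
have mI : measurable I by exact: measurable_itv.
have mGK : measurable_fun setT (G \_ K) by apply/(measurable_restrictT _ _).1 => //; exact: measurable_funTS.
have GK0 x : 0 <= (G \_ K) x by rewrite patchE; case: ifP.
have GE0 : 0 <= E%:E by apply: le_trans (ltW GE); exact: integral_ge0.
have mF : measurable_fun setT ((G \_ K) \o ins_rV i).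
  exact: (measurableT_comp mGK (measurable_ins_rV i)).
pose Phi (c : measurableTypeR R) := \int[lebesgue_rV m]_w (G \_ K) (ins_rV i (c, w)).
have mPhi : measurable_fun setT Phi.
  exact: (measurable_fun_fubini_tonelli_F (m2 := lebesgue_rV m) _ mF (fun p => GK0 _)).
have Phi0 c : 0 <= Phi c by apply: integral_ge0.
move: GE; apply/negP; rewrite -leNgt integral_mkcond (integral_rV_ins i)//.
apply: (@le_trans _ _ (\int[lebesgue_measure]_(c in I) Phi c)); last exact: ge0_subset_integral.
apply: (@le_trans _ _ (\int[lebesgue_measure]_(c in I) ((E / (c2 - c1))%:E))).
  rewrite integral_cst//.
  have lI : lebesgue_measure I = (c2 - c1)%:E by rewrite /I lebesgue_measure_itv/= lte_fin c12.
  rewrite [X in _ * X](_ : _ = (c2 - c1)%:E); last exact: lI.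
  by rewrite -EFinM divfK// gt_eqF.
apply: ge0_le_integral => //.
- by move=> c _; rewrite lee_fin divr_ge0// ltW.
- exact: measurable_funTS.
move=> c; rewrite /I/= in_itv/= => cI; rewrite leNgt; apply/negP => /ltW hc.
apply: H; exists c => //; apply: le_trans hc; rewrite /Phi integral_mkcond le_eqVlt; apply/orP; left.
by apply/eqP; apply: eq_integral => w _; rewrite !patchE.
Qed.

Lemma ins_rV_homothety m (i : 'I_m.+1) c (w w1 : 'rV[R]_m) (s : R) :
  (ins_rV i (c, w1) + s *: (ins_rV i (c, w) - ins_rV i (c, w1)) = ins_rV i (c, w1 + s *: (w - w1)))%R.
Proof.
apply/rowP => j; have [k ->|->] := unliftP i j.
  by rewrite ins_rV_lift !mxE liftK.
by rewrite ins_rV_i !mxE unlift_none subrr mulr0 addr0.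
Qed.

Lemma measurable_homothety_integral m k (H : 'rV[R]_m -> \bar R) w1 (l : nat) :
  measurable_fun setT H -> (forall w, 0 <= H w) ->
  measurable_fun setT (fun w : 'rV[R]_m => \int[lebesgue_measure]_(s in `[0%R, 1%R])
     ((s ^+ l)%:E * H (w1 + s ^+ k *: (w - w1))%R)).
Proof.
move=> mH H0.
pose I01 : set (measurableTypeR R) := `[0%R, 1%R]%classic.
have mI : measurable I01 by exact: measurable_itv.
pose F (p : measurableTypeR R * 'rV[R]_m) := (\1_I01 p.1)%:E *
   ((p.1 ^+ l)%:E * H (w1 + p.1 ^+ k *: (p.2 - w1))%R).
have mF : measurable_fun setT F.
  apply: emeasurable_funM.
    apply/measurable_EFinP; apply: (measurableT_comp (measurable_indic mI)).
    exact: measurable_fst.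
  apply: emeasurable_funM.
    apply/measurable_EFinP; apply: measurable_funX; exact: measurable_fst.
  exact: (measurableT_comp mH (measurable_homothety k w1)).
have F0 p : 0 <= F p.
  rewrite /F indicE; have [pI|_] := boolP (p.1 \in I01); last by rewrite mul0e.
  move: pI; rewrite inE/I01/= in_itv/= => /andP[s0 _].
  by rewrite mul1e !mule_ge0// lee_fin ?exprn_ge0// indicE.
have := measurable_fun_fubini_tonelli_G (m1 := lebesgue_measure) _ mF F0.
apply: eq_measurable_fun => w _; rewrite /fubini_G [RHS]integral_mkcond.
apply: eq_integral => s _; rewrite patchE /F/= indicE.
by case: ifPn => _; rewrite ?mul1e ?mul0e.
Qed.

(** Morrey's estimate in the hyperplane.  Compare u x and u y
with u w for all w in the slice of [W], and average over w: by
[homothety_average] the averages of the two bounds are at most E / kappa. *)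
Lemma slice_oscillation m (i : 'I_m.+1) (K W : set 'rV[R]_m.+1) u (G : 'rV[R]_m.+1 -> \bar R)
    (eta c L kappa E T : R) : (0 < m)%N ->
  measurable_fun setT G -> (forall x, 0 <= G x) -> osc_bound K u eta G ->
  W `<=` K -> measurable W -> measurable K ->
  (forall x y s, W x -> W y -> (0 <= s <= 1)%R -> W (x + s *: (y - x))%R) ->
  (forall x y k, W x -> W y -> (`|x ord0 k - y ord0 k| <= L)%R) ->
  let D := [set w | W (ins_rV i (c, w))] in
  (0 < kappa)%R -> kappa%:E <= lebesgue_rV m D ->
  \int[lebesgue_rV m]_(w in [set w | K (ins_rV i (c, w))]) G (ins_rV i (c, w)) <= E%:E ->
  (0 < L)%R -> (0 < T)%R -> forall x y, W x -> W y -> x ord0 i = c -> y ord0 i = c ->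
  (`|u x - u y| <= 2 * eta + 2 * (m.+1%:R ^+ 2 * L) * (T + T^-1 ^+ m * (E / kappa)))%R.
Proof.
move=> m0 mG G0 osc WK mW mK cW dW D k0 kD GE L0 T0 x y Wx Wy xc yc.
have mins : measurable_fun setT (fun w : 'rV[R]_m => ins_rV i (c, w)).
  exact: (measurableT_comp (measurable_ins_rV i) (measurable_pair_cst c)).
have mD : measurable D by exact: measurable_preimageT mins mW.
pose H (w : 'rV[R]_m) := G (ins_rV i (c, w)).
have mH : measurable_fun setT H by exact: (measurableT_comp mG mins).
have H0 w : 0 <= H w by exact: G0.
have HE : \int[lebesgue_rV m]_(w in D) H w <= E%:E.
  apply: le_trans GE; apply: ge0_subset_integral => //.
  - exact: measurable_preimageT mins mK.
  - exact: measurable_funTS.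
  - by move=> w; exact: WK.
have E0 : (0 <= E)%R by rewrite -lee_fin; apply: le_trans HE; exact: integral_ge0.
pose Phi (w1 w : 'rV[R]_m) : \bar R := \int[lebesgue_measure]_(s in `[0%R, 1%R])
     ((s ^+ (m * m.+1))%:E * H (w1 + s ^+ m.+1 *: (w - w1))%R).
have Phi0 w1 w : 0 <= Phi w1 w.
  apply: integral_ge0 => s; rewrite /= in_itv/= => /andP[s0 _].
  by rewrite mule_ge0// lee_fin exprn_ge0.
have mPhi w1 : measurable_fun setT (Phi w1) by exact: measurable_homothety_integral.
have PhiE w1 : D w1 -> \int[lebesgue_rV m]_(w in D) Phi w1 w <= E%:E.
  move=> Dw1; apply: le_trans HE; apply: homothety_average => // w s Dw s01.
  by rewrite /D/= -ins_rV_homothety; exact: cW.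
pose pr (z : 'rV[R]_m.+1) : 'rV[R]_m := (\row_k z ord0 (lift i k))%R.
have prE (z : 'rV[R]_m.+1) : z ord0 i = c -> ins_rV i (c, pr z) = z.
  move=> zc; apply/rowP => j; have [k ->|->] := unliftP i j.
    by rewrite ins_rV_lift !mxE.
  by rewrite ins_rV_i.
have [C CE] : exists C : R, C = (m.+1%:R ^+ 2 * L)%R by eexists.
have C0 : (0 < C)%R by rewrite CE mulr_gt0// exprn_gt0.
have TT : (0 < T^-1 ^+ m)%R by rewrite exprn_gt0// invr_gt0.
have step (z : 'rV[R]_m.+1) (w : 'rV[R]_m) : W z -> z ord0 i = c -> D w ->
    (`|u (ins_rV i (c, w)) - u z|)%:E <= eta%:E + C%:E * (T%:E + (T^-1 ^+ m)%:E * Phi (pr z) w).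
  move=> Wz zc Dw.
  have := osc z (ins_rV i (c, w)) L T T0; rewrite -CE.
  have -> : \int[lebesgue_measure]_(s in `[0%R, 1%R]) ((s ^+ (m * m.+1))%:E *
     G (z + s ^+ m.+1 *: (ins_rV i (c, w) - z))%R) = Phi (pr z) w.
    by apply: eq_integral => s _; rewrite -{1 2}(prE z zc) ins_rV_homothety.
  apply; last by move=> k; exact: dW.
  by move=> s s01; apply: WK; exact: cW.
pose B := (`|u x - u y| - 2 * eta - 2 * C * T)%R.
have BPhi w : D w -> B%:E <= (C * T^-1 ^+ m)%:E * (Phi (pr x) w + Phi (pr y) w).
  move=> Dw; have := step x w Wx xc Dw; have := step y w Wy yc Dw.
  have h1 := Phi0 (pr x) w; have h2 := Phi0 (pr y) w.
  have CT : 0 < (C * T^-1 ^+ m)%:E by rewrite lte_fin mulr_gt0.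
  have ny (a : \bar R) : 0 <= a -> a != -oo by case: a.
  (* where one of the two bounds is infinite there is nothing to prove *)
  have [ax|ax] := eqVneq (Phi (pr x) w) +oo.
    by rewrite ax addye ?ny// => _ _; rewrite gt0_muley// leey.
  have [ay|ay] := eqVneq (Phi (pr y) w) +oo.
    by rewrite ay addey ?ny// => _ _; rewrite gt0_muley// leey.
  move: h1 h2 ax ay; case: (Phi (pr x) w) => [a| |] // _; case: (Phi (pr y) w) => [b| |] // _ _ _.
  rewrite -!EFinM -!EFinD !lee_fin /B => hy hx.
  set z := u _ in hx hy.
  have := ler_normD (u x - z)%R (z - u y)%R; rewrite (distrC (u x)) addrA subrK.
  move: hx hy; rewrite !mulrDr !mulrA; lra.
rewrite -CE; suff : (B <= 2 * C * (T^-1 ^+ m * (E / kappa)))%R by rewrite /B !mulrDr; lra.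
have [B0|B0] := leP B 0%R.
  by apply: (le_trans B0); rewrite !mulr_ge0// ?ltW// invr_gt0.
have : (B * kappa)%:E <= (C * T^-1 ^+ m * (E + E))%:E.
  rewrite EFinM; apply: (@le_trans _ _ (B%:E * lebesgue_rV m D)).
    by rewrite lee_pmul2l// lte_fin.
  apply: (@le_trans _ _ (\int[lebesgue_rV m]_(w in D) ((C * T^-1 ^+ m)%:E * (Phi (pr x) w + Phi (pr y) w)))).
    have -> : B%:E * lebesgue_rV m D = \int[lebesgue_rV m]_(w in D) B%:E by rewrite integral_cst.
    apply: ge0_le_integral => //.
    - by move=> w _; rewrite lee_fin ltW.
    - by apply: measurable_funeM; apply: measurable_funTS; exact: emeasurable_funD.
  rewrite ge0_integralZl//; last 3 first.
  - by apply: measurable_funTS; exact: emeasurable_funD.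
  - by move=> w _; rewrite adde_ge0.
  - by rewrite lee_fin mulr_ge0// ltW.
  rewrite ge0_integralD//; last 2 first.
  - exact: measurable_funTS.
  - exact: measurable_funTS.
  rewrite [leRHS]EFinM EFinD lee_pmul2l//; last by rewrite lte_fin mulr_gt0.
  by apply: leeD; apply: PhiE; rewrite /D/= prE.
rewrite lee_fin -ler_pdivlMr// => /le_trans; apply.
rewrite le_eqVlt; apply/orP; left; apply/eqP; field; exact: lt0r_neq0.
Qed.

End energy.

(** * Sobolev functions on smaller open sets *)

Section restriction.
Context {R : realType}.

Lemma derive_off_support n (phi : 'rV[R]_n -> R) v x :
  ~ closure [set y | phi y != 0] x -> 'D_v phi x = 0 /\ phi x = 0.
Proof.
move=> nx.
have H : \near x, phi x = cst 0 x.
  have : open (~` closure [set y | phi y != 0]) by apply: closed_openC; exact: closed_closure.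
  move=> /(_ x nx); apply: filterS => y ny; apply: contrapT => /eqP py.
  by apply: ny; exact: subset_closure.
split; first by rewrite (near_eq_derive v H) derive_cst.
exact: nbhs_singleton H.
Qed.

(** A test function of the smaller set is one of the larger,
and both sides of the defining identity live on its support. *)
Lemma sobolev_restrict n (Omega U : set 'rV[R]_n) u g : sobolev_data Omega u g ->
  open U -> U `<=` Omega -> sobolev_data U u g.
Proof.
move=> [oO cu mu mg wp] oU UO.
have mO : measurable Omega by exact: open_measurable_rV.
have mU : measurable U by exact: open_measurable_rV.
have restr (f : 'rV[R]_n -> R) : measurable_fun setT (f \_ Omega) -> measurable_fun setT (f \_ U).
  move=> mf; apply/(measurable_restrictT _ _).1 => //.
  by apply: measurable_funS UO _ => //; apply/measurable_restrictT.
split => //; [by move=> x /UO; exact: cu|exact: restr|by move=> i; exact: restr|].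
move=> i phi [sphi cphi pU].
have := wp i phi (And3 sphi cphi (subset_trans pU UO)).
have e (f p : 'rV[R]_n -> R) : (forall x, ~ U x -> p x = 0) ->
    (\int[lebesgue_rV n]_(x in Omega) (f x * p x)%:E = \int[lebesgue_rV n]_(x in U) (f x * p x)%:E)%E.
  move=> p0; rewrite [LHS]integral_mkcond [RHS]integral_mkcond; apply: eq_integral => x _.
  rewrite !patchE; case: ifPn => [xO|xO]; case: ifPn => [xU|xU] //.
    by rewrite p0 ?mulr0// => Ux; move: xU; rewrite mem_set.
  by move: xO; rewrite mem_set//; apply: UO; move: xU; rewrite inE.
rewrite e; last by move=> x nU; apply: (derive_off_support _ _).1 => /pU.
by rewrite e// => x nU; apply: (derive_off_support (delta_mx ord0 i) _).2 => /pU.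
Qed.

(** Absolute continuity of the integral: a small ball has small
measure. *)
Lemma energy_small n (Omega : set 'rV[R]_n) (g : 'I_n -> 'rV[R]_n -> R) q (e : R) :
  (0 < n)%N -> open Omega -> (forall i, measurable_fun setT (g i \_ Omega)) ->
  (energy Omega g < +oo)%E -> 0 < e ->
  exists2 d : R, 0 < d & forall U, open U -> U `<=` Omega -> (forall x, U x -> `|x - q| <= d) ->
    (energy U g < e%:E)%E.
Proof.
move=> n0 oO mg Eoo e0.
have mO : measurable Omega by exact: open_measurable_rV.
pose f i x := `|(g i \_ Omega) x| ^+ n.
have mf i : measurable_fun setT (f i).
  by apply: measurable_funX; apply: measurableT_comp => //; exact: mg.
have fE i U : measurable U -> U `<=` Omega ->
    (\int[lebesgue_rV n]_(x in U) (`|g i x| ^+ n)%:E = \int[lebesgue_rV n]_(x in U) (`|f i x|)%:E)%E.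
  move=> mU UO; apply: eq_integral => x; rewrite inE => Ux.
  by rewrite /f patchE mem_set ?normrX ?normr_id//; exact: UO.
have fint i : (lebesgue_rV n).-integrable setT (EFin \o f i).
  apply/integrableP; split; first exact/measurable_EFinP.
  apply: le_lt_trans Eoo; rewrite /energy (bigD1 i)//=.
  have -> : (\int[lebesgue_rV n]_x `|(f i x)%:E| = \int[lebesgue_rV n]_(x in Omega) (`|g i x| ^+ n)%:E)%E.
    rewrite [RHS]integral_mkcond; apply: eq_integral => x _; rewrite /f !patchE.
    by case: ifPn => // _; rewrite ?normr0 ?expr0n ?gtn_eqF//= ?normr0// normrX normr_id.
  by rewrite leeDl// sume_ge0// => j _; apply: integral_ge0 => x _; rewrite lee_fin exprn_ge0.
have en0 : 0 < e / 2 / n%:R by rewrite !divr_gt0// ltr0n.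
have H i : exists d : R, 0 < d /\ forall A, measurable A -> (lebesgue_rV n A < d%:E)%E ->
    (\int[lebesgue_rV n]_(x in A) (`|f i x|)%:E < (e / 2 / n%:R)%:E)%E.
  have [d [d0 dH]] := integral_normr_continuous (fint i) en0.
  exists d; split => // A mA /(dH A mA); rewrite /Rintegral -lte_fin fineK//.
  rewrite ge0_fin_numE; last by apply: integral_ge0.
  have /integrableP[_ foo] := fint i.
  apply: le_lt_trans foo; apply: ge0_subset_integral => //.
  by apply/measurable_EFinP; apply: measurableT_comp.
have [d Hd] := choice H.
have [d' d'0 d'd] : exists2 d' : R, 0 < d' & forall i, d' <= d i.
  have dm0 (s : seq 'I_n) : exists2 d' : R, 0 < d' & forall i, i \in s -> d' <= d i.
    elim: s => [|i s [d1 d10 IH]]; first by exists 1.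
    exists (Num.min (d i) d1); first by rewrite lt_min d10 (Hd i).1.
    move=> j; rewrite inE => /predU1P[->|/IH]; first by rewrite ge_min lexx.
    by move=> H1; rewrite ge_min H1 orbT.
  have [d1 d10 IH] := dm0 (enum 'I_n); exists d1 => // i; apply: IH; exact: mem_enum.
pose r := Num.min 1 (d' / 4).
have r0 : 0 < r by rewrite lt_min ltr01 divr_gt0.
exists (r / 2); first by rewrite divr_gt0.
move=> U oU UO Uq.
have mU : measurable U by exact: open_measurable_rV.
have Ud i : (lebesgue_rV n U < (d i)%:E)%E.
  apply: (@le_lt_trans _ _ (lebesgue_rV n (box (q - const_mx (r / 2)) (q + const_mx (r / 2))))).
    apply: le_measure; rewrite ?inE//; first exact: measurable_box.
    move=> x /Uq xq k; rewrite !mxE; have := le_trans (coord_norm_le (x - q) k) xq.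
    by rewrite !mxE ler_norml; lra.
  rewrite lebesgue_rV_box; last by move=> k; rewrite !mxE; lra.
  rewrite lte_fin (lt_le_trans _ (d'd i))//.
  rewrite (eq_bigr (fun=> r)); last by move=> k _; rewrite !mxE; lra.
  rewrite prodr_const card_ord; apply: (@le_lt_trans _ _ r).
    rewrite -[leRHS]expr1; apply: ler_wiXn2l => //; first exact: ltW.
    by rewrite /r ge_min lexx.
  by rewrite /r gt_min; apply/orP; right; lra.
apply: (@le_lt_trans _ _ (\sum_(i < n) (e / 2 / n%:R)%:E)%E).
  by apply: lee_sum => i _; rewrite fE//; exact/ltW/(Hd i).2.
rewrite sumEFin lte_fin sumr_const card_ord -[ltLHS]mulr_natr divfK; first lra.
by rewrite pnatr_eq0 -lt0n.
Qed.

(** Otherwise [O] would be open and closed in the image of the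
interval. *)
Lemma path_crossing (T : topologicalType) (gam : R -> T) (a b : R) (O F : set T) : a <= b ->
  {within `[a, b], continuous gam} -> open O -> closed F -> O `<=` F ->
  O (gam a) -> ~ O (gam b) -> exists2 s, a <= s <= b & F (gam s) /\ ~ O (gam s).
Proof.
move=> ab cg oO cF OF Oa Ob; apply: contrapT => H.
have cA : connected (gam @` `[a, b]).
  by apply: connected_continuous_connected => //; exact: segment_connected.
have aI : `[a, b]%classic a by rewrite /= in_itv/= lexx.
have bI : `[a, b]%classic b by rewrite /= in_itv/= lexx ab.
have : gam @` `[a, b] `&` O = gam @` `[a, b].
  apply: cA; first by exists (gam a); split => //; exists a.
    by exists O.
  exists F => //; apply/seteqP; split => x [[s sI <-]] Ox.
    by split; [exists s|exact: OF].
  split; first by exists s.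
  apply: contrapT => nO; apply: H; exists s; last by split.
  by have := sI; rewrite /= in_itv.
move=> E; apply: Ob; suff : (gam @` `[a, b] `&` O) (gam b) by case.
by rewrite E; exists b.
Qed.

End restriction.

(** * The Euclidean ball *)

Section ball.
Context {R : realType}.

(** The square of the Euclidean norm; `|x| is the sup norm. *)
Definition sqnorm n (x : 'rV[R]_n) : R := \sum_i x ord0 i ^+ 2.

Lemma sqnorm_ge0 n (x : 'rV[R]_n) : 0 <= sqnorm x.
Proof. by apply: sumr_ge0 => i _; exact: sqr_ge0. Qed.

Lemma unit_ballE n (x : 'rV[R]_n) : unit_ball R n x <-> sqnorm x < 1.
Proof.
by rewrite /unit_ball/= /euclidean_norm -[X in _ < X]sqrtr1 -/(sqnorm x) ltr_sqrt.
Qed.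

Lemma sqnorm_continuous n : continuous (@sqnorm n).
Proof.
move=> x; apply: differentiable_continuous.
have -> : @sqnorm n = \sum_(i < n) (fun x : 'rV[R]_n => x ord0 i ^+ 2).
  by apply/funext => y; rewrite fct_sumE.
apply: differentiable_sum => i.
have H : differentiable (fun y : 'rV[R]_n => y ord0 i) x by exact: differentiable_coord.
have -> : (fun y : 'rV[R]_n => y ord0 i ^+ 2) = (fun y : 'rV[R]_n => y ord0 i) * (fun y : 'rV[R]_n => y ord0 i).
  by apply/funext => y; rewrite expr2.
exact: differentiableM.
Qed.

Lemma open_unit_ball n : open (unit_ball R n).
Proof.
rewrite (_ : unit_ball R n = @sqnorm n @^-1` [set t | t < 1]); last first.
  by apply/seteqP; split => x /unit_ballE.
by apply: open_comp => [x _|]; [exact: sqnorm_continuous|exact: open_lt].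
Qed.

Lemma coord_sqnorm n (x : 'rV[R]_n) i : x ord0 i ^+ 2 <= sqnorm x.
Proof.
by rewrite /sqnorm (bigD1 i)//= lerDl; apply: sumr_ge0 => k _; exact: sqr_ge0.
Qed.

Lemma sqnorm_norm n (x : 'rV[R]_n) : sqnorm x <= 1 -> `|x| <= 1.
Proof.
move=> x1; apply: rV_norm_le => // i.
rewrite -(@ler_pXn2r _ 2)// ?nnegrE// expr1n real_normK ?num_real//.
by rewrite (le_trans (coord_sqnorm _ _)).
Qed.

Lemma sqnorm_segment n (x y : 'rV[R]_n) (s : R) : 0 <= s <= 1 ->
  sqnorm (x + s *: (y - x)) <= (1 - s) * sqnorm x + s * sqnorm y.
Proof.
move=> /andP[s0 s1]; rewrite /sqnorm !mulr_sumr -big_split/=; apply: ler_sum => i _.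
rewrite !mxE; move: (x ord0 i) (y ord0 i) => a b.
rewrite -subr_ge0 (_ : _ - _ = s * (1 - s) * (a - b) ^+ 2); last by ring.
by rewrite mulr_ge0 ?sqr_ge0// mulr_ge0// subr_ge0.
Qed.

Lemma closed_sqnorm_le n (r : R) : closed [set x : 'rV[R]_n | sqnorm x <= r].
Proof.
apply: (@closed_comp _ _ (@sqnorm n) [set t : R | t <= r]); last exact: closed_le.
by move=> x _; exact: sqnorm_continuous.
Qed.

Lemma compact_sub_closed_ball n (A : set 'rV[R]_n) : closed A -> (forall x, A x -> sqnorm x <= 1) -> compact A.
Proof.
move=> cA A1; apply: bounded_closed_compact => //.
exists 1; split; first exact: num_real.
by move=> M M1 x /A1/sqnorm_norm x1 /=; rewrite (le_trans x1)// ltW.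
Qed.

Lemma closed_slab n (lo hi : 'I_n -> R) :
  closed [set x : 'rV[R]_n | forall k, lo k <= x ord0 k <= hi k].
Proof.
rewrite (_ : mkset _ = \bigcap_(k in [set: 'I_n]) ((fun x : 'rV[R]_n => x ord0 k) @^-1` `[lo k, hi k])).
  apply: closed_bigI => k _; apply: closed_comp; last exact: itv_closed.
  by move=> x _; exact: coord_continuous.
apply/seteqP; split => x H k; first by move=> _ /=; rewrite in_itv; exact: H.
by have := H k I; rewrite /= in_itv.
Qed.

Lemma open_slab n (lo hi : 'I_n -> R) :
  open [set x : 'rV[R]_n | forall k, lo k < x ord0 k < hi k].
Proof.
rewrite openE => x Hx.
suff H : forall k, nbhs x [set y : 'rV[R]_n | lo k < y ord0 k < hi k].
  exact: (@filter_forall _ _ (fun k (y : 'rV[R]_n) => lo k < y ord0 k < hi k) (nbhs x) _ H).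
move=> k.
have : open ((fun x : 'rV[R]_n => x ord0 k) @^-1` `]lo k, hi k[%classic).
  apply: open_comp; last exact: itv_open.
  by move=> y _; exact: coord_continuous.
move=> /(_ x) H; have {H} : nbhs x ((fun x : 'rV[R]_n => x ord0 k) @^-1` `]lo k, hi k[%classic).
  by apply: H; rewrite /= in_itv; exact: Hx.
by apply: filterS => y; rewrite /= in_itv.
Qed.

(** Only accumulation at [q] is asked for; the curve may wander. *)
Definition curve_to n (B : set 'rV[R]_n) (q : 'rV[R]_n) (gam : R -> 'rV[R]_n) (s0 : R) :=
  [/\ 0 < s0, forall s1, 0 < s1 -> {within `[s1, s0], continuous gam},
      forall s, 0 < s <= s0 -> B (gam s) &
      forall e, 0 < e -> exists2 s, 0 < s <= s0 & `|gam s - q| < e].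

End ball.

(** * Asymptotic values at a boundary point *)

Section asymptotic.
Context {R : realType}.

Lemma curve_inside n (q : 'rV[R]_n) gam s0 (s1 : R) : curve_to (unit_ball R n) q gam s0 ->
  0 < s1 <= s0 -> exists2 r : R, r < 1 & forall s, s1 <= s <= s0 -> sqnorm (gam s) <= r.
Proof.
move=> [s00 cg Bg _] /andP[s10 s1s0].
have cI : {within `[s1, s0], continuous (@sqnorm R n \o gam)}.
  move=> x; apply: (@continuous_comp (subspace `[s1, s0]) _ _ gam (@sqnorm R n)).
    exact: (cg s1 s10).
  exact: sqnorm_continuous.
have [c cI' cmax] := EVT_max s1s0 cI.
exists (sqnorm (gam c)).
  apply/unit_ballE; apply: Bg; move: cI'; rewrite in_itv/= => /andP[h1 h2].
  by rewrite (lt_le_trans s10 h1).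
by move=> s sI; apply: cmax; rewrite in_itv.
Qed.

(** At a scale rho, build a box around [q] whose
faces carry little energy: q is inside and both curves start outside, so each
crosses a face.  On a face inside B the function has small oscillation.  Near
[q], the sphere is a Lipschitz graph over the hyperplane orthogonal to e_j, where
q_j is the largest entry of q in absolute value, so if the box is taller in the direction e_j, then its
face beyond q lies outside of B, and its face below q lies inside of B and
meets all the lateral faces there.  The values on the two curves are then both
close to the value of [u] at one point of that face.  Box faces are slices,
picked by their energy at scale rho: the energy near q is below a constant
theta^n, and the estimate is scale invariant. *)
Lemma asymptotic_values_coincide m (u : 'rV[R]_m.+1 -> R) g (q : 'rV[R]_m.+1)
    (ga gb : R -> 'rV[R]_m.+1) (sa sb a b : R) : (0 < m)%N ->
  sobolev_data (unit_ball R m.+1) u g -> (energy (unit_ball R m.+1) g < +oo)%E ->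
  sqnorm q = 1 ->
  curve_to (unit_ball R m.+1) q ga sa -> (forall s, 0 < s <= sa -> u (ga s) = a) ->
  curve_to (unit_ball R m.+1) q gb sb -> (forall s, 0 < s <= sb -> u (gb s) = b) ->
  a = b.
Proof.
move=> m0 sob Eoo q1 cva ua cvb ub; apply: contrapT => /eqP ab.
set B := unit_ball R m.+1 in sob Eoo cva cvb *.
have oB : open B by exact: open_unit_ball.
have [N NE] : exists N : R, m.+1%:R = N by eexists.
have N1 : 1 <= N by rewrite -NE ler1n.
have N0 : 0 < N by rewrite -NE ltr0n.
(* a coordinate along which the sphere is a Lipschitz graph near q *)
have [j jmax] : exists j, forall k, `|q ord0 k| <= `|q ord0 j|.
  by case: (@arg_maxP _ R 'I_m.+1 ord0 xpredT (fun i => `|q ord0 i|) isT) => j _ jmax; exists j => k; exact: jmax.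
have [Q QE] : exists Q : R, `|q ord0 j| = Q by eexists.
rewrite QE in jmax.
have Q0 : 0 < Q.
  rewrite -QE normr_gt0; apply/eqP => qj; move: q1; rewrite /sqnorm big1; first by move/eqP; rewrite eq_sym oner_eq0.
  move=> k _; have := jmax k; rewrite -QE qj normr0 normr_le0 => /eqP ->; by rewrite expr0n.
have [sg sgQ sg1] : exists2 sg : R, q ord0 j = sg * Q & sg = 1 \/ sg = -1.
  by have [h|h] := leP 0 (q ord0 j); [exists 1|exists (-1)]; rewrite -?QE ?(ger0_norm h) ?(ltr0_norm h) ?mul1r ?mulN1r ?opprK//; [left|right].
have D0 : 0 < `|a - b| by rewrite normr_gt0 subr_eq0.
pose eta := `|a - b| / 32.
have eta0 : 0 < eta by rewrite divr_gt0.
have [K K512 K0] : exists2 K : R, K = 8 * 8 * 8 & 0 < K by exists (8 * 8 * 8); rewrite ?mulr_gt0.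
pose theta := `|a - b| / (K * N ^+ 3).
have N30 : 0 < N ^+ 3 by rewrite exprn_gt0.
have theta0 : 0 < theta by rewrite divr_gt0// mulr_gt0.
(* The n-th power of the oscillation scale theta: the two terms of the slice
   estimate are then equal, and the constant K makes them small. *)
pose E := theta ^+ m * (`|a - b| / (K * N ^+ 3)).
have E0 : 0 < E by rewrite mulr_gt0 ?exprn_gt0// divr_gt0// mulr_gt0.
have [_ _ _ mg _] := sob.
have [delta delta0 Hdelta] := energy_small q (ltn0Sn m) oB mg Eoo E0.
have nBq : ~ B q by move=> /unit_ballE; rewrite q1 ltxx.
have away gam s0 : curve_to B q gam s0 -> 0 < `|gam s0 - q|.
  move=> [s00 _ Bg _]; rewrite normr_gt0 subr_eq0; apply/eqP => gq; apply: nBq.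
  by rewrite -gq; apply: Bg; rewrite s00 lexx.
have da0 := away _ _ cva; have db0 := away _ _ cvb.
have [rho [rho0 rd ra rb rQ]] : exists rho : R, [/\ 0 < rho, 8 * N * rho < delta, 8 * N * rho < `|ga sa - q|,
    8 * N * rho < `|gb sb - q| & 64 * N ^+ 2 * rho <= Q].
  pose M := Num.min (Num.min delta Q) (Num.min `|ga sa - q| `|gb sb - q|).
  have M0 : 0 < M by rewrite !lt_min delta0 Q0 da0 db0.
  have N2 : 0 < 64 * N ^+ 2 by rewrite mulr_gt0// exprn_gt0.
  exists (M / (64 * N ^+ 2)).
  have e1 : 64 * N ^+ 2 * (M / (64 * N ^+ 2)) = M by rewrite mulrC divfK// gt_eqF.
  have e2 : 8 * N * (M / (64 * N ^+ 2)) < M.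
    rewrite mulrA ltr_pdivrMr// mulrC ltr_pM2l// expr2.
    have : N <= N * N by rewrite ler_peMl// ltW.
    lra.
  split; first by rewrite divr_gt0.
  - by apply: lt_le_trans e2 _; rewrite /M !ge_min lexx.
  - by apply: lt_le_trans e2 _; rewrite /M !ge_min lexx !orbT.
  - by apply: lt_le_trans e2 _; rewrite /M !ge_min lexx !orbT.
  - by rewrite e1 /M !ge_min lexx !orbT.
(* The distance from q to a face is between w and 2 w.  Lateral faces are closer,
   so that on the box the variation of x_j outweighs that of the other entries. *)
pose w k := if k == j then 4 * N * rho else rho.
have Nrho : rho <= N * rho by rewrite ler_peMl// ltW.
have w_ge k : rho <= w k by rewrite /w; case: ifP => // _; move: Nrho rho0; clear; lra.
have w_le k : w k <= 4 * N * rho by rewrite /w; case: ifP => // _; move: Nrho rho0; clear; lra.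
have w0 k : 0 < w k by exact: lt_le_trans (w_ge k).
(* the part of the box around the face below q, at depth between 4 N rho and
   8 N rho: there the linear term of sqnorm is the dominant one *)
pose slab (x : 'rV[R]_m.+1) := (forall k, k != j -> `|x ord0 k - q ord0 k| <= 2 * rho) /\
  - (8 * N * rho) <= sg * (x ord0 j - q ord0 j) <= - (4 * N * rho).
have sumq (x : 'rV[R]_m.+1) : (forall k, k != j -> `|x ord0 k - q ord0 k| <= 2 * rho) ->
   sqnorm x = 1 + 2 * (Q * (sg * (x ord0 j - q ord0 j))) + 2 * (\sum_(k | k != j) q ord0 k * (x ord0 k - q ord0 k))
     + \sum_k (x ord0 k - q ord0 k) ^+ 2 /\
   `|\sum_(k | k != j) q ord0 k * (x ord0 k - q ord0 k)| <= N * (Q * (2 * rho)).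
  move=> xq; split.
    have -> : Q * (sg * (x ord0 j - q ord0 j)) = q ord0 j * (x ord0 j - q ord0 j) by rewrite [X in _ = X * _]sgQ mulrA (mulrC Q).
    rewrite -addrA -(addrA 1) [X in _ + X]addrA -mulrDr.
    rewrite -(bigD1 j (P := xpredT) (F := fun k => q ord0 k * (x ord0 k - q ord0 k)))//=.
    rewrite -[X in _ = X + _]q1 /sqnorm mulr_sumr -!big_split/=.
    by apply: eq_bigr => k _; ring.
  apply: (le_trans (ler_norm_sum _ _ _)).
  apply: (@le_trans _ _ (\sum_(k < m.+1) Q * (2 * rho))).
    rewrite [leRHS](bigD1 j)//= ler_wpDl//; first by rewrite !mulr_ge0// ltW.
    by apply: ler_sum => k kj; rewrite normrM ler_pM//; exact: xq.
  by rewrite sumr_const card_ord -[leLHS]mulr_natl NE.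
have slab_ball x : slab x -> sqnorm x <= 1 - N * Q * rho.
  move=> [xq /andP[h1 h2]]; have [-> h3] := sumq x xq.
  have h4 : \sum_k (x ord0 k - q ord0 k) ^+ 2 <= N * (8 * N * rho) ^+ 2.
    apply: (@le_trans _ _ (\sum_(k < m.+1) (8 * N * rho) ^+ 2)).
      apply: ler_sum => k _; rewrite -[X in X <= _]real_normK ?num_real//.
      rewrite ler_pXn2r ?nnegrE//; last by rewrite !mulr_ge0// ltW.
      have [->|kj] := eqVneq k j; last by apply: (le_trans (xq _ kj)); move: Nrho rho0; clear; lra.
      by case: sg1 h1 h2 => ->; rewrite ?mul1r ?mulN1r ler_norml; move: Nrho rho0; clear; lra.
    by rewrite sumr_const card_ord -[leLHS]mulr_natl NE.
  have h5 : N * (8 * N * rho) ^+ 2 <= N * Q * rho.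
    rewrite (_ : N * _ = N * rho * (64 * N ^+ 2 * rho)); last by ring.
    rewrite (_ : N * Q * rho = N * rho * Q); last by ring.
    by rewrite ler_wpM2l// mulr_ge0// ltW.
  have h6 : Q * (sg * (x ord0 j - q ord0 j)) <= Q * - (4 * N * rho) by rewrite ler_wpM2l// ltW.
  move: h3; rewrite ler_norml => /andP[_ h3].
  have NQr : 0 <= N * Q * rho by rewrite !mulr_ge0// ltW.
  rewrite (_ : Q * - (4 * N * rho) = - 4 * (N * Q * rho)) in h6; last by ring.
  rewrite (_ : N * (Q * (2 * rho)) = 2 * (N * Q * rho)) in h3; last by ring.
  by move: NQr h3 h4 h5 h6; clear; lra.
have top_out (x : 'rV[R]_m.+1) : (forall k, k != j -> `|x ord0 k - q ord0 k| <= 2 * rho) ->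
    4 * N * rho <= sg * (x ord0 j - q ord0 j) -> 1 < sqnorm x.
  move=> xq h1; have [-> h3] := sumq x xq.
  have h4 : 0 <= \sum_k (x ord0 k - q ord0 k) ^+ 2 by apply: sumr_ge0 => k _; exact: sqr_ge0.
  have h6 : Q * (4 * N * rho) <= Q * (sg * (x ord0 j - q ord0 j)) by rewrite ler_wpM2l// ltW.
  move: h3; rewrite ler_norml => /andP[h3 _].
  have NQr : 0 < N * Q * rho by rewrite !mulr_gt0.
  rewrite (_ : Q * (4 * N * rho) = 4 * (N * Q * rho)) in h6; last by ring.
  rewrite (_ : N * (Q * (2 * rho)) = 2 * (N * Q * rho)) in h3; last by ring.
  by move: NQr h3 h4 h6; clear; lra.
have NQr : 0 < N * Q * rho by rewrite !mulr_gt0.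
have [sa00 _ _ /(_ _ rho0)[s1 s1I gs1]] := cva.
have [sb00 _ _ /(_ _ rho0)[s2 s2I gs2]] := cvb.
have [r1 r11 Hr1] := curve_inside cva s1I.
have [r2 r21 Hr2] := curve_inside cvb s2I.
have [r [rlt1 r1r r2r rs]] : exists r : R, [/\ r < 1, r1 <= r, r2 <= r & 1 - N * Q * rho <= r].
  exists (Num.max (Num.max r1 r2) (1 - N * Q * rho)); split; last 3 first.
  - by rewrite !le_max lexx.
  - by rewrite !le_max lexx !orbT.
  - by rewrite !le_max lexx !orbT.
  by rewrite !gt_max r11 r21/=; move: NQr; clear; lra.
pose W := [set x : 'rV[R]_m.+1 | sqnorm x <= r] `&`
  [set x : 'rV[R]_m.+1 | forall k, q ord0 k - 2 * w k <= x ord0 k <= q ord0 k + 2 * w k].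
pose U := B `&` [set x : 'rV[R]_m.+1 | forall k, q ord0 k - delta < x ord0 k < q ord0 k + delta].
have oU : open U by apply: openI => //; exact: open_slab.
have UB : U `<=` B by move=> x [].
have cW : closed W by apply: closedI; [exact: closed_sqnorm_le|exact: closed_slab].
have kW : compact W by apply: compact_sub_closed_ball cW _ => x [xr _]; rewrite (le_trans xr)// ltW.
have mW : measurable W by exact: closed_measurable_rV.
have WU : W `<=` U.
  move=> x [xr xw]; split; first by apply/unit_ballE; exact: le_lt_trans xr rlt1.
  by move=> k; have := xw k; have := w_le k; move: rd; clear; lra.
have EU : (energy U g < E%:E)%E.
  apply: Hdelta => // x [_ xq]; apply: rV_norm_le => [|k]; first exact: ltW.
  by rewrite !mxE ler_norml; have := xq k; clear; lra.
have sobU := sobolev_restrict sob oU UB.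
have [G [mG G0 GE osc]] := mollify m0 sobU kW WU eta0.
have {}GE := le_lt_trans GE EU.
have pick k (bb : bool) : exists p : R, w k <= (if bb then p - q ord0 k else q ord0 k - p) <= 2 * w k /\
    (\int[lebesgue_rV m]_(z in [set z | W (ins_rV k (p, z))]) G (ins_rV k (p, z)) <= (E / rho)%:E)%E.
  have H c1 c2 : c2 - c1 = w k -> exists2 c, c1 <= c <= c2 &
      (\int[lebesgue_rV m]_(z in [set z | W (ins_rV k (c, z))]) G (ins_rV k (c, z)) <= (E / rho)%:E)%E.
    move=> c12; have c12' : c1 < c2 by have := w0 k; rewrite -c12; clear; lra.
    have [c cI cE] := pick_slice k mW mG G0 GE c12'.
    exists c => //; apply: le_trans cE _; rewrite c12 lee_fin.
    by apply: ler_wpM2l; [exact: ltW|rewrite lef_pV2 ?posrE].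
  case: bb.
    have [|c cI cE] := H (q ord0 k + w k) (q ord0 k + 2 * w k); first by clear; lra.
    by exists c; split => //; move: cI; clear; lra.
  have [|c cI cE] := H (q ord0 k - 2 * w k) (q ord0 k - w k); first by clear; lra.
  by exists c; split => //; move: cI; clear; lra.
have [p Hp] : {p : 'I_m.+1 -> bool -> R | forall k bb,
   w k <= (if bb then p k bb - q ord0 k else q ord0 k - p k bb) <= 2 * w k /\
    (\int[lebesgue_rV m]_(z in [set z | W (ins_rV k (p k bb, z))]) G (ins_rV k (p k bb, z)) <= (E / rho)%:E)%E}.
  exists (fun k => projT1 (choice (pick k))) => k bb.
  exact: projT2 (choice (pick k)) bb.
pose lo k := if k == j then q ord0 j - sg * (6 * N * rho) - 2 * N * rho else q ord0 k - 2 * rho.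
pose hi k := if k == j then q ord0 j - sg * (6 * N * rho) + 2 * N * rho else q ord0 k + 2 * rho.
have lohi k : rho <= hi k - lo k by rewrite /hi /lo; case: ifP => _; move: Nrho rho0; clear; lra.
have slabW (x : 'rV[R]_m.+1) : (forall k, lo k <= x ord0 k <= hi k) -> W x.
  move=> xlh.
  have sx : slab x.
    split; first by move=> k /negbTE kj; have := xlh k; rewrite /lo /hi kj ler_norml; clear; lra.
    by have := xlh j; rewrite /lo /hi eqxx; case: sg1 => ->; clear; lra.
  split; first by rewrite /= (le_trans (slab_ball _ sx)).
  move=> k; have := xlh k; rewrite /lo /hi /w; case: ifP => [/eqP ->|_]; last by clear; lra.
  by case: sg1 => ->; move: Nrho rho0; clear; lra.
have convW (x y : 'rV[R]_m.+1) (s : R) : W x -> W y -> 0 <= s <= 1 -> W (x + s *: (y - x)).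
  move=> [xr xw] [yr yw] s01; have /andP[s0' s1'] := s01.
  split.
    rewrite /= (le_trans (sqnorm_segment _ _ s01))//.
    have h1 : (1 - s) * sqnorm x <= (1 - s) * r by rewrite ler_wpM2l// subr_ge0.
    have h2 : s * sqnorm y <= s * r by rewrite ler_wpM2l.
    by move: h1 h2; clear; lra.
  move=> k; rewrite !mxE; have /andP[hx1 hx2] := xw k; have /andP[hy1 hy2] := yw k.
  set xk := x ord0 k in hx1 hx2 *; set yk := y ord0 k in hy1 hy2 *.
  rewrite (_ : xk + s * (yk - xk) = (1 - s) * xk + s * yk); last by ring.
  have h1 : (1 - s) * (q ord0 k - 2 * w k) <= (1 - s) * xk by rewrite ler_wpM2l// subr_ge0.
  have h2 : s * (q ord0 k - 2 * w k) <= s * yk by rewrite ler_wpM2l.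
  have h3 : (1 - s) * xk <= (1 - s) * (q ord0 k + 2 * w k) by rewrite ler_wpM2l// subr_ge0.
  have h4 : s * yk <= s * (q ord0 k + 2 * w k) by rewrite ler_wpM2l.
  by move: h1 h2 h3 h4; clear; lra.
have osc_face k c : lo k <= c <= hi k ->
    (\int[lebesgue_rV m]_(z in [set z | W (ins_rV k (c, z))]) G (ins_rV k (c, z)) <= (E / rho)%:E)%E ->
    forall x y, W x -> W y -> x ord0 k = c -> y ord0 k = c -> `|u x - u y| <= 3 / 16 * `|a - b|.
  move=> cI cE x y Wx Wy xc yc.
  have mins : measurable_fun setT (fun w : 'rV[R]_m => ins_rV k (c, w)).
    exact: (measurableT_comp (measurable_ins_rV k) (measurable_pair_cst c)).
  have L0 : 0 < 16 * N * rho by rewrite !mulr_gt0.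
  have kap0 : 0 < rho ^+ m by rewrite exprn_gt0.
  have T0 : 0 < theta / rho by rewrite divr_gt0.
  have diamW (x' y' : 'rV[R]_m.+1) l : W x' -> W y' -> `|x' ord0 l - y' ord0 l| <= 16 * N * rho.
    by move=> [_ xw] [_ yw]; rewrite ler_norml; have := xw l; have := yw l; have := w_le l; clear; lra.
  have kD : ((rho ^+ m)%:E <= lebesgue_rV m [set z | W (ins_rV k (c, z))])%E.
    apply: (@le_trans _ _ (lebesgue_rV m (box (\row_l lo (lift k l)) (\row_l hi (lift k l))))).
      rewrite lebesgue_rV_box; last by move=> l; rewrite !mxE; have := lohi (lift k l); move: rho0; clear; lra.
      rewrite lee_fin -[X in _ ^+ X](card_ord m) -prodr_const; apply: ler_prod => l _.
      by rewrite !mxE (ltW rho0)/=; exact: lohi.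
    apply: le_measure; rewrite ?inE//; first exact: measurable_box.
      exact: measurable_preimageT mins mW.
    move=> z zb; apply: slabW => l; have [l' ->|->] := unliftP k l.
      by rewrite ins_rV_lift/=; have := zb l'; rewrite !mxE.
    by rewrite ins_rV_i.
  have := slice_oscillation m0 mG G0 osc (@subset_refl _ W) mW mW convW diamW kap0 kD cE L0 T0 Wx Wy xc yc.
  move=> /le_trans; apply.
  rewrite NE (_ : (theta / rho)^-1 ^+ m * (E / rho / rho ^+ m) = theta / rho); last first.
    have tm0 : theta ^+ m != 0 by rewrite gt_eqF// exprn_gt0.
    rewrite /E -/theta invf_div expr_div_n; field.
    by rewrite tm0 (gt_eqF kap0) (gt_eqF rho0).
  rewrite (_ : 2 * (N ^+ 2 * (16 * N * rho)) * (theta / rho + theta / rho) = 64 * (N ^+ 3 * theta)); last first.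
    by field; rewrite gt_eqF.
  have -> : N ^+ 3 * theta = `|a - b| / K by rewrite /theta; field; rewrite (gt_eqF K0) (gt_eqF N0).
  rewrite K512 /eta; move: D0; clear; move: `|a - b| => d d0.
  rewrite (_ : 64 * (d / (8 * 8 * 8)) = d / 8); last by field.
  lra.
(* the bottom of the box meets every lateral face *)
have m11 : (-1 == 1 :> R) = false by apply/negbTE; rewrite lt_eqF//; clear; lra.
pose b0 := if sg == 1 then false else true.
pose c0 := p j b0.
have c0E : - (8 * N * rho) <= sg * (c0 - q ord0 j) <= - (4 * N * rho).
  have [+ _] := Hp j b0; rewrite /c0 /b0 /w eqxx.
  case: sg1 => ->; rewrite ?eqxx; first by clear; lra.
  by rewrite m11; clear; lra.
have c0lh : lo j <= c0 <= hi j.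
  by move: c0E; rewrite /lo /hi eqxx; case: sg1 => ->; clear; lra.
pose y0 : 'rV[R]_m.+1 := \row_l (if l == j then c0 else q ord0 l).
have qlh l : l != j -> lo l <= q ord0 l <= hi l.
  by move=> /negbTE lj; rewrite /lo /hi lj; move: rho0; clear; lra.
have Wy0 : W y0.
  by apply: slabW => l; rewrite mxE; case: eqVneq => [->//|lj]; exact: qlh.
(* A curve leaves the box through a face; the estimate on that face, then the one
   on the bottom face, carry its value to y0. *)
have reach gam s0 s val : curve_to B q gam s0 -> 0 < s <= s0 -> `|gam s - q| < rho ->
    8 * N * rho < `|gam s0 - q| -> (forall t, s <= t <= s0 -> sqnorm (gam t) <= r) ->
    (forall t, 0 < t <= s0 -> u (gam t) = val) -> `|val - u y0| <= 3 / 8 * `|a - b|.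
  move=> [s00 cg _ _] /andP[s_gt0 ss0] gs gs0 gr gu.
  pose O := [set x : 'rV[R]_m.+1 | forall k, p k false < x ord0 k < p k true].
  pose F := [set x : 'rV[R]_m.+1 | forall k, p k false <= x ord0 k <= p k true].
  have OF : O `<=` F by move=> x Ox k; have /andP[h1 h2] := Ox k; rewrite (ltW h1) (ltW h2).
  have Os : O (gam s).
    move=> k; have := le_lt_trans (coord_norm_le _ k) gs; rewrite !mxE ltr_norml.
    by have [+ _] := Hp k true; have [+ _] := Hp k false; have := w_ge k; clear; lra.
  have nOs0 : ~ O (gam s0).
    move=> Os0; move: gs0; apply/negP; rewrite -leNgt; apply: rV_norm_le => [|k].
      by rewrite !mulr_ge0// ltW.
    rewrite !mxE ler_norml; have := Os0 k.
    by have [+ _] := Hp k true; have [+ _] := Hp k false; have := w_le k; clear; lra.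
  have oO : open O by exact: open_slab.
  have cF : closed F by exact: closed_slab.
  have [t tI [Ft nOt]] := path_crossing ss0 (cg _ s_gt0) oO cF OF Os nOs0.
  have tI' : 0 < t <= s0 by move: tI => /andP[h1 ->]; rewrite (lt_le_trans s_gt0 h1).
  set x := gam t in Ft nOt.
  have Wx : W x.
    split; first exact: gr.
    move=> k; have := Ft k.
    by have [+ _] := Hp k true; have [+ _] := Hp k false; clear; lra.
  have [k [bb xk]] : exists k bb, x ord0 k = p k bb.
    apply: contrapT => H; apply: nOt => k; have /andP[h1 h2] := Ft k.
    rewrite !lt_neqAle h1 h2 !andbT; apply/andP; split; apply/eqP => e; apply: H.
      by exists k, false.
    by exists k, true.
  have ux : val = u x by rewrite gu.
  have [kj|kj] := eqVneq k j.
    have bb0 : p k bb = c0.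
      suff -> : bb = b0 by rewrite kj.
      have lat : forall l, l != j -> `|x ord0 l - q ord0 l| <= 2 * rho.
        move=> l /negbTE lj; have [_ xw] := Wx; have := xw l; rewrite /w lj ler_norml; clear; lra.
      have [xr _] := Wx; have {}xr := le_lt_trans xr rlt1.
      have ntop : sg * (x ord0 j - q ord0 j) < 4 * N * rho.
        by rewrite ltNge; apply/negP => /(top_out x lat); rewrite ltNge (ltW xr).
      rewrite (_ : x ord0 j = p j bb) in ntop; last by rewrite -kj.
      have [+ _] := Hp j bb; move: ntop; rewrite /b0 /w eqxx.
      case: sg1 => ->; rewrite ?eqxx; first by case: (bb) => //; clear; lra.
      by rewrite m11; case: (bb) => //; clear; lra.
    rewrite ux; apply: (@le_trans _ _ (3 / 16 * `|a - b|)); last by move: D0; clear; lra.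
    apply: (osc_face j c0 c0lh (Hp j b0).2) => //; first by rewrite -bb0 -kj.
    by rewrite mxE eqxx.
  pose y1 : 'rV[R]_m.+1 := \row_l (if l == j then c0 else if l == k then p k bb else q ord0 l).
  have klh : lo k <= p k bb <= hi k.
    rewrite /lo /hi (negbTE kj); have [+ _] := Hp k bb; rewrite /w (negbTE kj).
    by case: (bb); move: rho0; clear; lra.
  have Wy1 : W y1.
    apply: slabW => l; rewrite mxE; case: eqVneq => [->//|lj].
    by case: eqVneq => [->//|lk]; exact: qlh.
  have h1 : `|u x - u y1| <= 3 / 16 * `|a - b|.
    by apply: (osc_face k _ klh (Hp k bb).2) => //; rewrite mxE (negbTE kj) eqxx.
  have h2 : `|u y1 - u y0| <= 3 / 16 * `|a - b|.
    by apply: (osc_face j c0 c0lh (Hp j b0).2) => //; rewrite mxE eqxx.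
  rewrite ux; have := ler_normD (u x - u y1) (u y1 - u y0); rewrite addrA subrK.
  by move: h1 h2; clear; lra.
have ra' t : s1 <= t <= sa -> sqnorm (ga t) <= r by move=> /Hr1 /le_trans; apply.
have rb' t : s2 <= t <= sb -> sqnorm (gb t) <= r by move=> /Hr2 /le_trans; apply.
have h1 := reach ga sa s1 a cva s1I gs1 ra ra' ua.
have h2 := reach gb sb s2 b cvb s2I gs2 rb rb' ub.
have := ler_normD (a - u y0) (u y0 - b); rewrite addrA subrK (distrC (u y0) b).
by move: h1 h2 D0; clear; lra.
Qed.

End asymptotic.

(** * Limits at punctured slices *)

Section puncture.
Context {R : realType}.

(** A cluster point along the filter of the sequence. *)
Lemma compact_sequence (T : pseudoMetricType R) (K : set T) (x_ : nat -> T) :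
  compact K -> (forall N, K (x_ N)) ->
  exists2 c, K c & forall (e : R) M, 0 < e -> exists2 N, (M <= N)%N & ball c e (x_ N).
Proof.
move=> cK Kx; have FK : (x_ @ \oo) K by exists 0%N => // N _; exact: Kx.
have [c [Kc clc]] := cK (x_ @ \oo) _ FK.
exists c => // e M e0.
have FM : (x_ @ \oo) [set x_ N | N in [set N | (M <= N)%N]] by exists M => // N MN; exists N.
have [_ [[N /= MN <-] cN]] := clc _ _ FM (nbhsx_ballx c e e0).
by exists N.
Qed.

(** The second component in the splitting R x R^(n-1). *)
Definition tail m (x : 'rV[R]_m.+1) : 'rV[R]_m := \row_l x ord0 (lift ord0 l).

Lemma tail_ins m t (w : 'rV[R]_m) : tail (ins_rV ord0 (t, w)) = w.
Proof. by apply/rowP => l; rewrite mxE ins_rV_lift. Qed.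

Lemma ins_tail m (x : 'rV[R]_m.+1) : ins_rV ord0 (x ord0 ord0, tail x) = x.
Proof.
apply/rowP => j; have [k ->|->] := unliftP ord0 j; last by rewrite ins_rV_i.
by rewrite ins_rV_lift mxE.
Qed.

Lemma tail_le m (x : 'rV[R]_m.+1) : `|tail x| <= `|x|.
Proof. by apply: rV_norm_le => // l; rewrite mxE coord_norm_le. Qed.

Lemma tailB m (x y : 'rV[R]_m.+1) : tail (x - y) = tail x - tail y.
Proof. by apply/rowP => l; rewrite !mxE. Qed.

(** One dominating function for finitely many functions, hence
one slice on which all of them are controlled. *)
Lemma mollify_family m p (Omega K : set 'rV[R]_m.+1) (u : 'I_p -> 'rV[R]_m.+1 -> R)
    (g : 'I_p -> 'I_m.+1 -> 'rV[R]_m.+1 -> R) (eta : R) : (0 < m)%N ->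
  (forall k, sobolev_data Omega (u k) (g k)) -> compact K -> K `<=` Omega -> 0 < eta ->
  exists G : 'rV[R]_m.+1 -> \bar R, [/\ measurable_fun setT G, forall x, (0 <= G x)%E,
    (\int[lebesgue_rV m.+1]_(x in K) G x <= \sum_k energy Omega (g k))%E &
    forall k, osc_bound K (u k) eta G].
Proof.
move=> m0 sob cK KO eta0.
have [G HG] := choice (fun k => mollify m0 (sob k) cK KO eta0).
have mK : measurable K by exact: compact_measurable_rV.
exists (fun x => (\sum_k G k x)%E); split.
- by apply: emeasurable_sum => k; have [] := HG k.
- by move=> x; apply: sume_ge0 => k _; have [_ + _ _] := HG k; exact.
- rewrite ge0_integral_sum//.
  + by apply: lee_sum => k _; have [] := HG k.
  + by move=> k; apply: measurable_funTS; have [] := HG k.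
  + by move=> k x _; have [_ + _ _] := HG k; exact.
move=> k x z L T T0 sK dL; have [mG G0 _ osc] := HG k.
apply: (le_trans (osc x z L T T0 sK dL)).
have L0 : 0 <= L by exact: le_trans (dL ord0).
apply: leeD2l; apply: lee_pmul => //.
- by rewrite lee_fin mulr_ge0// exprn_ge0.
- apply: adde_ge0; first by rewrite lee_fin ltW.
  apply: mule_ge0; first by rewrite lee_fin exprn_ge0// invr_ge0 ltW.
  apply: integral_ge0 => s; rewrite /= in_itv/= => /andP[s0 _].
  by rewrite mule_ge0// lee_fin exprn_ge0.
apply: leeD2l; apply: lee_pmul => //.
- by rewrite lee_fin exprn_ge0// invr_ge0 ltW.
- apply: integral_ge0 => s; rewrite /= in_itv/= => /andP[s0 _].
  by rewrite mule_ge0// lee_fin exprn_ge0.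
have mc (H : 'rV[R]_m.+1 -> \bar R) : measurable_fun setT H ->
    measurable_fun (`[0, 1]%classic : set (measurableTypeR R)) (fun s : measurableTypeR R =>
    ((s ^+ (m * m.+1))%:E * H (x + s ^+ m.+1 *: (z - x))%R)%E).
  move=> mH; apply: measurable_funTS; apply: emeasurable_funM; first exact/measurable_EFinP.
  exact: (measurableT_comp mH (measurable_curve x (z - x) m.+1)).
apply: ge0_le_integral.
- exact: measurable_itv.
- by move=> s; rewrite /= in_itv/= => /andP[s0 _]; rewrite mule_ge0// lee_fin exprn_ge0.
- exact: mc.
- by apply: (mc (fun x => \sum_k G k x)%E); apply: emeasurable_sum => k'; have [] := HG k'.
move=> s; rewrite /= in_itv/= => /andP[s0 _].
apply: lee_pmul => //; first by rewrite lee_fin exprn_ge0.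
rewrite (bigD1 k)//= leeDl//; apply: sume_ge0 => k' _; have [_ + _ _] := HG k'; exact.
Qed.

Definition half_lo m (i : 'I_m) (s : bool) (r l : R) : 'rV[R]_m :=
  \row_k (if (k == i) && s then r else - l).
Definition half_hi m (i : 'I_m) (s : bool) (r l : R) : 'rV[R]_m :=
  \row_k (if (k == i) && ~~ s then - r else l).
(** For the various [i] and signs [s], these convex sets cover the
cube of radius [l] without the open cube of radius [r], and they avoid the
puncture. *)
Definition half_cube m (i : 'I_m) s r l := box (half_lo i s r l) (half_hi i s r l).

(** [mollify_family] needs a compact set, so the tube around the
slit of radius [r] is removed; the slice [t] depends on [r]. *)
Lemma slice_half_cube m p (Omega : set 'rV[R]_m.+1) (u : 'I_p -> 'rV[R]_m.+1 -> R)
    (g : 'I_p -> 'I_m.+1 -> 'rV[R]_m.+1 -> R) (c1 c2 delta E r : R) : (0 < m)%N ->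
  (forall k, sobolev_data Omega (u k) (g k)) -> (\sum_k energy Omega (g k) < E%:E)%E ->
  c1 < c2 -> 0 < r ->
  (forall x : 'rV[R]_m.+1, c1 <= x ord0 ord0 <= c2 -> 0 < `|tail x| <= delta -> Omega x) ->
  exists2 t : R, c1 <= t <= c2 & forall k i s l (theta : R) w w', 0 < theta -> 2 * r <= l -> l <= delta ->
    half_cube i s r l w -> half_cube i s r l w' ->
    `|u k (ins_rV ord0 (t, w)) - u k (ins_rV ord0 (t, w'))| <=
      2 * r + 4 * m.+1%:R ^+ 2 * (theta + (2 / theta) ^+ m * l * (E / (c2 - c1))).
Proof.
move=> m0 sob Eoo c12 r0 KO'.
pose K := [set x : 'rV[R]_m.+1 | c1 <= x ord0 ord0 <= c2 /\ r <= `|tail x| <= delta].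
have tc : continuous (fun x : 'rV[R]_m.+1 => `|tail x|).
  move=> x; apply/rV_cont_at => e e0; exists e => // y yx.
  by rewrite (le_lt_trans (ler_dist_dist _ _))// -tailB (le_lt_trans (tail_le _)).
have cK : closed K.
  rewrite (_ : K = ((fun x : 'rV[R]_m.+1 => x ord0 ord0) @^-1` `[c1, c2]) `&`
     ((fun x : 'rV[R]_m.+1 => `|tail x|) @^-1` `[r, delta])); last first.
    by apply/seteqP; split => x /=; rewrite /K/= !in_itv.
  apply: closedI; (apply: closed_comp; last exact: itv_closed).
    by move=> x _; exact: coord_continuous.
  by move=> x _; exact: tc.
have kK : compact K.
  apply: bounded_closed_compact => //.
  exists (Num.max (Num.max `|c1| `|c2|) delta); split; first exact: num_real.
  move=> M; rewrite !gt_max => /andP[/andP[h1 h2] h3] x [/andP[x1 x2] /andP[_ xd]] /=.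
  apply: rV_norm_le => [|j]; first by rewrite (le_trans (normr_ge0 c1))// ltW.
  have [k ->|->] := unliftP ord0 j.
    rewrite (_ : x ord0 (lift ord0 k) = tail x ord0 k); last by rewrite mxE.
    by rewrite (le_trans (coord_norm_le _ _))// (le_trans xd)// ltW.
  move: h1 h2 x1 x2; clear; rewrite ler_norml !ltr_norml; lra.
have KO : K `<=` Omega.
  by move=> x [xc /andP[xr xd]]; apply: KO' => //; rewrite xd (lt_le_trans r0).
have mK : measurable K by exact: closed_measurable_rV.
have [G [mG G0 GE osc]] := mollify_family m0 sob kK KO r0.
have [t tI tE] := pick_slice ord0 mK mG G0 (le_lt_trans GE Eoo) c12.
exists t => // k i s l theta w w' theta0 rl ld Hw Hw'.
have l0 : 0 < l by move: r0 rl; clear; lra.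
pose a := half_lo i s r l; pose b := half_hi i s r l.
have ab_l j : l / 2 <= b ord0 j - a ord0 j /\ - l <= a ord0 j /\ b ord0 j <= l.
  by rewrite !mxE; case: (j == i); case: (s) => /=; move: r0 rl; clear; lra.
pose W := [set x : 'rV[R]_m.+1 | t <= x ord0 ord0 <= t] `&`
  [set x : 'rV[R]_m.+1 | forall j, a ord0 j <= x ord0 (lift ord0 j) <= b ord0 j].
have mW : measurable W.
  apply: measurableI; first exact: measurable_coord_le.
  by apply: measurable_forall_ord => j; exact: measurable_coord_le.
have WK : W `<=` K.
  move=> x [/= xt xab]; split.
    by have -> : x ord0 ord0 = t by apply: le_anti; rewrite andbC.
  apply/andP; split.
    apply: le_trans (coord_norm_le _ i); rewrite mxE.
    by have := xab i; rewrite !mxE eqxx/= ler_normr; case: (s) => /=; clear; lra.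
  apply: rV_norm_le => [|j]; first by move: l0 ld; clear; lra.
  rewrite mxE ler_norml; have := xab j; have [_ [h1 h2]] := ab_l j; move: h1 h2 ld; clear; lra.
have convW (x y : 'rV[R]_m.+1) (z : R) : W x -> W y -> 0 <= z <= 1 -> W (x + z *: (y - x)).
  have conv1 (A B X Y : R) : 0 <= z <= 1 -> A <= X <= B -> A <= Y <= B -> A <= X + z * (Y - X) <= B.
    clear; move=> /andP[z0 z1] /andP[h1 h2] /andP[h3 h4].
    have : z * A <= z * Y by rewrite ler_wpM2l.
    have : z * Y <= z * B by rewrite ler_wpM2l.
    have : (1 - z) * A <= (1 - z) * X by rewrite ler_wpM2l// subr_ge0.
    have : (1 - z) * X <= (1 - z) * B by rewrite ler_wpM2l// subr_ge0.
    clear; rewrite mulrBr !mulrBl !mul1r; lra.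
  have entry j : (x + z *: (y - x)) ord0 j = x ord0 j + z * (y ord0 j - x ord0 j) by rewrite !mxE.
  move=> [x1 x2] [y1 y2] z01; split; first by rewrite /= entry; exact: conv1.
  by move=> j; rewrite entry; exact: conv1.
have diamW (x y : 'rV[R]_m.+1) j : W x -> W y -> `|x ord0 j - y ord0 j| <= 2 * l.
  move=> [x1 x2] [y1 y2]; rewrite ler_norml; have [j' ->|->] := unliftP ord0 j.
    have := x2 j'; have := y2 j'; have [_ [h1 h2]] := ab_l j'; move: h1 h2; clear; lra.
  by move: x1 y1 l0 => /=; clear; lra.
have WE z : W (ins_rV ord0 (t, z)) <-> half_cube i s r l z.
  split=> [[_ H] j|H]; first by have := H j; rewrite ins_rV_lift.
  split; first by rewrite /= ins_rV_i/= lexx.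
  by move=> j; rewrite ins_rV_lift; exact: H.
have kap0 : 0 < (l / 2) ^+ m by rewrite exprn_gt0// divr_gt0.
have kD : (((l / 2) ^+ m)%:E <= lebesgue_rV m [set z | W (ins_rV ord0 (t, z))])%E.
  rewrite (_ : mkset _ = box a b); last by apply/seteqP; split => z Hz; apply/WE.
  rewrite lebesgue_rV_box; last by move=> j; have [h _] := ab_l j; move: h l0; clear; lra.
  rewrite lee_fin -[X in _ ^+ X](card_ord m) -prodr_const; apply: ler_prod => j _.
  by rewrite divr_ge0 ?(ltW l0)//=; have [] := ab_l j.
have L0 : 0 < 2 * l by rewrite mulr_gt0.
have T0 : 0 < theta / l by rewrite divr_gt0.
have := slice_oscillation m0 mG G0 (osc k) WK mW mK convW diamW kap0 kD tE L0 T0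
  ((WE w).2 Hw) ((WE w').2 Hw') (ins_rV_i _ _) (ins_rV_i _ _).
move=> /le_trans; apply; rewrite le_eqVlt; apply/orP; left; apply/eqP; congr (_ + _).
move: (E / (c2 - c1)) => E1.
rewrite (_ : (theta / l)^-1 ^+ m * (E1 / (l / 2) ^+ m) = (2 / theta) ^+ m * E1); last first.
  have tm0 : theta ^+ m != 0 by rewrite gt_eqF// exprn_gt0.
  have lm0 : l ^+ m != 0 by rewrite gt_eqF// exprn_gt0.
  have two0 : (2 : R) ^+ m != 0 by rewrite gt_eqF// exprn_gt0.
  rewrite invf_div !expr_div_n; field.
  by rewrite lm0 tm0 two0.
move: ((2 / theta) ^+ m) (m.+1%:R) => X N.
by field; rewrite gt_eqF.
Qed.

Lemma half_cubeS m (i : 'I_m) s (r r' l : R) w : r' <= r ->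
  half_cube i s r l w -> half_cube i s r' l w.
Proof.
move=> rr H k; have := H k; rewrite !mxE.
by case: (k == i) => //; case: (s) => //=; move: rr; clear; lra.
Qed.

Lemma in_half_cube m (w : 'rV[R]_m) (l : R) : 0 < `|w| <= l ->
  exists i s, half_cube i s `|w| l w.
Proof.
move=> /andP[w0 wl].
have [i wi] : exists i, `|w| <= `|w ord0 i|.
  apply: contrapT => H; have : `|w| < `|w|; last by rewrite ltxx.
  apply: rV_norm_lt => // i; rewrite ltNge; apply/negP => h; apply: H; by exists i.
exists i, (0 <= w ord0 i) => k; rewrite !mxE.
have := coord_norm_le w k; rewrite ler_norml => /andP[h1 h2].
have [ki|ki] := eqVneq k i => /=; last by move: h1 h2 wl; clear; lra.
rewrite {k}ki in h1 h2 *.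
have [w1|w1] := leP 0 (w ord0 i) => /=.
  by move: wi; rewrite ger0_norm// => wi; rewrite wi; apply: le_trans wl; rewrite (le_trans _ (coord_norm_le w i))// ger0_norm.
move: wi; rewrite ltr0_norm// => wi.
have := coord_norm_le w i; rewrite ltr0_norm//; move: wi wl; clear; lra.
Qed.

(** A point common to two half cubes in different directions. *)
Definition corner m (i j : 'I_m) (s t : bool) (l : R) : 'rV[R]_m :=
  \row_k (if k == i then (if s then l else - l) else if k == j then (if t then l else - l) else 0).

Lemma corner_half_cubes m (i j : 'I_m) s t (r l : R) : i != j -> 0 < r <= l ->
  half_cube i s r l (corner i j s t l) /\ half_cube j t r l (corner i j s t l).
Proof.
move=> ij /andP[r0 rl]; split=> k; rewrite !mxE.
  have [_|_] := eqVneq k i => /=; first by case: (s) => /=; move: r0 rl; clear; lra.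
  by case: (k == j); case: (t) => /=; move: r0 rl; clear; lra.
have [->|_] := eqVneq k j => /=.
  by rewrite eq_sym (negbTE ij); case: (t) => /=; move: r0 rl; clear; lra.
by case: (k == i); case: (s) => /=; move: r0 rl; clear; lra.
Qed.

(** Slices t_N good outside of the tube of radius r_N -> 0
accumulate at some t, and by continuity of f the oscillation bounds pass
to the slice of t, now on all half cubes.  Two points of the punctured cube of
radius l lie in half cubes that are linked by at most three half cubes, which
takes two different coordinate directions.  So f oscillates by at most
3 A (theta + C(theta) l): choose theta, then l. *)
Lemma puncture_limit m (Omega Kb : set 'rV[R]_m.+1) (f : 'rV[R]_m.+1 -> 'rV[R]_m.+1)
    (g : 'I_m.+1 -> 'I_m.+1 -> 'rV[R]_m.+1 -> R) (c1 c2 delta : R) : (1 < m)%N ->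
  (forall k, sobolev_data Omega (fun x => f x ord0 k) (g k)) ->
  (forall k, energy Omega (g k) < +oo)%E ->
  c1 < c2 -> 0 < delta ->
  (forall x : 'rV[R]_m.+1, c1 <= x ord0 ord0 <= c2 -> 0 < `|tail x| <= delta -> Omega x) ->
  compact Kb -> (forall x, Omega x -> Kb (f x)) ->
  exists t q, [/\ c1 <= t <= c2, Kb q & forall e : R, 0 < e -> exists2 d : R, 0 < d <= delta &
    forall w, 0 < `|w| <= d -> `|f (ins_rV ord0 (t, w)) - q| <= e].
Proof.
move=> m1 sob Eoo c12 delta0 cyl cKb fKb.
have m0 : (0 < m)%N by exact: ltnW.
pose u k (x : 'rV[R]_m.+1) := f x ord0 k.
have energy_ge0 k : (0 <= energy Omega (g k))%E.
  apply: sume_ge0 => i _; apply: integral_ge0 => x _; by rewrite lee_fin exprn_ge0.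
have [E EE] : exists E : R, (\sum_k energy Omega (g k) < E%:E)%E.
  have : (\sum_k energy Omega (g k))%E \is a fin_num.
    by apply/sum_fin_numP => k _ _; rewrite ge0_fin_numE.
  move=> /fineK <-; exists (fine (\sum_k energy Omega (g k))%E + 1).
  by rewrite lte_fin ltrDl.
have E0 : 0 <= E.
  by rewrite -lee_fin; apply: le_trans (ltW EE); apply: sume_ge0 => k _.
pose r_ (N : nat) := delta / 2 / N.+1%:R.
have r0 N : 0 < r_ N by rewrite !divr_gt0.
have [t_ Ht_] : {t_ : nat -> R | forall N, c1 <= t_ N <= c2 /\ forall k i s l (theta : R) w w', 0 < theta -> 2 * r_ N <= l -> l <= delta ->
    half_cube i s (r_ N) l w -> half_cube i s (r_ N) l w' ->
    `|u k (ins_rV ord0 (t_ N, w)) - u k (ins_rV ord0 (t_ N, w'))| <=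
      2 * r_ N + 4 * m.+1%:R ^+ 2 * (theta + (2 / theta) ^+ m * l * (E / (c2 - c1)))}.
  have H N := slice_half_cube m0 sob EE c12 (r0 N) cyl.
  have H' N : exists t, c1 <= t <= c2 /\ forall k i s l (theta : R) w w', 0 < theta -> 2 * r_ N <= l -> l <= delta ->
    half_cube i s (r_ N) l w -> half_cube i s (r_ N) l w' ->
    `|u k (ins_rV ord0 (t, w)) - u k (ins_rV ord0 (t, w'))| <=
      2 * r_ N + 4 * m.+1%:R ^+ 2 * (theta + (2 / theta) ^+ m * l * (E / (c2 - c1))).
    by have [t tI tH] := H N; exists t.
  by exists (fun N => projT1 (choice H') N) => N; exact: projT2 (choice H') N.
have [A AE] : exists A : R, 4 * m.+1%:R ^+ 2 = A by eexists.
have A0 : 0 < A by rewrite -AE mulr_gt0// exprn_gt0.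
have [E1 E1E] : exists E1 : R, E / (c2 - c1) = E1 by eexists.
have E10 : 0 <= E1 by rewrite -E1E divr_ge0// subr_ge0 ltW.
rewrite AE E1E in Ht_.
have [t tI tcl] : exists2 t, c1 <= t <= c2 & forall (e : R) M, 0 < e -> exists2 N, (M <= N)%N & `|t - t_ N| < e.
  have [||t tI H] := @compact_sequence R^o `[c1, c2]%classic t_.
  - exact: segment_compact.
  - by move=> N; rewrite /= in_itv/=; exact: (Ht_ N).1.
  exists t; first by move: tI; rewrite /= in_itv.
  by move=> e M e0; have [N MN] := H e M e0; rewrite -ball_normE; exists N.
have r_small (e : R) : 0 < e -> exists M, forall N, (M <= N)%N -> r_ N < e.
  move=> e0; have [M /= _ HM] := near_infty_natSinv_lt (PosNum (divr_gt0 e0 delta0)).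
  exists M => N /HM /=; rewrite /r_ => h.
  have : delta * N.+1%:R^-1 < e by rewrite mulrC -ltr_pdivlMr.
  have : 0 < delta * N.+1%:R^-1 by rewrite mulr_gt0// invr_gt0.
  rewrite [delta / 2 / _]mulrAC; move: (delta / N.+1%:R) => X; clear; lra.
have insD (a b : R) (w : 'rV[R]_m) : `|ins_rV ord0 (a, w) - ins_rV ord0 (b, w)| <= `|a - b|.
  apply: rV_norm_le => // j; rewrite !mxE; case: unliftP => [k|] _ //.
  by rewrite subrr normr0.
have Om (w : 'rV[R]_m) : 0 < `|w| <= delta -> Omega (ins_rV ord0 (t, w)).
  by move=> wd; apply: cyl; rewrite ?ins_rV_i ?tail_ins.
pose B (theta l : R) := A * (theta + (2 / theta) ^+ m * l * E1).
(* the estimates on the slices t_N, with r_N -> 0, pass to the slice of t *)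
have step k i s r l theta (w w' : 'rV[R]_m) : 0 < theta -> 0 < r -> 2 * r <= l -> l <= delta ->
    half_cube i s r l w -> half_cube i s r l w' ->
    `|u k (ins_rV ord0 (t, w)) - u k (ins_rV ord0 (t, w'))| <= B theta l.
  move=> theta0 r00 rl ld Hw Hw'.
  have nz (z : 'rV[R]_m) : half_cube i s r l z -> 0 < `|z| <= delta.
    move=> Hz; apply/andP; split.
      apply: lt_le_trans (coord_norm_le z i); have := Hz i; rewrite !mxE eqxx/= => Hi.
      by rewrite normr_gt0; apply/eqP => zi; move: Hi; rewrite zi; case: (s) => /=; move: r00; clear; lra.
    apply: rV_norm_le => [|k']; first by exact: ltW.
    by have := Hz k'; rewrite !mxE ler_norml; case: (_ == i); case: (s) => /=; move: r00 rl ld; clear; lra.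
  apply/ler_addgt0Pr => e e0.
  have e6 : 0 < e / 6 by rewrite divr_gt0.
  have ucont (z : 'rV[R]_m) : half_cube i s r l z ->
      exists2 d, 0 < d & forall y, `|y - ins_rV ord0 (t, z)| < d -> `|u k y - u k (ins_rV ord0 (t, z))| < e / 6.
    move=> /nz/Om Oz; have [_ cu _ _ _] := sob k.
    by have /rV_cont_at := cu _ Oz; apply.
  have [d1 d10 h1] := ucont _ Hw; have [d2 d20 h2] := ucont _ Hw'.
  have re0 : 0 < Num.min r (e / 6) by rewrite lt_min r00.
  have [M HM] := r_small _ re0.
  have d0 : 0 < Num.min d1 d2 by rewrite lt_min d10.
  have [N MN tN] := tcl _ M d0.
  have := HM N MN; rewrite lt_min => /andP[rN1 rN2].
  move: tN; rewrite lt_min => /andP[tN1 tN2].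
  have rNl : 2 * r_ N <= l by move: rN1 rl; clear; lra.
  have := (Ht_ N).2 k i s l theta w w' theta0 rNl ld
    (half_cubeS (ltW rN1) Hw) (half_cubeS (ltW rN1) Hw').
  rewrite -/(B theta l).
  have {h1} := h1 (ins_rV ord0 (t_ N, w)); rewrite (le_lt_trans (insD _ _ _)) 1?distrC// => /(_ isT).
  have {h2} := h2 (ins_rV ord0 (t_ N, w')); rewrite (le_lt_trans (insD _ _ _)) 1?distrC// => /(_ isT).
  move: (u k (ins_rV ord0 (t_ N, w))) (u k (ins_rV ord0 (t_ N, w'))) => a a'.
  move: (u k _) (u k _) => b b'.
  rewrite (_ : b - b' = (b - a) + ((a - a') + (a' - b'))); last by ring.
  have := ler_normD (b - a) ((a - a') + (a' - b')); have := ler_normD (a - a') (a' - b').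
  rewrite (distrC b a); move: rN2 e0; move: (r_ N) (B theta l) => X Y; clear; lra.
have chain k l theta (w w' : 'rV[R]_m) : 0 < theta -> l <= delta -> 0 < `|w| <= l -> 0 < `|w'| <= l ->
    `|u k (ins_rV ord0 (t, w)) - u k (ins_rV ord0 (t, w'))| <= 3 * B theta l.
  move=> theta0 ld wl wl'.
  have [i [s Hi]] := in_half_cube wl; have [i' [s' Hi']] := in_half_cube wl'.
  pose r := Num.min `|w| `|w'| / 2.
  have rw : r <= `|w|.
    have : Num.min `|w| `|w'| <= `|w| by rewrite ge_min lexx.
    by rewrite /r; move: wl => /andP[+ _]; clear; lra.
  have rw' : r <= `|w'|.
    have : Num.min `|w| `|w'| <= `|w'| by rewrite ge_min lexx orbT.
    by rewrite /r; move: wl' => /andP[+ _]; clear; lra.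
  have r00 : 0 < r by rewrite divr_gt0// lt_min; move: wl wl' => /andP[-> _] /andP[-> _].
  have rl : 2 * r <= l.
    rewrite /r mulrC divfK//; move: wl => /andP[_]; apply: le_trans; by rewrite ge_min lexx.
  have l0 : 0 < l by move: r00 rl; clear; lra.
  have rl' : 0 < r <= l by rewrite r00/=; move: r00 rl; clear; lra.
  have {}Hi := half_cubeS rw Hi; have {}Hi' := half_cubeS rw' Hi'.
  have B0 : 0 <= B theta l.
    have th0 := ltW theta0; have l00 := ltW l0.
    by rewrite mulr_ge0 ?(ltW A0)// addr_ge0// !mulr_ge0// exprn_ge0// divr_ge0.
  have link i1 s1 (z z' : 'rV[R]_m) : half_cube i1 s1 r l z -> half_cube i1 s1 r l z' ->
      `|u k (ins_rV ord0 (t, z)) - u k (ins_rV ord0 (t, z'))| <= B theta l by exact: step.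
  have [ii|ii] := eqVneq i i'.
    have [i'' ii''] : exists i'' : 'I_m, i != i''.
      have [i0|i0] := eqVneq (i : nat) 0%N; first by exists (Ordinal m1); rewrite -val_eqE/= i0.
      by exists (Ordinal m0); rewrite -val_eqE.
    have [p1 p2] := corner_half_cubes s true ii'' rl'.
    have [p3 p4] := corner_half_cubes s' true ii'' rl'.
    have h1 := link _ _ _ _ Hi p1; have h2 := link _ _ _ _ p2 p4.
    rewrite -ii in Hi'; have h3 := link _ _ _ _ p3 Hi'.
    move: h1 h2 h3; move: (u k (ins_rV ord0 (t, w))) (u k (ins_rV ord0 (t, w'))) => c c'.
    move: (u k _) (u k _) => b' b h1 h2 h3.
    have := ler_normD (c - b) (b - b'); have := ler_normD (c - b') (b' - c').
    rewrite !addrA !subrK; move: h1 h2 h3; move: (B theta l) => Y; clear; lra.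
  have [p1 p2] := corner_half_cubes s s' ii rl'.
  have h1 := link _ _ _ _ Hi p1; have h2 := link _ _ _ _ p2 Hi'.
  move: h1 h2; move: (u k (ins_rV ord0 (t, w))) (u k (ins_rV ord0 (t, w'))) => c c'.
  move: (u k _) => b h1 h2.
  have := ler_normD (c - b) (b - c').
  rewrite !addrA !subrK; move: h1 h2 B0; move: (B theta l) => Y; clear; lra.
(* the candidate for the limit comes from one sequence tending to the puncture *)
pose w_ (N : nat) : 'rV[R]_m := const_mx (r_ N).
have w_norm N : `|w_ N| = r_ N by exact: norm_const_row (ltW (r0 N)).
have rd N : r_ N <= delta.
  rewrite /r_ ler_pdivrMr//; have : 1 <= N.+1%:R :> R by rewrite ler1n.
  move: (N.+1%:R) => X X1; have : delta <= delta * X by rewrite ler_peMr// ltW.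
  move: delta0; clear; lra.
have w_I N : 0 < `|w_ N| <= delta by rewrite w_norm r0 rd.
have [q Kq qcl] := compact_sequence cKb (fun N => fKb _ (Om _ (w_I N))).
exists t, q; split => // e e0.
pose theta := e / (12 * A).
have theta0 : 0 < theta by rewrite divr_gt0// mulr_gt0.
pose C := (2 / theta) ^+ m * E1.
have C0 : 0 <= C by rewrite mulr_ge0// exprn_ge0// divr_ge0// ltW.
have C10 : 0 < C + 1 by move: C0; clear; lra.
pose l := Num.min delta (e / (12 * A * (C + 1))).
have l0 : 0 < l by rewrite lt_min delta0 divr_gt0// !mulr_gt0.
have ld : l <= delta by rewrite /l ge_min lexx.
exists l; first by rewrite l0.
have Bsmall : 3 * B theta l <= e / 2.
  have h1 : A * theta = e / 12 by rewrite /theta; field; rewrite gt_eqF.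
  have h2 : A * (C * l) <= e / 12.
    apply: (@le_trans _ _ (A * ((C + 1) * (e / (12 * A * (C + 1)))))); last first.
      by rewrite le_eqVlt; apply/orP; left; apply/eqP; field; rewrite !gt_eqF.
    apply: ler_wpM2l; first exact: ltW.
    apply: ler_pM => //; [exact: ltW|by rewrite lerDl|by rewrite /l ge_min lexx orbT].
  rewrite /B mulrDr h1 (_ : _ * l * E1 = C * l); last by rewrite /C mulrAC.
  by move: h2; clear; lra.
have e2 : 0 < e / 2 by rewrite divr_gt0.
have [M HM] := r_small _ l0.
have [N MN] := qcl _ M e2; rewrite ball_rV => qN.
move=> w wl.
have wlN : 0 < `|w_ N| <= l by rewrite w_norm r0/= ltW// HM.
apply: (@le_trans _ _ (`|f (ins_rV ord0 (t, w)) - f (ins_rV ord0 (t, w_ N))| + `|f (ins_rV ord0 (t, w_ N)) - q|)).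
  by rewrite -{1}(subrK (f (ins_rV ord0 (t, w_ N))) (f (ins_rV ord0 (t, w)))) -addrA ler_normD.
rewrite (splitr e) lerD//; last by rewrite distrC ltW.
apply: rV_norm_le => [|k]; first exact: ltW.
by rewrite !mxE; exact: le_trans (chain k l theta w (w_ N) theta0 ld wl wlN) Bsmall.
Qed.

End puncture.

(** * The two sides of a surface that reaches the sphere at one point *)

Section sides.
Context {R : realType}.

Definition dot n (x y : 'rV[R]_n) : R := \sum_i x ord0 i * y ord0 i.

Lemma dot_lin n (x y q : 'rV[R]_n) (a b : R) :
  dot (a *: x + b *: y) q = a * dot x q + b * dot y q.
Proof.
rewrite /dot !mulr_sumr -big_split/=; apply: eq_bigr => i _; rewrite !mxE; ring.
Qed.

Lemma sqnorm_lin n (x y : 'rV[R]_n) (a b : R) :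
  sqnorm (a *: x + b *: y) = a ^+ 2 * sqnorm x + 2 * (a * b * dot x y) + b ^+ 2 * sqnorm y.
Proof.
rewrite /sqnorm /dot !mulr_sumr -!big_split/=; apply: eq_bigr => i _; rewrite !mxE; ring.
Qed.

Lemma sqnormZ n (x : 'rV[R]_n) (a : R) : sqnorm (a *: x) = a ^+ 2 * sqnorm x.
Proof. by rewrite -[a *: x]addr0 -(scale0r x) sqnorm_lin; ring. Qed.

Lemma dotZ n (x q : 'rV[R]_n) (a : R) : dot (a *: x) q = a * dot x q.
Proof. by rewrite -[a *: x]addr0 -(scale0r x) dot_lin; ring. Qed.

Lemma dotxx n (x : 'rV[R]_n) : dot x x = sqnorm x.
Proof. by []. Qed.

Lemma dot_sqr n (x q : 'rV[R]_n) : sqnorm q = 1 -> dot x q ^+ 2 <= sqnorm x.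
Proof.
move=> q1; have := sqnorm_ge0 (1 *: x + (- dot x q) *: q).
by rewrite sqnorm_lin q1; move: (dot x q) (sqnorm x); clear => c N; lra.
Qed.

(** Near is meant in the sup norm, whence the factor [n]. *)
Lemma dot_near n (x q : 'rV[R]_n) (e : R) : sqnorm q = 1 -> 0 <= e -> `|x - q| <= e ->
  1 - n%:R * e <= dot x q.
Proof.
move=> q1 e0 xq.
have -> : 1 - n%:R * e = \sum_(i < n) (q ord0 i * q ord0 i - e).
  by rewrite mulr_natl big_split/= -/(dot q q) dotxx q1 sumrN sumr_const card_ord.
apply: ler_sum => i _.
have q1' : `|q ord0 i| <= 1 by apply: le_trans (coord_norm_le q i) (sqnorm_norm _); rewrite q1.
have := le_trans (coord_norm_le (x - q) i) xq; rewrite !mxE => h.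
have : `|(q ord0 i - x ord0 i) * q ord0 i| <= e.
  by rewrite normrM distrC -[e]mulr1 ler_pM.
rewrite ler_norml => /andP[_]; move: (x ord0 i) (q ord0 i); clear => X Q.
by rewrite mulrBl; move: (Q * Q) (X * Q) => ? ?; lra.
Qed.

Lemma near_dot n (x q : 'rV[R]_n) (e : R) : sqnorm q = 1 -> sqnorm x < 1 -> 0 < e ->
  1 - e ^+ 2 / 2 < dot x q -> `|x - q| < e.
Proof.
move=> q1 x1 e0 xq.
have H : sqnorm (x - q) < e ^+ 2.
  have -> : x - q = 1 *: x + (- 1) *: q by rewrite scale1r scaleN1r.
  rewrite sqnorm_lin q1; move: xq x1; move: (dot x q) (sqnorm x) (e ^+ 2); clear => c N E; lra.
apply: rV_norm_lt => // i; rewrite -ltr_sqr ?nnegrE ?normr_ge0 ?ltW// real_normK ?num_real//.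
exact: le_lt_trans (coord_sqnorm _ i) H.
Qed.

(** The segment from x to -|x| q, projected radially to the sphere of
radius |x|.  The inner product with [q] does not exceed its initial value, so
the arc remains outside of every cap around [q] that does not contain x. *)
Lemma great_arc n (x q : 'rV[R]_n) : sqnorm q = 1 -> dot x q < Num.sqrt (sqnorm x) ->
  exists gam : R -> 'rV[R]_n, [/\ gam 0 = x, gam 1 = - Num.sqrt (sqnorm x) *: q,
    {in `[0, 1]%classic, continuous gam} &
    forall s, 0 <= s <= 1 -> sqnorm (gam s) = sqnorm x /\ dot (gam s) q <= dot x q].
Proof.
move=> q1 cr; set rho := Num.sqrt (sqnorm x) in cr *; set c := dot x q in cr *.
have rr : rho ^+ 2 = sqnorm x by rewrite sqr_sqrtr// sqnorm_ge0.
have rho_ge0 : 0 <= rho by exact: sqrtr_ge0.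
have c2 : c ^+ 2 <= rho ^+ 2 by rewrite rr dot_sqr.
have rho0 : 0 < rho.
  rewrite lt_neqAle rho_ge0 andbT; apply/eqP => r0; move: c2 cr; rewrite -r0 expr0n/=.
  by move=> c0 c1; have : 0 < c ^+ 2; [rewrite exprn_even_gt0//= lt_eqF|rewrite ltNge c0].
pose w s := (1 - s) *: x + (- (s * rho)) *: q.
pose N s := sqnorm (w s).
have NE s : N s = ((1 - s) * rho) ^+ 2 - 2 * (s * (1 - s) * (rho * c)) + (s * rho) ^+ 2.
  by rewrite /N /w sqnorm_lin q1 -rr -/c; ring.
have N0 s : 0 <= s <= 1 -> 0 < N s.
  move=> /andP[s0 s1].
  have -> : N s = ((1 - 2 * s) * rho) ^+ 2 + 2 * (s * (1 - s) * (rho * (rho - c))).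
    by rewrite NE; ring.
  have h : 0 < rho * (rho - c) by rewrite mulr_gt0// subr_gt0.
  have [s2|s2] := eqVneq (1 - 2 * s) 0.
    have -> : s = 1 / 2 by move: s2; clear; lra.
    by move: h; move: (rho * (rho - c)); clear => X h; lra.
  apply: ltr_wpDr; first by rewrite !mulr_ge0// ?subr_ge0// ltW.
  by rewrite exprn_even_gt0//= mulf_neq0// gt_eqF.
have cw : continuous w.
  move=> s; apply: cvgD; apply: cvgZr_tmp.
    by apply: cvgB; [exact: cvg_cst|exact: cvg_id].
  by apply: cvgN; apply: cvgM; [exact: cvg_id|exact: cvg_cst].
pose gam s := (rho / Num.sqrt (N s)) *: w s.
exists gam; split.
- rewrite /gam /N /w subr0 mul0r oppr0 scale1r scale0r addr0 -/rho divff ?scale1r// gt_eqF//.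
- rewrite /gam; have -> : w 1 = (- rho) *: q by rewrite /w subrr scale0r add0r mul1r.
  have -> : N 1 = rho ^+ 2 by rewrite NE; ring.
  rewrite sqrtr_sqr gtr0_norm// divff ?scale1r// gt_eqF//.
- move=> s; rewrite inE/= in_itv/= => sI.
  have cN : continuous N by move=> z; apply: (@continuous_comp _ _ _ w); [exact: cw|exact: sqnorm_continuous].
  apply: (@cvgZ _ _ R _ _ (fun s => rho / Num.sqrt (N s)) w); last exact: cw.
  apply: cvgM; first exact: cvg_cst.
  apply: cvgV; first by rewrite gt_eqF// sqrtr_gt0 N0.
  by apply: (@continuous_comp _ _ _ N); [exact: cN|exact: sqrt_continuous].
move=> s sI; have N0s := N0 s sI; have [s0 s1] := andP sI.
set M := Num.sqrt (N s); have M0 : 0 < M by rewrite sqrtr_gt0.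
have MM : M ^+ 2 = N s by rewrite sqr_sqrtr// ltW.
rewrite /gam -/M; split.
  by rewrite sqnormZ -/(N s) -MM -rr; field; rewrite gt_eqF.
have -> : dot ((rho / M) *: w s) q = rho * ((1 - s) * c - s * rho) / M.
  by rewrite dotZ /w dot_lin dotxx q1 -/c; field; rewrite gt_eqF.
rewrite ler_pdivrMr//.
have cr2 : 0 <= (rho - c) * (rho + c) by rewrite -subr_sqr subr_ge0.
have [c0|c0] := leP 0 c.
  have : c * ((1 - s) * rho - s * c) <= c * M.
    apply: ler_wpM2l => //; apply: le_trans (ler_norm _) _.
    rewrite -ler_sqr ?nnegrE ?(ltW M0)// real_normK ?num_real// MM -subr_ge0.
    have -> : N s - ((1 - s) * rho - s * c) ^+ 2 = s ^+ 2 * ((rho - c) * (rho + c)) by rewrite NE; ring.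
    by rewrite mulr_ge0// sqr_ge0.
  apply: le_trans; rewrite -subr_ge0.
  have -> : c * ((1 - s) * rho - s * c) - rho * ((1 - s) * c - s * rho) = s * ((rho - c) * (rho + c)) by ring.
  by rewrite mulr_ge0.
have rc : 0 <= rho + c.
  by rewrite -(pmulr_rge0 _ (_ : 0 < rho - c))// subr_gt0.
have Mr : M <= rho.
  rewrite -ler_sqr ?nnegrE ?(ltW M0)// MM -subr_ge0.
  have -> : rho ^+ 2 - N s = 2 * (s * (1 - s) * (rho * (rho + c))) by rewrite NE; ring.
  by rewrite !mulr_ge0// subr_ge0.
have : c * rho <= c * M by rewrite ler_wnM2l// ltW.
apply: le_trans; rewrite -subr_ge0.
have -> : c * rho - rho * ((1 - s) * c - s * rho) = s * (rho * (rho + c)) by ring.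
by rewrite !mulr_ge0.
Qed.

(** [T] separates [I] from its complement and clusters on the sphere
only at [q].  Points close to the sphere with inner product at most k with [q]
can be joined among themselves off [T]: along great arcs to the ray of -q,
and along that ray.  The caps shrink to [q] as k tends to 1, and the side
cannot change with k because these sets increase. *)
Lemma one_sided n (q : 'rV[R]_n) (I T : set 'rV[R]_n) : sqnorm q = 1 ->
  (forall gam : R -> 'rV[R]_n, {in `[0, 1]%classic, continuous gam} ->
    (forall s : R, 0 <= s <= 1 -> sqnorm (gam s) < 1) -> I (gam 0) -> ~ I (gam 1) ->
    exists2 s, 0 <= s <= 1 & T (gam s)) ->
  (forall k : R, 0 <= k < 1 -> exists2 r, r < 1 &
    forall x, T x -> r < sqnorm x < 1 -> k < dot x q) ->
  exists b : bool, forall k : R, 0 <= k < 1 -> exists2 r, r < 1 &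
    forall x, r < sqnorm x < 1 -> dot x q <= k -> if b then I x else ~ I x.
Proof.
move=> q1 cross trace.
have conn k : 0 <= k < 1 -> exists2 r, r < 1 & forall x y : 'rV[R]_n,
    r < sqnorm x < 1 -> dot x q <= k -> r < sqnorm y < 1 -> dot y q <= k -> I x -> I y.
  move=> /andP[k0 k1]; have [r0 r01 tr] := trace k (introT andP (conj k0 k1)).
  exists (Num.max r0 (k ^+ 2)) => [|x y].
    by rewrite gt_max r01/= expr_lt1.
  have k2 (z : 'rV[R]_n) : Num.max r0 (k ^+ 2) < sqnorm z < 1 -> dot z q <= k ->
      [/\ r0 < sqnorm z, sqnorm z < 1, k < Num.sqrt (sqnorm z) & dot z q < Num.sqrt (sqnorm z)].
    rewrite gt_max => /andP[/andP[h1 h2] h3] h4.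
    have h5 : k < Num.sqrt (sqnorm z).
      by rewrite -ltr_sqr ?nnegrE ?sqrtr_ge0// sqr_sqrtr ?sqnorm_ge0.
    by split => //; exact: le_lt_trans h4 h5.
  have step (gam : R -> 'rV[R]_n) : {in `[0, 1]%classic, continuous gam} ->
      (forall s : R, 0 <= s <= 1 -> r0 < sqnorm (gam s) < 1 /\ dot (gam s) q <= k) ->
      I (gam 0) -> I (gam 1).
    move=> cg gs I0; apply: contrapT => I1.
    have [|s sI Ts] := cross gam cg _ I0 I1; first by move=> s /gs[/andP[]].
    have [h1 h2] := gs s sI; have := tr _ Ts h1; by rewrite ltNge h2.
  move=> xr xk yr yk; have [x1 x2 x3 x4] := k2 x xr xk; have [y1 y2 y3 y4] := k2 y yr yk.
  have [ga [ga0 ga1 cga gas]] := great_arc q1 x4.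
  have [gb [gb0 gb1 cgb gbs]] := great_arc q1 y4.
  set X := Num.sqrt (sqnorm x) in x3 ga1; set Y := Num.sqrt (sqnorm y) in y3 gb1.
  have XX : X ^+ 2 = sqnorm x by rewrite sqr_sqrtr ?sqnorm_ge0.
  have YY : Y ^+ 2 = sqnorm y by rewrite sqr_sqrtr ?sqnorm_ge0.
  have h1 : I x -> I (- X *: q).
    rewrite -ga1 -{1}ga0; apply: step => // s /gas[-> h]; rewrite x1 x2; split => //; exact: le_trans h xk.
  have h3 : I (- Y *: q) -> I y.
    rewrite -gb1 -{1}gb0.
    have := step (fun s => gb (1 - s)); rewrite subrr subr0; apply.
      move=> s; rewrite inE/= in_itv/= => sI.
      apply: (@continuous_comp _ _ _ (fun s : R => 1 - s) gb).
        by apply: cvgB; [exact: cvg_cst|exact: cvg_id].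
      by apply: cgb; rewrite inE/= in_itv/=; move: sI; clear; lra.
    move=> s sI; have [|-> h] := gbs (1 - s); first by move: sI; clear; lra.
    by rewrite y1 y2; split => //; exact: le_trans h yk.
  have h2 : I (- X *: q) -> I (- Y *: q).
    have := step (fun s => - ((1 - s) * X + s * Y) *: q).
    rewrite subr0 mul0r mul1r addr0 subrr mul0r mul1r add0r; apply.
      move=> s _; apply: cvgZr_tmp; apply: cvgN; apply: cvgD.
        by apply: cvgM; [apply: cvgB; [exact: cvg_cst|exact: cvg_id]|exact: cvg_cst].
      by apply: cvgM; [exact: cvg_id|exact: cvg_cst].
    move=> s /andP[s0 s1].
    have X0 : 0 <= X by exact: sqrtr_ge0.
    have Y0 : 0 <= Y by exact: sqrtr_ge0.
    have [Z [ZE Zr Z1 Z0]] : exists Z, [/\ (1 - s) * X + s * Y = Z, r0 < Z ^+ 2, Z ^+ 2 < 1 & 0 <= Z].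
      exists ((1 - s) * X + s * Y); have s1' : 0 <= 1 - s by rewrite subr_ge0.
      have Z0 : 0 <= (1 - s) * X + s * Y by rewrite addr_ge0// mulr_ge0.
      have [XY|XY] := leP X Y.
        have le1 : X <= (1 - s) * X + s * Y.
          by have : s * X <= s * Y; [rewrite ler_wpM2l|rewrite mulrBl mul1r; clear; lra].
        have le2 : (1 - s) * X + s * Y <= Y.
          by have : (1 - s) * X <= (1 - s) * Y; [rewrite ler_wpM2l|rewrite [_ * Y]mulrBl mul1r; clear; lra].
        split => //.
          by apply: lt_le_trans x1 _; rewrite -XX ler_sqr ?nnegrE.
        by apply: le_lt_trans y2; rewrite -YY ler_sqr ?nnegrE.
      have le1 : Y <= (1 - s) * X + s * Y.
        by have : (1 - s) * Y <= (1 - s) * X; [rewrite ler_wpM2l// ltW|rewrite [_ * Y]mulrBl mul1r; clear; lra].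
      have le2 : (1 - s) * X + s * Y <= X.
        by have : s * Y <= s * X; [rewrite ler_wpM2l// ltW|rewrite mulrBl mul1r; clear; lra].
      split => //.
        by apply: lt_le_trans y1 _; rewrite -YY ler_sqr ?nnegrE.
      by apply: le_lt_trans x2; rewrite -XX ler_sqr ?nnegrE.
    rewrite ZE sqnormZ dotZ dotxx q1 !mulr1 sqrrN; split; first by rewrite Zr.
    by apply: le_trans k0; rewrite oppr_le0.
  by move=> /h1/h2/h3.
have [H|/existsNP[k0]] := pselect (forall k : R, 0 <= k < 1 -> exists2 r, r < 1 &
    forall x, r < sqnorm x < 1 -> dot x q <= k -> ~ I x); first by exists false.
move=> /not_implyP[k0I nk0]; exists true => k kI.
have [r r1 Hr] : exists2 r, r < 1 & forall x y : 'rV[R]_n, r < sqnorm x < 1 ->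
    dot x q <= k0 -> r < sqnorm y < 1 -> dot y q <= k -> I x -> I y.
  have [kk|kk] := leP k0 k.
    have [r r1 Hr] := conn k kI; exists r => // x y h1 h2; apply: Hr => //; exact: le_trans h2 kk.
  have [r r1 Hr] := conn k0 k0I; exists r => // x y h1 h2 h3 h4; apply: Hr => //.
  by apply: le_trans h4 _; exact: ltW.
exists r => // y h3 h4; apply: contrapT => nIy; apply: nk0; exists r => // x h1 h2 Ix.
by apply: nIy; exact: Hr h1 h2 h3 h4 Ix.
Qed.

(** * The ball and the slit ball *)

(** Finiteness of the L^n norm is restated as finiteness of
the integral of an integer power. *)
Lemma W1p_sobolev_data n (X : set 'rV[R]_n) (u : 'rV[R]_n -> R) : (0 < n)%N -> open X ->
  (forall x, X x -> {for x, continuous u}) -> W1p n%:R%:E X u ->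
  exists g, sobolev_data X u g /\ (energy X g < +oo)%E.
Proof.
move=> n0 oX cu [Lu Hg].
have [g Hg'] := choice (fun i => let: ex_intro2 g a b := Hg i in ex_intro (fun g => Lp_on n%:R%:E X g /\ weak_partial X i u g) g (conj a b)).
have meas (v : 'rV[R]_n -> R) : Lp_on n%:R%:E X v -> measurable_fun setT (v \_ X).
  by rewrite /Lp_on inE => /andP[+ _]; rewrite inE.
exists g; split.
  split => // [|i|i]; first exact: meas.
    by apply: meas; have [] := Hg' i.
  by have [] := Hg' i.
have int_ge0 i : (0 <= \int[lebesgue_rV n]_(y in X) (`|g i y| ^+ n)%:E)%E.
  by apply: integral_ge0 => x _; rewrite lee_fin exprn_ge0.
rewrite -ge0_fin_numE; last by apply: sume_ge0.
apply/sum_fin_numP => i _ _; rewrite ge0_fin_numE//.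
have [+ _] := Hg' i; rewrite /Lp_on inE => /andP[_]; rewrite inE/= /finite_norm => fin.
have := poweR_lty n%:R fin; rewrite poweR_Lnorm ?pnatr_eq0 -?lt0n//.
apply: le_lt_trans; rewrite le_eqVlt; apply/orP; left; apply/eqP.
rewrite [LHS]integral_mkcond. apply: eq_integral => x _ /=; rewrite !patchE.
case: ifPn => _; first by rewrite powR_mulrn.
by rewrite normr0 powR0// pnatr_eq0 -lt0n.
Qed.


(** Inside the ball the bound t < 1 is automatic, so the slit can be
replaced by a closed set. *)
Lemma slitE m (x : 'rV[R]_m.+1) : unit_ball R m.+1 x ->
  slit R m.+1 x <-> forall k, 0 <= x ord0 k <= (k == ord0)%:R.
Proof.
move=> /unit_ballE Bx; split=> [[t /=]|H].
  rewrite in_itv/= => /andP[t0 t1] <- k; rewrite mxE -val_eqE/=.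
  by case: (nat_of_ord k == 0)%N; rewrite ?lexx// t0 ltW.
exists (x ord0 ord0).
  rewrite /= in_itv/=; have /andP[-> _] := H ord0; rewrite ltNge; apply/negP => x1.
  have := le_lt_trans (coord_sqnorm x ord0) Bx; rewrite ltNge.
  by rewrite -[leLHS](expr1n _ 2) ler_sqr ?nnegrE// (le_trans _ x1).
apply/rowP => k; rewrite mxE; have := H k; rewrite -val_eqE/=.
case: eqP => [k0 _|_]; first by congr (x _ _); exact/val_inj.
by move=> h; apply/eqP; rewrite eq_le.
Qed.

Lemma open_slit_ball m : open (unit_ball R m.+1 `\` slit R m.+1).
Proof.
rewrite (_ : _ `\` _ = unit_ball R m.+1 `&`
   ~` [set x : 'rV[R]_m.+1 | forall k, 0 <= x ord0 k <= (k == ord0)%:R]).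
  by apply: openI; [exact: open_unit_ball|apply: closed_openC; exact: closed_slab].
by apply/seteqP; split => x [Bx H]; split => //; move=> /(slitE Bx).
Qed.

(** The points of [Y] where the inequality fails form the image
under [h] of a compact set. *)
Lemma inverse_proper n (Y : set 'rV[R]_n) h f z (r : R) :
  homeomorphism_onto (unit_ball R n) Y h f -> ~ Y z -> r < 1 ->
  exists2 d : R, 0 < d & forall y, Y y -> `|y - z| < d -> r < sqnorm (f y).
Proof.
move=> [hY hf ch _] nYz r1.
pose K := [set x : 'rV[R]_n | sqnorm x <= r].
have KB : K `<=` unit_ball R n by move=> x xr; apply/unit_ballE; exact: le_lt_trans xr r1.
have cK : compact K.
  by apply: compact_sub_closed_ball; [exact: closed_sqnorm_le|move=> x /le_trans; apply; exact: ltW].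
have chK : compact (h @` K).
  by apply: continuous_compact => //; exact: continuous_subspaceW KB ch.
have ohK : open (~` (h @` K)) by apply: closed_openC; apply: compact_closed chK; exact: norm_hausdorff.
have nz : (~` (h @` K)) z by move=> [x Kx xz]; apply: nYz; rewrite -hY -xz; exists x => //; exact: KB.
have /nbhs_ballP[d d0 dz] := open_nbhs_nbhs (conj ohK nz).
exists d => // y Yy yz; rewrite ltNge; apply/negP => fyr.
have : (~` (h @` K)) y by apply: dz; rewrite ball_rV distrC.
apply; move: Yy; rewrite -hY => -[x Bx xy]; exists x => //.
by rewrite /K/= -(hf x) ?xy// inE.
Qed.

Lemma sqnorm_tail m (x : 'rV[R]_m.+1) : sqnorm x = x ord0 ord0 ^+ 2 + sqnorm (tail x).
Proof. by rewrite /sqnorm big_ord_recl; congr (_ + _); apply: eq_bigr => i _; rewrite mxE. Qed.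

Lemma sqnorm_le_norm n (x : 'rV[R]_n) (d : R) : `|x| <= d -> sqnorm x <= n%:R * d ^+ 2.
Proof.
move=> xd; rewrite mulr_natl -[n in leRHS]card_ord -sumr_const; apply: ler_sum => i _.
rewrite -real_normK ?num_real// ler_sqr ?nnegrE//; first exact: le_trans (coord_norm_le x i) xd.
by rewrite (le_trans _ xd).
Qed.

(** The slice t is found between 1/8 and 1/4.  The
curves (a, s, ..., s), s -> 0, with 0 < a < t run inside of the box; those with
a = 1/2 and a = 3/4 run outside. *)
Lemma no_biconformal_homeomorphism m : (1 < m)%N ->
  ~ same_biconformal_type (unit_ball R m.+1) (unit_ball R m.+1 `\` slit R m.+1).
Proof.
move=> m1 [h [f [homeo Wh Wf]]].
have m0 : (0 < m)%N by exact: ltnW.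
set B := unit_ball R m.+1 in homeo Wh Wf *; set Y := B `\` _ in homeo Wf *.
have oB : open B by exact: open_unit_ball.
have oY : open Y by exact: open_slit_ball.
have proper z r := @inverse_proper m.+1 Y h f z r homeo.
have [hY fh ch cf] := homeo.
have Yh x : B x -> Y (h x) by move=> Bx; rewrite -hY; exists x.
have {}fh x : B x -> f (h x) = x by move=> Bx; apply: fh; rewrite inE.
have Bf y : Y y -> B (f y) by rewrite -hY => -[x Bx <-]; rewrite fh.
have hf y : Y y -> h (f y) = y by rewrite -hY => -[x Bx <-]; rewrite fh.
have {}ch x : B x -> {for x, continuous h}.
  by move=> Bx; move: ch; rewrite continuous_open_subspace//; apply; rewrite inE.
have {}cf y : Y y -> {for y, continuous f}.
  by move=> Yy; move: cf; rewrite continuous_open_subspace//; apply; rewrite inE.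
have sobh : exists g, sobolev_data B (fun x => h x ord0 ord0) g /\ (energy B g < +oo)%E.
  apply: W1p_sobolev_data => // x Bx.
  by apply: (@continuous_comp _ _ _ h (fun y : 'rV[R]_m.+1 => y ord0 ord0)); [exact: ch|exact: coord_continuous].
have sobf k : exists g, sobolev_data Y (fun x => f x ord0 k) g /\ (energy Y g < +oo)%E.
  apply: W1p_sobolev_data => // x Yx.
  by apply: (@continuous_comp _ _ _ f (fun y : 'rV[R]_m.+1 => y ord0 k)); [exact: cf|exact: coord_continuous].
have [gf Hgf] := choice sobf.
(* small enough for the closed box and the final curves to lie in the ball *)
pose delta : R := 1 / 4 / m.+1%:R.
have N1 : 1 <= m.+1%:R :> R by rewrite ler1n.
have N0 : 0 < m.+1%:R :> R by [].
have delta0 : 0 < delta by rewrite !divr_gt0.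
have delta4 : delta <= 1 / 4.
  by rewrite /delta ler_pdivrMr//; move: N1; clear; lra.
have md : m%:R * delta ^+ 2 <= 1 / 16.
  apply: (@le_trans _ _ (m.+1%:R * delta * delta)).
    by rewrite expr2 -mulrA ler_wpM2r ?sqr_ge0// ?ler_nat// -expr2 sqr_ge0.
  have -> : m.+1%:R * delta = 1 / 4 by rewrite /delta mulrC divfK// gt_eqF.
  by move: delta4; clear; lra.
have inB (x : 'rV[R]_m.+1) (a : R) : `|x ord0 ord0| <= a -> a ^+ 2 < 15 / 16 -> `|tail x| <= delta -> B x.
  move=> xa a2 xd; apply/unit_ballE; rewrite sqnorm_tail.
  have h1 : x ord0 ord0 ^+ 2 <= a ^+ 2.
    by rewrite -real_normK ?num_real// ler_sqr ?nnegrE// (le_trans _ xa).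
  by have := sqnorm_le_norm xd; move: h1 a2 md; clear; lra.
have inY (x : 'rV[R]_m.+1) (a : R) : `|x ord0 ord0| <= a -> a ^+ 2 < 15 / 16 -> 0 < `|tail x| <= delta -> Y x.
  move=> xa a2 /andP[x0 xd]; have Bx := inB x a xa a2 xd; split => // /(slitE Bx) Sx.
  move: x0; rewrite normr_gt0 => /eqP; apply; apply/rowP => l; rewrite !mxE.
  by have := Sx (lift ord0 l); rewrite /= => h0; apply/eqP; rewrite eq_le andbC.
have c2 : (1 / 4) ^+ 2 < 15 / 16 :> R by rewrite expr2; lra.
have cyl (x : 'rV[R]_m.+1) : 1 / 8 <= x ord0 ord0 <= 1 / 4 -> 0 < `|tail x| <= delta -> Y x.
  by move=> xI; apply: (inY x (1 / 4)) => //; rewrite ler_norml; move: xI; clear; lra.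
have cK : compact [set x : 'rV[R]_m.+1 | sqnorm x <= 1].
  by apply: compact_sub_closed_ball => //; exact: closed_sqnorm_le.
have fK x : Y x -> [set x : 'rV[R]_m.+1 | sqnorm x <= 1] (f x) by move=> /Bf /unit_ballE /ltW.
have c12 : 1 / 8 < 1 / 4 :> R by lra.
have [t [q [tI Kq lim]]] := puncture_limit m1 (fun k => (Hgf k).1) (fun k => (Hgf k).2)
  c12 delta0 cyl cK fK.
have t0 : 0 < t by move: tI; clear; lra.
have t1 : t <= 1 / 4 by move: tI; clear; lra.
have nY a : 0 <= a < 1 -> ~ Y (ins_rV ord0 (a, 0)).
  move=> aI [Bx]; apply; apply/(slitE Bx) => k.
  have [j ->|->] := unliftP ord0 k; first by rewrite ins_rV_lift mxE lexx.
  by rewrite ins_rV_i/=; move: aI; clear; lra.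
have insB a (w w' : 'rV[R]_m) : ins_rV ord0 (a, w) - ins_rV ord0 (a, w') = ins_rV ord0 (0, w - w').
  by apply/rowP => k; have [j ->|->] := unliftP ord0 k; rewrite !mxE ?liftK ?unlift_none/= ?mxE ?subrr.
have ins_norm (w : 'rV[R]_m) : `|ins_rV ord0 (0, w)| = `|w|.
  apply/le_anti/andP; split; last by rewrite -{1}(tail_ins 0 w) tail_le.
  apply: rV_norm_le => // k; have [j ->|->] := unliftP ord0 k; first by rewrite ins_rV_lift coord_norm_le.
  by rewrite ins_rV_i/= normr0.
have cs (s : R) : 0 < s -> `|const_mx s : 'rV[R]_m| = s by move=> s0; exact: norm_const_row (ltW s0).
have near0 e : 0 < e -> exists2 d, 0 < d <= delta & forall w : 'rV[R]_m, 0 < `|w| <= d ->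
    Y (ins_rV ord0 (t, w)) /\ `|f (ins_rV ord0 (t, w)) - q| <= e.
  move=> e0; have [d dI dH] := lim e e0; exists d => // w wI; split; last exact: dH.
  apply: cyl; rewrite ?ins_rV_i ?tail_ins//; move: dI wI; clear; lra.
(* f leaves every compact subset of the ball near the puncture *)
have q1 : sqnorm q = 1.
  apply/eqP; rewrite eq_le Kq/= leNgt; apply/negP => qlt.
  pose r := (sqnorm q + 1) / 2.
  have r1 : r < 1 by rewrite /r; move: qlt; clear; lra.
  have tI' : 0 <= t < 1 by move: t0 t1; clear; lra.
  have [d d0 dH] := proper _ r (nY t tI') r1.
  have qr : 0 < r - sqnorm q by rewrite /r; move: qlt; clear; lra.
  have /rV_cont_at/(_ _ qr)[e e0 eH] := @sqnorm_continuous R m.+1 q.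
  have e2 : 0 < e / 2 by rewrite divr_gt0.
  have [d' /andP[d'0 d'1] d'H] := near0 _ e2.
  pose s := Num.min (d / 2) d'.
  have s0 : 0 < s by rewrite lt_min d'0 divr_gt0.
  have [sd sd'] : s < d /\ s <= d'.
    split; last by rewrite ge_min lexx orbT.
    by apply: (@le_lt_trans _ _ (d / 2)); [rewrite ge_min lexx|move: d0; clear; lra].
  have [|Yw wq] := d'H (const_mx s); first by rewrite cs// s0.
  have h1 : r < sqnorm (f (ins_rV ord0 (t, const_mx s))).
    by apply: dH => //; rewrite insB subr0 ins_norm cs.
  have := eH (f (ins_rV ord0 (t, const_mx s))); rewrite (le_lt_trans wq); last by move: e0; clear; lra.
  move=> /(_ isT); rewrite ltr_norml => /andP[_]; move: h1; clear; lra.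
(* the open box O and its closure F, with the puncture on the top face *)
pose lo := fun k : 'I_m.+1 => - delta.
pose hi := fun k : 'I_m.+1 => if k == ord0 then t else delta.
pose O := [set y : 'rV[R]_m.+1 | forall k, lo k < y ord0 k < hi k].
pose F := [set y : 'rV[R]_m.+1 | forall k, lo k <= y ord0 k <= hi k].
have oO : open O by exact: open_slab.
have cF : closed F by exact: closed_slab.
have OF : O `<=` F by move=> x Ox k; have /andP[/ltW-> /ltW->] := Ox k.
have F4 y : F y -> `|y ord0 ord0| <= 1 / 4 /\ `|tail y| <= delta.
  move=> Fy; split.
    by have := Fy ord0; rewrite /lo /hi eqxx ler_norml; move: t1 delta4; clear; lra.
  apply: rV_norm_le => [|l]; first exact: ltW.
  by rewrite mxE ler_norml; exact: Fy.
have cross (gam : R -> 'rV[R]_m.+1) : {in `[0, 1]%classic, continuous gam} ->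
    (forall s : R, 0 <= s <= 1 -> sqnorm (gam s) < 1) -> O (h (gam 0)) -> ~ O (h (gam 1)) ->
    exists2 s, 0 <= s <= 1 & (F `\` O) (h (gam s)).
  move=> cg gB O0 O1.
  have chg : {within `[0, 1], continuous (h \o gam)}.
    apply: continuous_in_subspaceT => s; rewrite inE/= in_itv/= => sI.
    apply: (@continuous_comp _ _ _ gam h); first by apply: cg; rewrite inE/= in_itv.
    by apply: ch; apply/unit_ballE; exact: gB.
  by have [s sI [Fs nOs]] := path_crossing ler01 chg oO cF OF O0 O1; exists s.
(* Near the puncture, the surface is in the slice of t, where f is close to q.  The
   rest of it is compact in B minus the slit, so f keeps it away from the sphere. *)
have trace (k : R) : 0 <= k < 1 -> exists2 r, r < 1 &
    forall x, (F `\` O) (h x) -> r < sqnorm x < 1 -> k < dot x q.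
  move=> /andP[_ k1].
  pose e := (1 - k) / 2 / m.+1%:R.
  have e0 : 0 < e by rewrite !divr_gt0// subr_gt0.
  have [d /andP[d0 dd] dH] := near0 _ e0.
  pose lo' := fun k : 'I_m.+1 => if k == ord0 then - delta else - d.
  pose hi' := fun k : 'I_m.+1 => if k == ord0 then 1 else d.
  pose V := [set y : 'rV[R]_m.+1 | forall k, lo' k < y ord0 k < hi' k].
  have oV : open V by exact: open_slab.
  pose K := F `&` (~` O `&` ~` V).
  have KY : K `<=` Y.
    move=> y [Fy [_ nV]]; have [y0 yt] := F4 y Fy.
    split=> [|/slitE Sy]; first exact: (inB y (1 / 4)).
    have {Sy} Sy := Sy (inB y (1 / 4) y0 c2 yt).
    apply: nV => l; rewrite /lo' /hi'; have := Sy l; case: eqP => [->|_]; last first.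
      by move: d0; clear; rewrite /=; lra.
    by move: y0 delta0; rewrite ler_norml; clear; lra.
  have cKK : compact K.
    apply: compact_sub_closed_ball => [|y [Fy _]].
      by apply: closedI => //; apply: closedI; exact: open_closedC.
    have [y0 yt] := F4 y Fy; apply/ltW/unit_ballE; exact: (inB y (1 / 4)).
  have [r r1 rH] : exists2 r, r < 1 & forall y, K y -> sqnorm (f y) <= r.
    have [K0|/set0P/negP] := pselect (K !=set0); last first.
      rewrite negbK => /eqP K0; exists 0 => // y; by rewrite K0.
    have [|c Kc cmax] := @EVT_max_rV R m.+1 (sqnorm (n:=m.+1) \o f) K K0 cKK.
      apply: continuous_in_subspaceT => y; rewrite inE => Ky.
      by apply: (@continuous_comp _ _ _ f); [exact/cf/KY|exact: sqnorm_continuous].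
    rewrite inE in Kc; exists (sqnorm (f c)); first by apply/unit_ballE/Bf/KY.
    by move=> y Ky; apply: cmax; rewrite inE.
  exists r => // x [Fx nOx] /andP[rx x1].
  have Bx : B x by exact/unit_ballE.
  have Vx : V (h x).
    apply: contrapT => nV; have /rH : K (h x) by [].
    by rewrite fh// leNgt rx.
  have xt : (h x) ord0 ord0 = t.
    apply: contrapT => xt; apply: nOx => l; have := Vx l; have := Fx l; rewrite /lo /hi /lo' /hi'.
    case: eqP => [->|_]; last by move: dd; clear; lra.
    move=> /andP[_ h1] /andP[-> _]; rewrite lt_neqAle h1 andbT; exact/eqP.
  have := dH (tail (h x)); rewrite -xt ins_tail fh// => /(_ _)[].
    apply/andP; split; last first.
      apply: rV_norm_le => [|l]; first exact: ltW.
      by rewrite mxE ler_norml; have := Vx (lift ord0 l); rewrite /lo' /hi'/=; clear; lra.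
    rewrite normr_gt0; apply/eqP => tx.
    have : Y (h x) by exact: Yh.
    rewrite -[h x]ins_tail tx; apply: nY; rewrite xt; move: t0 t1; clear; lra.
  move=> _ xq; apply: lt_le_trans (dot_near q1 (ltW e0) xq).
  by rewrite /e [_ * (_ / _)]mulrC divfK ?gt_eqF//; move: k1; clear; lra.
have [b Hb] := @one_sided m.+1 q (h @^-1` O) (h @^-1` (F `\` O)) q1 cross trace.
pose D y := if b then ~ O y else O y.
pose c a (s : R) : 'rV[R]_m.+1 := ins_rV ord0 (a, const_mx s).
have Yc a s : 0 <= a < 1 -> a ^+ 2 < 15 / 16 -> 0 < s <= delta / 2 -> Y (c a s).
  move=> a01 a2 sI; apply: (inY _ a) => //; rewrite ?ins_rV_i ?tail_ins/=.
    by rewrite ger0_norm//; case/andP: a01.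
  by rewrite cs; move: sI delta0; clear; lra.
have curve a : 0 <= a < 1 -> a ^+ 2 < 15 / 16 -> (forall s, 0 < s <= delta / 2 -> D (c a s)) ->
    curve_to B q (f \o c a) (delta / 2).
  move=> a01 a2 Da.
  have cc : continuous (c a).
    move=> s; have -> : c a = fun s => ins_rV ord0 (a, 0) + s *: ins_rV ord0 (0, const_mx 1).
      apply/funext => z; apply/rowP => k; have [j ->|->] := unliftP ord0 k; rewrite !mxE ?liftK ?unlift_none/= ?mxE; ring.
    apply: cvgD; first exact: cvg_cst.
    by apply: cvgZr_tmp; exact: cvg_id.
  split => [|s1 s10|s sI|e e0]; first by rewrite divr_gt0.
  - apply: continuous_in_subspaceT => s; rewrite inE/= in_itv/= => /andP[h1 h2].
    apply: (@continuous_comp _ _ _ (c a) f); first exact: cc.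
    by apply/cf/Yc => //; rewrite (lt_le_trans s10 h1).
  - by apply/Bf/Yc.
  pose k := Num.max 0 (1 - e ^+ 2 / 2).
  have k01 : 0 <= k < 1.
    by rewrite le_max lexx/= gt_max ltr01/=; have : 0 < e ^+ 2; [rewrite exprn_gt0|clear; lra].
  have [r r1 rH] := Hb k k01.
  have [d d0 dH] := proper _ r (nY a a01) r1.
  have d20 : 0 < delta / 2 by rewrite divr_gt0.
  pose s := Num.min (delta / 2) (d / 2).
  have s0 : 0 < s by rewrite lt_min d20 divr_gt0.
  have [sd sd'] : s < d /\ s <= delta / 2.
    split; last by rewrite ge_min lexx.
    by apply: (@le_lt_trans _ _ (d / 2)); [rewrite ge_min lexx orbT|move: d0; clear; lra].
  have sI : 0 < s <= delta / 2 by rewrite s0.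
  exists s => //; have Ys := Yc a s a01 a2 sI.
  have x1 : sqnorm (f (c a s)) < 1 by apply/unit_ballE; exact: Bf.
  apply: near_dot => //.
  apply: (@le_lt_trans _ _ k); first by rewrite le_max lexx orbT.
  rewrite ltNge; apply/negP => xk.
  have rx : r < sqnorm (f (c a s)) by apply: dH => //; rewrite insB subr0 ins_norm cs.
  have := rH _ (introT andP (conj rx x1)) xk; have := Da s sI; rewrite /D /=.
  by case: (b); rewrite hf.
have [g [sob Eg]] := sobh.
have coincide a a' : 0 <= a < 1 -> a ^+ 2 < 15 / 16 -> 0 <= a' < 1 -> a' ^+ 2 < 15 / 16 ->
    (forall s, 0 < s <= delta / 2 -> D (c a s)) -> (forall s, 0 < s <= delta / 2 -> D (c a' s)) -> a = a'.
  move=> a01 a2 a01' a2' Da Da'.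
  apply: (asymptotic_values_coincide m0 sob Eg q1 (curve a a01 a2 Da) _ (curve a' a01' a2' Da') _) => s sI.
    by rewrite /= hf ?ins_rV_i//; exact: Yc.
  by rewrite /= hf ?ins_rV_i//; exact: Yc.
move: coincide; rewrite /D; case: (b) => coincide.
  have outside a : 1 / 4 <= a -> forall s, 0 < s <= delta / 2 -> ~ O (c a s).
    by move=> ha s _ /(_ ord0); rewrite ins_rV_i /hi eqxx/=; move: ha t1; clear; lra.
  have := coincide (1 / 2) (3 / 4); rewrite !expr2.
  move=> H; suff : 1 / 2 = 3 / 4 :> R by clear; lra.
  by apply: H; try (by clear; lra); apply: outside; clear; lra.
have inside a : 0 < a < t -> forall s, 0 < s <= delta / 2 -> O (c a s).
  move=> ha s sI k; rewrite /lo /hi; have [j ->|->] := unliftP ord0 k.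
    by rewrite ins_rV_lift mxE/=; move: sI delta0; clear; lra.
  by rewrite ins_rV_i eqxx/=; move: ha delta0; clear; lra.
have tsq a : 0 < a < t -> 0 <= a < 1 /\ a ^+ 2 < 15 / 16.
  move=> ha; split; first by move: ha t1; clear; lra.
  apply: le_lt_trans c2; rewrite ler_sqr ?nnegrE; move: ha t1; clear; lra.
have h1 : 0 < t / 3 < t by move: t0; clear; lra.
have h2 : 0 < t / 2 < t by move: t0; clear; lra.
have := coincide (t / 3) (t / 2) (tsq _ h1).1 (tsq _ h1).2 (tsq _ h2).1 (tsq _ h2).2 (inside _ h1) (inside _ h2).
by move: t0; clear; lra.
Qed.

End sides.

Theorem theorem1p6 (R : realType) (n : nat) (hn : (3 <= n)%N) :
  ~ same_biconformal_type (unit_ball R n) (unit_ball R n `\` slit R n).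
Proof.
case: n hn => // m; rewrite ltnS; exact: no_biconformal_homeomorphism.
Qed.
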